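(* Let $\gamma>-1$. A function $\psi\in \mu^{2\gamma+1}C_{\alpha,+,+}^\infty(\partial_+ S\mathbb{D})$ belongs to the range of $I_0 d^\gamma$ on $C^\infty(\mathbb{D})$ (i.e. $\psi=I_0(d^\gamma f)$ for some $f\in C^\infty(\mathbb{D})$) if and only if $$\langle \psi, \psi_{n,k}^\gamma \rangle_{L^2(\partial_+ S\mathbb{D}, \mu^{-2\gamma})} = 0 \qquad \text{for all } n\ge 0,\ k\in \mathbb{Z}\setminus \{0, \dots, n\}.$$
   Context: $\mathbb{D}=\{z\in\mathbb{C}:|z|\le 1\}$ is the closed Euclidean unit disk, $C^\infty(\mathbb{D})$ denotes functions smooth up to the boundary, and $d(z)=1-|z|^2$. $\partial S\mathbb{D}=\mathbb{S}^1\times(\mathbb{R}/2\pi\mathbb{Z})$ with coordinates $(\beta,\alpha)$, and $\partial_+S\mathbb{D}=\mathbb{S}^1\times[-\pi/2,\pi/2]$ with measure $d\beta\,d\alpha$; $\mu(\beta,\alpha)=\cos\alpha$. The X-ray transform is $I_0f(\beta,\alpha)=\int_0^{2\cos\alpha}f(e^{i\beta}+te^{i(\beta+\pi+\alpha)})\,dt$ for $(\beta,\alpha)\in\partial_+S\mathbb{D}$. $L^2(\partial_+S\mathbb{D},\mu^{-2\gamma})$ is the $L^2$ space for the measure $\mu^{-2\gamma}d\beta\,d\alpha$. Let $\mathcal{S}(\beta,\alpha)=(\beta+\pi+2\alpha,\pi-\alpha)$ and $\mathcal{S}_A(\beta,\alpha)=(\beta+\pi+2\alpha,-\alpha)$.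 For $f$ on $\partial_+S\mathbb{D}$, $A_+f$ (resp. $A_-f$) is the extension of $f$ to $\partial S\mathbb{D}$ that is even (resp. odd) under $\mathcal{S}$. Then $C_{\alpha,\pm}^\infty(\partial_+S\mathbb{D})=\{f\in C^\infty(\partial_+S\mathbb{D}):A_\pm f\in C^\infty(\partial S\mathbb{D})\}$ and $C_{\alpha,+,+}^\infty(\partial_+S\mathbb{D})=\{f\in C_{\alpha,+}^\infty(\partial_+S\mathbb{D}): f\circ\mathcal{S}_A=f\}$. $L_n^\gamma\colon[-1,1]\to\mathbb{R}$ is the degree-$n$ orthogonal polynomial for the weight $(1-x^2)^{\gamma+1/2}$ on $[-1,1]$ (any fixed nonzero normalization), and for $n\ge0$, $k\in\mathbb{Z}$, $$\psi_{n,k}^\gamma=\mu^{2\gamma+1}\frac{(-1)^n}{2\pi}e^{i(n-2k)(\beta+\alpha)}L_n^\gamma(\sin\alpha).$$ *)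

(* Defs.v *)
From HB Require Import structures.
From mathcomp Require Import all_boot all_order all_algebra.
From mathcomp Require Import complex.
From mathcomp Require Import all_classical all_reals all_analysis.

Set Implicit Arguments.
Unset Strict Implicit.
Unset Printing Implicit Defensive.

Import Order.TTheory GRing.Theory Num.Theory.
Import numFieldNormedType.Exports.

Local Open Scope classical_set_scope.
Local Open Scope complex_scope.
Local Open Scope ring_scope.

Section Defs.
Variable R : realType.

(* [D j k] is the partial derivative of order [j] in the first and [k] in the
   second variable: all partial derivatives of [f] exist on the open set [U]
   and extend continuously to its closure.  For [U := setT] this is C^oo(R^2). *)
Definition smooth_up_to_boundary_real (U : set (R * R)) (f : R * R -> R) : Prop :=
  exists D : nat -> nat -> R * R -> R,
    [/\ {in closure U, D 0%N 0%N =1 f},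
        forall j k, {within closure U, continuous (D j k)} &
        forall j k p, U p ->
          is_derive p (1, 0) (D j k) (D j.+1 k p) /\
          is_derive p (0, 1) (D j k) (D j k.+1 p)].

Definition smooth_up_to_boundary (U : set (R * R)) (f : R * R -> R[i]) : Prop :=
  smooth_up_to_boundary_real U (fun p => complex.Re (f p)) /\
  smooth_up_to_boundary_real U (fun p => complex.Im (f p)).

(* Complex functions are differentiated and integrated through their real and
   imaginary parts. *)
Definition cintegral d (T : measurableType d) (m : {measure set T -> \bar R})
    (D : set T) (f : T -> R[i]) : R[i] :=
  (\int[m]_(x in D) complex.Re (f x)) +i* (\int[m]_(x in D) complex.Im (f x)).

Definition expi (t : R) : R[i] := cos t +i* sin t.

(* A function on the closed unit disk is a total function on R[i] whose values
   off the disk are never used. *)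
Definition smooth_disk (f : R[i] -> R[i]) : Prop :=
  smooth_up_to_boundary [set p : R * R | Normc.normc (p.1 +i* p.2) < 1]
    (fun p => f (p.1 +i* p.2)).

Definition bdef (z : R[i]) : R := 1 - Normc.normc z ^+ 2.

(* The value [0 `^ gamma] occurs only on the unit circle, hence at the two
   endpoints of a chord, which do not affect the integrals below. *)
Definition weight_mul (gamma : R) (f : R[i] -> R[i]) (z : R[i]) : R[i] :=
  (bdef z `^ gamma)%:C * f z.

(* Points of the boundary of the circle bundle are pairs (beta, alpha) of real
   numbers, functions on it are 2pi-periodic in both variables.  Functions on
   the inward boundary are total functions on R * R that are 2pi-periodic in
   beta over [inward]; their values off [inward] are never used. *)
Definition inward : set (R * R) := [set p | - (pi / 2) <= p.2 <= pi / 2].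

Definition inward_interior : set (R * R) := [set p | - (pi / 2) < p.2 < pi / 2].

Definition mu (p : R * R) : R := cos p.2.

Definition scat (p : R * R) : R * R := (p.1 + pi + 2 * p.2, pi - p.2).

Definition antipodal_scat (p : R * R) : R * R := (p.1 + pi + 2 * p.2, - p.2).

Definition smooth_bdry (F : R * R -> R[i]) : Prop :=
  [/\ forall b a, F (b + 2 * pi, a) = F (b, a),
      forall b a, F (b, a + 2 * pi) = F (b, a) &
      smooth_up_to_boundary setT F].

Definition smooth_inward (f : R * R -> R[i]) : Prop :=
  (forall b a, inward (b, a) -> f (b + 2 * pi, a) = f (b, a)) /\
  smooth_up_to_boundary inward_interior f.

(* [F] is the extension of [f] that is even under [scat]; it is determined by [f], because [inward] and its
   image under [scat] cover the boundary of the circle bundle. *)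
Definition even_extension (f F : R * R -> R[i]) : Prop :=
  [/\ forall b a, F (b + 2 * pi, a) = F (b, a),
      forall b a, F (b, a + 2 * pi) = F (b, a),
      {in inward, F =1 f} &
      forall p, F (scat p) = F p].

Definition C_alpha_plus (f : R * R -> R[i]) : Prop :=
  smooth_inward f /\ exists2 F, even_extension f F & smooth_bdry F.

Definition C_alpha_plus_plus (f : R * R -> R[i]) : Prop :=
  C_alpha_plus f /\ {in inward, forall p, f (antipodal_scat p) = f p}.

(* The weight mu^(2 gamma + 1) may be singular where mu = 0, so equalities
   between weighted functions are required on [inward_interior] only. *)
Definition weighted_C_alpha_plus_plus (gamma : R) (psi : R * R -> R[i]) : Prop :=
  exists2 g, C_alpha_plus_plus g &
    {in inward_interior, forall p, psi p = (mu p `^ (2 * gamma + 1))%:C * g p}.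

Definition I0 (f : R[i] -> R[i]) (p : R * R) : R[i] :=
  cintegral (@lebesgue_measure R) `[0, 2 * cos p.2]
    (fun t : R => f (expi p.1 + t%:C * expi (p.1 + pi + p.2))).

Definition in_range_I0 (gamma : R) (psi : R * R -> R[i]) : Prop :=
  exists2 f, smooth_disk f &
    {in inward_interior,
      forall p, psi p = I0 (weight_mul gamma f) p}.

Definition inner (gamma : R) (f g : R * R -> R[i]) : R[i] :=
  cintegral (@lebesgue_measure R \x @lebesgue_measure R)%E
    (`[0, 2 * pi] `*` `[- (pi / 2), pi / 2])
    (fun p => f p * (g p)^* * (mu p `^ (- (2 * gamma)))%:C).

Definition orthogonal_polynomials (gamma : R) (L : nat -> {poly R}) : Prop :=
  (forall n, size (L n) = n.+1) /\
  (forall m n, m <> n ->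
    \int[@lebesgue_measure R]_(x in `[-1, 1])
       ((L m).[x] * (L n).[x] * (1 - x ^+ 2) `^ (gamma + 1 / 2)) = 0).

Definition psi_nk (gamma : R) (L : nat -> {poly R}) (n : nat) (k : int)
    (p : R * R) : R[i] :=
  (mu p `^ (2 * gamma + 1))%:C * ((-1) ^+ n / (2 * pi))%:C
  * expi ((n%:Z - 2 * k)%:~R * (p.1 + p.2)) * ((L n).[sin p.2])%:C.

End Defs.

(* Main.v *)
(* Put [lam := gamma + 1], let [C_n] be the Gegenbauer polynomials of parameter [lam]
   and let [E] denote integration in [v] against [(1 - v^2)^gamma] on [-1, 1].
   In the variable [w = beta + alpha], substituting [t = (cos alpha) (1 - v)] gives
   [I0 (d^gamma f) = (cos alpha)^(2 gamma + 1) T f], where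
   [T f (w, alpha) = E (f (e^(i w) (v cos alpha - i sin alpha)))].  By the product
   formula for [C_n], [T] maps the ridge function [C_j (Re (z e^(- i phi)))] to a
   multiple of [C_j (sin alpha) C_j (sin (w - phi))].

   Necessity: ridge functions span all polynomials, hence are dense in the
   continuous functions on the disk, and [C_j (sin (w - phi))] only contains the
   frequencies [j, j - 2, .., - j].

   Sufficiency: write [G (w, alpha)] for the smooth even extension of the data.
   Jackson's theorem makes the coefficients [b_j] of the Gegenbauer expansion of
   [G (w, .)] in [sin alpha] rapidly decreasing, uniformly in [w].  The moment
   conditions make [b_j] a trigonometric polynomial with frequencies
   [j, j - 2, .., - j], which is therefore a combination of the translates
   [C_j (sin (w - phi_i))] with [phi_i] on a grid of [2 j + 1] points; its
   coefficients are controlled because those of [C_j (cos t)] as a cosine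
   polynomial are bounded below.  The sum over [j] of the corresponding ridge
   functions is smooth up to the boundary and [T] maps it to [G]. *)

Require Import Defs.
From HB Require Import structures.
From mathcomp Require Import all_boot all_order all_algebra.
From mathcomp Require Import complex.
From mathcomp Require Import all_classical all_reals all_analysis.
From mathcomp Require Import measurable_realfun.
From mathcomp Require Import ring lra zify.

Set Implicit Arguments.
Unset Strict Implicit.
Unset Printing Implicit Defensive.

Import Order.TTheory GRing.Theory Num.Theory.
Import numFieldNormedType.Exports.

Local Open Scope classical_set_scope.
Local Open Scope ring_scope.

(** * Gegenbauer polynomials *)

(** The weight of the L_n is (1 - x^2)^(lam - 1/2), so they are multiples of the C_n. In the inner
    product the two factors mu^(2 gamma + 1) and the density mu^(- 2 gamma) combine to mu^(2 lam),
    which is this weight pulled back by x = sin alpha. In the variable w the symmetry under S makes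
    G (w, .) even about pi / 2, so smoothness on the whole circle gives approximation by polynomials
    in sin alpha with no loss at alpha = +- pi / 2. The symmetry under S_A gives b_j (w + pi) =
    (-1)^j b_j (w) and removes the frequencies of the wrong parity. Since k lies outside {0, .., n}
    exactly when |n - 2 k| > n, the moment conditions remove the remaining frequencies beyond j. The
    obstacle is smoothness of the reconstructed f up to the circle. Ridge functions reduce every
    partial derivative on the disk to a derivative of the one-variable C_j, which is bounded by a
    power of j (j + 2 lam) times C_j (1). Hence norms, inverse cosine coefficients and derivatives
    cost only powers of j, and the rapid decay of b_j absorbs them. *)

Section Gegenbauer.
Variables (R : realFieldType) (lam : R).
Hypothesis lam_gt0 : 0 < lam.

(** Consecutive pairs turn the three-term recurrence into a structural recursion. *)
Fixpoint gegen_pair (n : nat) : {poly R} * {poly R} :=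
  if n is n'.+1 then
    let: (p, q) := gegen_pair n' in
    (q, (n'.+2%:R^-1)%:P *
        ((2 * (n'.+1%:R + lam))%:P * 'X * q - (n'%:R + 2 * lam)%:P * p))
  else (1, (2 * lam)%:P * 'X).

Definition gegen n := (gegen_pair n).1.

Lemma gegen0 : gegen 0 = 1. Proof. by []. Qed.
Lemma gegen1 : gegen 1 = (2 * lam)%:P * 'X. Proof. by []. Qed.

Lemma gegen_rec n : n.+2%:R%:P * gegen n.+2 =
  (2 * (n.+1%:R + lam))%:P * 'X * gegen n.+1 - (n%:R + 2 * lam)%:P * gegen n.
Proof.
rewrite /gegen /=; case: (gegen_pair n) => p q /=.
by rewrite mulrA -polyCM divff ?pnatr_eq0// mul1r.
Qed.

Lemma natP_neq0 n : (n.+1%:R%:P : {poly R}) != 0.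
Proof. by rewrite polyC_eq0 pnatr_eq0. Qed.

(** One induction proves both identities, because the second one at each step rests on the first.
    They are the source of the differential equation, of the ratio of the values at 1 and of the
    stability of the cone [gcone] under derivation. *)
Lemma gegen_deriv_pair n :
  (gegen n.+1)^`() - 'X * (gegen n)^`() = (n%:R + 2 * lam)%:P * gegen n /\
  'X * (gegen n.+1)^`() - (gegen n)^`() = n.+1%:R%:P * gegen n.+1.
Proof.
elim: n => [|n [IH1 IH2]].
  rewrite gegen1 gegen0 !poly.derivE; split; rewrite ?polyCD ?polyCM; ring.
have H : n.+2%:R%:P * (gegen n.+2)^`() =
    (2 * (n.+1%:R + lam))%:P * (gegen n.+1 + 'X * (gegen n.+1)^`())
    - (n%:R + 2 * lam)%:P * (gegen n)^`().
  have := congr1 (@deriv R) (gegen_rec n).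
  rewrite derivM derivC mul0r add0r => ->.
  rewrite derivB !derivM !derivC derivX; ring.
have E1 : (gegen n.+2)^`() - 'X * (gegen n.+1)^`() =
    (n.+1%:R + 2 * lam)%:P * gegen n.+1.
  apply: (mulfI (natP_neq0 n.+1)); rewrite mulrBr H.
  have -> : (gegen n)^`() = 'X * (gegen n.+1)^`() - n.+1%:R%:P * gegen n.+1.
    by rewrite -IH2; ring.
  rewrite !polyCD !polyCM !polyCD !polyC_natr -!natr1; ring.
split=> //; rewrite (_ : n.+2%:R%:P * gegen n.+2 =
  (2 * (n.+1%:R + lam))%:P * 'X * gegen n.+1 - (n%:R + 2 * lam)%:P * gegen n);
  last exact: gegen_rec.
have -> : (gegen n.+2)^`() = 'X * (gegen n.+1)^`() +
    (n.+1%:R + 2 * lam)%:P * gegen n.+1 by rewrite -E1; ring.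
have -> : (n%:R + 2 * lam)%:P * gegen n = (gegen n.+1)^`() - 'X * (gegen n)^`().
  by rewrite IH1.
have -> : (gegen n)^`() = 'X * (gegen n.+1)^`() - n.+1%:R%:P * gegen n.+1.
  by rewrite -IH2; ring.
rewrite !polyCD !polyCM !polyCD !polyC_natr -!natr1; ring.
Qed.

(** The Gegenbauer differential operator. Orthogonality and the product formula both come from its
    having the [gegen n] as eigenvectors with distinct eigenvalues. *)
Definition gegenD (p : {poly R}) : {poly R} :=
  (1 - 'X^2) * p^`()^`() - (2 * lam + 1)%:P * 'X * p^`().

Lemma gegenD_gegen n : gegenD (gegen n) = - (n%:R * (n%:R + 2 * lam))%:P * gegen n.
Proof.
case: n => [|n].
  rewrite /gegenD gegen0 !poly.derivE mul0r polyC0; ring.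
have [E1 E2] := gegen_deriv_pair n.
have E3 : (1 - 'X^2) * (gegen n.+1)^`() =
    (n%:R + 2 * lam)%:P * gegen n - n.+1%:R%:P * 'X * gegen n.+1.
  rewrite -E1 [in RHS](mulrC (_%:P)) -mulrA -E2; ring.
have d1 : (1 - 'X^2 : {poly R})^`() = - (2 * 'X).
  by rewrite derivB derivXn -[1]/(1%:P) derivC sub0r -mulr_natl.
have := congr1 (@deriv R) E3; rewrite derivM d1 derivB !derivM !derivC derivX => E4.
rewrite /gegenD -[X in X - _ = _](addKr (- (2 * 'X) * (gegen n.+1)^`())) E4.
have -> : (gegen n)^`() = 'X * (gegen n.+1)^`() - n.+1%:R%:P * gegen n.+1.
  by rewrite -E2; ring.
rewrite !polyCD !polyCM !polyCD !polyC_natr -!natr1; ring.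
Qed.

Lemma coef_gegenD (p : {poly R}) i : (gegenD p)`_i =
  (i.+2 * i.+1)%:R * p`_i.+2 - (i%:R * (i%:R + 2 * lam)) * p`_i.
Proof.
rewrite /gegenD mulrBl mul1r !coefB -mulrA !coefCM coefXnM !coefXM !coef_deriv.
case: i => [|[|i]] /=; rewrite ?subSS ?subn0 ?coef_deriv ?sub0r ?subr0.
- move: p`_0 p`_1 p`_2 => a b c; ring.
- move: p`_1 p`_2 p`_3 => a b c; ring.
- move: p`_i.+2 p`_i.+3 p`_i.+4 => a b c; by rewrite natrM !mulrS; ring.
Qed.

(** The operator is triangular on coefficients, so the leading coefficient of a nonzero q forces the
    eigenvalue of its own degree; i (i + 2 lam) is strictly increasing in i. *)
Lemma gegenD_eigen0 n (q : {poly R}) : (size q <= n)%N ->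
  gegenD q = - (n%:R * (n%:R + 2 * lam))%:P * q -> q = 0.
Proof.
move=> sq Dq; apply/eqP; apply: contraT => q0.
have sq0 : (0 < size q)%N by rewrite size_poly_gt0.
have := congr1 (fun p : {poly R} => p`_(size q).-1) Dq.
rewrite coef_gegenD -polyCN coefCM (@nth_default _ _ _ (size q).-1.+2); last first.
  by rewrite prednK.
have : q`_(size q).-1 != 0 by rewrite -/(lead_coef q) lead_coef_eq0.
set a := q`__ => a0 /eqP; rewrite mulr0 sub0r -mulNr -subr_eq0 -mulrBl mulf_eq0 (negbTE a0) orbF.
have : ((size q).-1%:R : R) < n%:R by rewrite ltr_nat prednK.
have : 0 <= ((size q).-1%:R : R) by rewrite ler0n.
move: (_%:R) (n%:R) => x y x0 xy /eqP.
have : 0 < (y - x) * (y + x + 2 * lam).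
  by rewrite mulr_gt0 ?subr_gt0//; have := lam_gt0; lra.
by move=> /[swap] E; rewrite (_ : _ * _ = 0) ?ltxx// -E; ring.
Qed.

Lemma size_coef_lead (p : {poly R}) n : (size p <= n.+1)%N -> p`_n != 0 -> size p = n.+1.
Proof.
move=> sp pn; apply/eqP; rewrite eqn_leq sp /= ltnNge.
by apply: contra pn => /leq_sizeP ->.
Qed.

Lemma gegen_size_lead n : (size (gegen n) <= n.+1)%N /\ 0 < (gegen n)`_n.
Proof.
suff : [/\ (size (gegen n) <= n.+1)%N, 0 < (gegen n)`_n,
  (size (gegen n.+1) <= n.+2)%N & 0 < (gegen n.+1)`_n.+1] by case.
elim: n => [|n [IH1 IH2 IH3 IH4]].
  rewrite gegen0 gegen1 size_poly1 coef1 coefCM coefX eqxx mulr1 ltr01 mulr_gt0//.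
  split=> //; apply/leq_sizeP => j j2; rewrite coefCM coefX.
  by case: j j2 => [|[|j]]//; rewrite mulr0.
have rec : forall j, n.+2%:R * (gegen n.+2)`_j =
   2 * (n.+1%:R + lam) * (if j is j'.+1 then (gegen n.+1)`_j' else 0) -
   (n%:R + 2 * lam) * (gegen n)`_j.
  move=> j; have := congr1 (fun p : {poly R} => p`_j) (gegen_rec n).
  by rewrite /= coefB -mulrA !coefCM coefXM; case: j.
have n0 : (n.+2%:R : R) != 0 by rewrite pnatr_eq0.
split=> //.
  apply/leq_sizeP => -[//|j] nj; apply: (mulfI n0); rewrite rec mulr0.
  rewrite (leq_sizeP _ _ IH3)// (leq_sizeP _ _ IH1) ?mulr0 ?subr0//.
  by rewrite ltnW// ltnW.
have := rec n.+2; rewrite (leq_sizeP _ _ IH1)// mulr0 subr0 => E.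
rewrite -(@pmulr_rgt0 _ n.+2%:R) ?ltr0n// E mulr_gt0// mulr_gt0// addr_gt0// ltr0n.
Qed.

Lemma size_gegen n : size (gegen n) = n.+1.
Proof.
have [h1 h2] := gegen_size_lead n.
by apply: size_coef_lead => //; rewrite gt_eqF.
Qed.

(* Distinct eigenvalues make the eigenspaces one-dimensional. *)
Lemma gegenD_eigen n (q : {poly R}) : (size q <= n.+1)%N ->
  gegenD q = - (n%:R * (n%:R + 2 * lam))%:P * q ->
  exists k, q = k%:P * gegen n.
Proof.
move=> sq Dq; have [sC lC] := gegen_size_lead n.
exists (q`_n / (gegen n)`_n); apply/eqP; rewrite -subr_eq0; apply/eqP.
apply: (@gegenD_eigen0 n).
  apply/leq_sizeP => j; rewrite leq_eqVlt => /predU1P[<-|nj]; rewrite coefB coefCM.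
    by rewrite divfK ?subrr// gt_eqF.
    by rewrite (leq_sizeP _ _ sq j nj) (leq_sizeP _ _ sC j nj) mulr0 subr0.
set c := _%:P.
have -> : gegenD (q - c * gegen n) = gegenD q - c * gegenD (gegen n).
  have dM (p : {poly R}) : (c * p)^`() = c * p^`() by rewrite derivM derivC mul0r add0r.
  rewrite /gegenD !derivB !dM; ring.
by rewrite Dq gegenD_gegen; ring.
Qed.

(** At 1 the second-order term of [gegenD] vanishes and the equation determines the derivative. *)
Lemma gegenD_horner1 n : (gegen n)^`().[1] * (2 * lam + 1) =
  n%:R * (n%:R + 2 * lam) * (gegen n).[1].
Proof.
have := congr1 (fun p : {poly R} => p.[1]) (gegenD_gegen n).
rewrite /gegenD -polyCN !hornerE => E.
move: E; rewrite ?expr1n; set a := _.[1]; set b := _.[1]; set c := _.[1] => E.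
by lra.
Qed.

Lemma gegen1_rec n : n.+1%:R * (gegen n.+1).[1] = (n%:R + 2 * lam) * (gegen n).[1].
Proof.
have [E1 E2] := gegen_deriv_pair n.
have := congr1 (fun p : {poly R} => p.[1]) E1; have := congr1 (fun p : {poly R} => p.[1]) E2.
rewrite !hornerE; lra.
Qed.

Lemma gegen1_gt0 n : 0 < (gegen n).[1].
Proof.
elim: n => [|n IH]; first by rewrite gegen0 hornerC.
rewrite -(@pmulr_rgt0 _ n.+1%:R) ?ltr0n// gegen1_rec mulr_gt0//.
by rewrite ltr_wpDl// mulr_gt0.
Qed.

Lemma gegen1_le (M : nat) n : 2 * lam <= M%:R -> (gegen n).[1] <= n.+1%:R ^+ M.
Proof.
move=> lM; elim: n => [|n IH]; first by rewrite gegen0 hornerC expr1n.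
rewrite -(@ler_pM2l _ n.+1%:R) ?ltr0n// gegen1_rec.
apply: (@le_trans _ _ ((n.+1%:R + M%:R) * n.+1%:R ^+ M)).
  apply: ler_pM => //; first by rewrite addr_ge0// ltW// mulr_gt0.
    exact/ltW/gegen1_gt0.
  by rewrite lerD// ler_nat.
rewrite -natrD -!natrX -!natrM ler_nat.
(* What remains is Bernoulli's inequality 1 + M / (n + 1) <= (1 + 1 / (n + 1))^M, cleared of
   denominators. *)
elim: M {lM IH} => [|M IH]; first by rewrite !expn0 !muln1 addn0.
rewrite !expnS; move: (n.+1 ^ M)%N (n.+2 ^ M)%N IH => X Y IH.
apply: (@leq_trans (n.+2 * ((n.+1 + M) * X))); last by rewrite (mulnCA n.+1) leq_mul2l IH orbT.
rewrite mulnA mulnA leq_mul2r; apply/orP; right.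
rewrite -[n.+2]addn1 -[M.+1]addn1; nia.
Qed.

(** The coefficient (lam)_k / k! of x^k in (1 - x)^(- lam). *)
Definition gcoef k : R := \prod_(i < k) ((i%:R + lam) / i.+1%:R).

Lemma gcoef0 : gcoef 0 = 1. Proof. exact: big_ord0. Qed.

Lemma gcoefS k : k.+1%:R * gcoef k.+1 = (k%:R + lam) * gcoef k.
Proof.
by rewrite /gcoef big_ord_recr /= mulrCA [RHS]mulrC mulrC (mulrC k.+1%:R) divfK ?pnatr_eq0// mulrC.
Qed.

Lemma gcoef_gt0 k : 0 < gcoef k.
Proof.
rewrite /gcoef prodr_gt0 // => i _; rewrite divr_gt0 ?ltr0n//.
by rewrite ltr_wpDl.
Qed.

(** The sequence k [gcoef k] is nondecreasing from k = 1 on, because its next term is (k + lam)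
    [gcoef k]. This bound keeps the cosine coefficients of [gegen] away from 0, as the inversion on
    the grid requires. *)
Lemma gcoef_ge k : Num.min lam 1 <= k.+1%:R * gcoef k.
Proof.
have m0 : 0 < Num.min lam 1 by rewrite lt_min lam_gt0 ltr01.
case: k => [|k]; first by rewrite gcoef0 mulr1 ge_min lexx orbT.
have : Num.min lam 1 <= k.+1%:R * gcoef k.+1.
  elim: k => [|k IH]; first by rewrite gcoefS gcoef0 add0r mulr1 ge_min lexx.
  apply: (le_trans IH); rewrite [leRHS]gcoefS ler_pM2r ?gcoef_gt0//.
  by rewrite lerDl ltW.
move/le_trans; apply; rewrite ler_pM2r ?gcoef_gt0// ler_nat.
by [].
Qed.

(** * The generating function of the Gegenbauer polynomials, factored *)

Section Homogeneous.
Variables (A : comNzRingType) (f : {rmorphism R -> A}) (x y : A).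

(** The coefficient of t^n in (1 - x t)^(- lam) (1 - y t)^(- lam). *)
Definition gegenH n : A := \sum_(k < n.+1) f (gcoef k * gcoef (n - k)) * x ^+ (n - k) * y ^+ k.
(** [SA] and [SB] apply y d/dy and x d/dx to [gegenH n]. Their sum is Euler's identity for a form of
    degree n, and [SAS], [SBS] express the first-order equation of each factor of the generating
    function. *)
Let SA n : A := \sum_(k < n.+1) f (k%:R * gcoef k * gcoef (n - k)) * x ^+ (n - k) * y ^+ k.
Let SB n : A := \sum_(k < n.+1) f (gcoef k * ((n - k)%:R * gcoef (n - k))) * x ^+ (n - k) * y ^+ k.

Let SAS n : SA n.+1 = y * (SA n + f lam * gegenH n).
Proof.
rewrite /SA big_ord_recl /= mul0r mul0r rmorph0 !mul0r add0r mulrDr !mulr_sumr -big_split /=.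
apply: eq_bigr => i _; rewrite /bump /= add1n subSS gcoefS exprS !rmorphM rmorphD; ring.
Qed.

Let SBS n : SB n.+1 = x * (SB n + f lam * gegenH n).
Proof.
rewrite /SB big_ord_recr /= subnn mul0r mulr0 rmorph0 !mul0r addr0 mulrDr !mulr_sumr -big_split /=.
apply: eq_bigr => i _; rewrite subSn -1?ltnS// gcoefS exprS !rmorphM rmorphD; ring.
Qed.

Let SAB n : SA n + SB n = n%:R * gegenH n.
Proof.
rewrite mulr_sumr -big_split /=; apply: eq_bigr => i _.
have -> : n%:R = (n - i)%:R + i%:R :> A by rewrite -natrD subnK// -ltnS.
rewrite !rmorphM !rmorph_nat; ring.
Qed.

Lemma gegenH_rec n : n.+2%:R * gegenH n.+2 =
  f (n.+1%:R + lam) * (x + y) * gegenH n.+1 - f (n%:R + 2 * lam) * (x * y) * gegenH n.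
Proof.
rewrite -SAB SAS SBS.
have E : n%:R * gegenH n = SA n + SB n by rewrite SAB.
have E1 : n.+1%:R * gegenH n.+1 = SA n.+1 + SB n.+1 by rewrite SAB.
rewrite !rmorphD rmorphM !rmorph_nat.
transitivity ((x + y) * (SA n.+1 + SB n.+1) + f lam * (x + y) * gegenH n.+1
   - (x * SA n.+1 + y * SB n.+1)); first by ring.
rewrite [in X in _ - X]SAS [in X in _ - X]SBS -E1.
transitivity ((x + y) * (n.+1%:R * gegenH n.+1) + f lam * (x + y) * gegenH n.+1
   - x * y * (SA n + SB n) - x * y * 2 * f lam * gegenH n); first by ring.
rewrite -E; ring.
Qed.

(** Both sides obey the same recurrence once x y = 1 and x + y = 2 c. The case x = e^(i t), y = e^(-
    i t) in [R[i]] is the cosine expansion of [gegen]. *)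
Lemma gegenH_horner c n : x * y = 1 -> x + y = f (2 * c) ->
  (forall k, (k.+1%:R : A) != 0) -> (forall u v : A, u * v = 0 -> u = 0 \/ v = 0) ->
  f (gegen n).[c] = gegenH n.
Proof.
move=> xy xDy A0 Adom.
suff : f (gegen n).[c] = gegenH n /\ f (gegen n.+1).[c] = gegenH n.+1 by case.
elim: n => [|n [IH1 IH2]].
  rewrite gegen0 gegen1 /gegenH !big_ord_recl !big_ord0 /= /bump /= !subnn !hornerE gcoef0.
  rewrite subn0 /gcoef !big_ord_recl !big_ord0 /= add0r divr1 !mulr1 !mul1r !rmorph1.
  rewrite !expr1 addr0 -mulrDr xDy -rmorphM; split=> //; congr (f _); ring.
split=> //; apply/eqP; rewrite -subr_eq0; apply/eqP.
have := congr1 (fun p : {poly R} => f p.[c]) (gegen_rec n).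
rewrite /= hornerD !hornerM hornerN !hornerM !hornerC hornerX !rmorphB !rmorphM.
rewrite IH1 IH2 rmorph_nat => E.
have := gegenH_rec n; rewrite xy xDy mulr1 => E'.
have : n.+2%:R * (f (gegen n.+2).[c] - gegenH n.+2) = 0.
  rewrite mulrBr E E' !rmorphM; ring.
by case/Adom => // /eqP; rewrite (negbTE (A0 _)).
Qed.

End Homogeneous.

(* The cone spanned by the [gegen k] is stable under derivation, and its
   elements attain their maximum over [-1, 1] at 1. *)
Inductive gcone (n : nat) : {poly R} -> Prop :=
| gcone0 : gcone n 0
| gconeS p k c : (k <= n)%N -> 0 <= c -> gcone n p -> gcone n (c%:P * gegen k + p).

Lemma gcone_gegen n k : (k <= n)%N -> gcone n (gegen k).
Proof.
move=> kn; rewrite -[gegen k]addr0 -[gegen k]mul1r -polyC1.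
by apply: gconeS => //; exact: gcone0.
Qed.

Lemma gconeD n p q : gcone n p -> gcone n q -> gcone n (p + q).
Proof.
move=> Hp Hq; elim: Hp => [|p' k c kn c0 _ IH]; first by rewrite add0r.
by rewrite -addrA; apply: gconeS.
Qed.

Lemma gconeZ n a p : 0 <= a -> gcone n p -> gcone n (a%:P * p).
Proof.
move=> a0; elim => [|p' k c kn c0 _ IH]; first by rewrite mulr0; exact: gcone0.
by rewrite mulrDr mulrA -polyCM; apply: gconeS => //; rewrite mulr_ge0.
Qed.

(** C_(k+2)' = 2 (k + 1 + lam) C_(k+1) + C_k' has positive coefficients; hence an induction in steps
    of two. *)
Lemma gcone_deriv_gegen n k : (k <= n)%N -> gcone n (gegen k)^`().
Proof.
suff : ((k <= n)%N -> gcone n (gegen k)^`()) /\ ((k.+1 <= n)%N -> gcone n (gegen k.+1)^`()).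
  by case.
elim: k => [|k [IH1 IH2]].
  split=> kn; first by rewrite gegen0 -polyC1 derivC; exact: gcone0.
  rewrite gegen1 derivM derivC mul0r add0r derivX -gegen0.
  by apply: gconeZ; [rewrite mulr_ge0// ltW|exact: gcone_gegen].
split=> // kn.
have [_ E2] := gegen_deriv_pair k; have [E1 _] := gegen_deriv_pair k.+1.
have -> : (gegen k.+2)^`() = (2 * (k.+1%:R + lam))%:P * gegen k.+1 + (gegen k)^`().
  have -> : (gegen k.+2)^`() = 'X * (gegen k.+1)^`() + (k.+1%:R + 2 * lam)%:P * gegen k.+1.
    by rewrite -E1; ring.
  have -> : 'X * (gegen k.+1)^`() = (gegen k)^`() + k.+1%:R%:P * gegen k.+1.
    by rewrite -E2; ring.
  by rewrite !polyCD !polyCM !polyCD !polyC_natr; ring.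
apply: gconeS; first exact: ltnW.
  by rewrite mulr_ge0// addr_ge0// ltW.
by apply: IH1; rewrite ltnW// ltnW.
Qed.

Lemma gcone_deriv n p : gcone n p -> gcone n p^`().
Proof.
elim=> [|p' k c kn c0 _ IH]; first by rewrite -polyC0 derivC; exact: gcone0.
rewrite derivD derivM derivC mul0r add0r; apply: gconeD => //.
by apply: gconeZ => //; apply: gcone_deriv_gegen.
Qed.

Lemma gcone_horner_ge0 n p : gcone n p -> 0 <= p.[1].
Proof.
elim=> [|p' k c kn c0 _ IH]; first by rewrite horner0.
by rewrite hornerD hornerM hornerC addr_ge0// mulr_ge0// ltW// gegen1_gt0.
Qed.

(** On each generator this is [gegenD_horner1] with the factor 2 lam + 1 >= 1 dropped, followed by
    monotonicity of the eigenvalues in k. *)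
Lemma gcone_deriv1_le n p : gcone n p -> p^`().[1] <= n%:R * (n%:R + 2 * lam) * p.[1].
Proof.
elim=> [|p' k c kn c0 _ IH]; first by rewrite -polyC0 derivC !hornerC mulr0.
rewrite derivD derivM derivC mul0r add0r !hornerE mulrDr lerD// mulrCA ler_wpM2l//.
apply: (@le_trans _ _ (k%:R * (k%:R + 2 * lam) * (gegen k).[1])).
  rewrite -gegenD_horner1 ler_peMr ?gcone_horner_ge0 ?lerDr ?mulr_ge0 ?(ltW lam_gt0)//.
  exact: gcone_horner_ge0 (gcone_deriv_gegen (leqnn k)).
rewrite ler_pM2r ?gegen1_gt0//.
have l0 := ltW lam_gt0.
rewrite ler_pM ?addr_ge0 ?mulr_ge0// ?lerD2r ?ler_nat//.
Qed.

Lemma gcone_norm_le n p x : (forall k, `|(gegen k).[x]| <= (gegen k).[1]) ->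
  gcone n p -> `|p.[x]| <= p.[1].
Proof.
move=> xP; elim=> [|p' k c kn c0 _ IH]; first by rewrite !horner0 normr0.
rewrite !hornerD !hornerM !hornerC (le_trans (ler_normD _ _))// lerD//.
by rewrite normrM (ger0_norm c0) ler_wpM2l.
Qed.

(** An inequality of Markov type: derivatives stay in the cone, so they are largest at 1, where each
    derivation costs at most one factor n (n + 2 lam). *)
Lemma gegen_derivn_le n r x : (forall k, `|(gegen k).[x]| <= (gegen k).[1]) ->
  `|(gegen n)^`(r).[x]| <= (n%:R * (n%:R + 2 * lam)) ^+ r * (gegen n).[1].
Proof.
move=> xP.
have [C B] : gcone n (gegen n)^`(r) /\
    (gegen n)^`(r).[1] <= (n%:R * (n%:R + 2 * lam)) ^+ r * (gegen n).[1].
  elim: r => [|r [IH1 IH2]]; first by rewrite derivn0 expr0 mul1r; split => //; apply: gcone_gegen.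
  rewrite derivnS; split; first exact: gcone_deriv.
  apply: (le_trans (gcone_deriv1_le IH1)); rewrite exprS -[leRHS]mulrA ler_wpM2l//.
  by rewrite mulr_ge0// addr_ge0// mulr_ge0// ltW.
exact: (le_trans (gcone_norm_le xP C)).
Qed.

(** * Generalized translation and the product formula *)

Section ProductFormula.
Variable e : nat -> R.
Hypothesis eP : forall i, (i.+1%:R + 2 * lam) * e i.+2 = i.+1%:R * e i.

(** The mean over v of (x y + v s)^n with s^2 = (1 - x^2) (1 - y^2), expanded by the binomial
    formula. [e] plays the moments of v; only even ones are kept, so s enters through its square and
    the result is a polynomial in x. *)
Definition gtransM (y : R) n : {poly R} :=
  \sum_(i < n.+1) ('C(n, i.*2)%:R * e i.*2 * (1 - y ^+ 2) ^+ i * y ^+ (n - i.*2))%:P *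
     ('X ^+ (n - i.*2) * (1 - 'X^2) ^+ i).

Definition gtrans (y : R) (p : {poly R}) : {poly R} :=
  \sum_(n < size p) (p`_n)%:P * gtransM y n.

Lemma gegenD_mono a i : gegenD ('X ^+ a * (1 - 'X^2) ^+ i) =
  (a * a.-1)%:R%:P * ('X ^+ a.-2 * (1 - 'X^2) ^+ i)
  + (2 * i%:R * (2 * i%:R - 1 + 2 * lam))%:P * ('X ^+ a * (1 - 'X^2) ^+ i.-1)
  - ((a + i.*2)%:R * ((a + i.*2)%:R + 2 * lam))%:P * ('X ^+ a * (1 - 'X^2) ^+ i).
Proof.
have d1 : (1 - 'X^2 : {poly R})^`() = - (2 * 'X).
  by rewrite derivB derivXn -[1]/(1%:P) derivC sub0r -mulr_natl.
have d2 b j : ('X ^+ b * (1 - 'X^2 : {poly R}) ^+ j)^`() =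
    b%:R * ('X ^+ b.-1 * (1 - 'X^2) ^+ j) - 2 * j%:R * ('X ^+ b.+1 * (1 - 'X^2) ^+ j.-1).
  rewrite derivM derivXn deriv_exp d1 -[_ *+ b]mulr_natl -[_ *+ j]mulr_natl (exprS 'X b); ring.
have cM c p : (c%:R * p : {poly R})^`() = c%:R * p^`().
  by rewrite -polyC_natr derivM derivC mul0r add0r.
rewrite /gegenD d2 derivB -!mulrA !cM !d2.
rewrite -muln2 natrD natrM !polyCD !polyCM polyC_natr !polyCD polyC_natr !polyCN polyCM polyC1 natrM.
case: a => [|[|a]]; case: i => [|[|i]]; rewrite /= ?expr0 ?expr1 ?(exprS _ i.+1) ?(exprS _ i) ?(exprS _ a.+2) ?(exprS _ a.+1) ?(exprS _ a) ?mulrS ?polyCD ?polyC0 ?polyC_natr; try ring.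
rewrite (exprS _ a.+3) (exprS _ a.+2) (exprS _ a.+1) (exprS _ a) !(polyCM, polyCD, polyC_natr, polyC0, polyC1); ring.
Qed.

Lemma gegenD_sum (I : Type) (r : seq I) (P : pred I) (F : I -> {poly R}) :
  gegenD (\sum_(i <- r | P i) F i) = \sum_(i <- r | P i) gegenD (F i).
Proof.
apply: (big_morph gegenD); last by rewrite /gegenD !deriv0 !mulr0 subr0.
by move=> p q; rewrite /gegenD !derivD; ring.
Qed.

Lemma gegenDZ c p : gegenD (c%:P * p) = c%:P * gegenD p.
Proof.
have dM (q : {poly R}) : (c%:P * q)^`() = c%:P * q^`() by rewrite derivM derivC mul0r add0r.
by rewrite /gegenD !dM; ring.
Qed.

Lemma bin_mul2 m j : ('C(m.+2, j.+2) * (j.+2 * j.+1) = (m.+2 * m.+1) * 'C(m, j))%N.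
Proof.
rewrite mulnA [('C(_, _) * _)%N]mulnC -mul_bin_diag -mulnA [('C(_, _) * _)%N]mulnC -mul_bin_diag.
by rewrite mulnA.
Qed.

Lemma bin_mul2r m j : ('C(m.+2, j) * ((m.+2 - j) * (m.+2 - j).-1) = (m.+2 * m.+1) * 'C(m, j))%N.
Proof.
have [jm|mj] := leqP j m; last first.
  rewrite (bin_small mj) muln0.
  have [|] := leqP j m.+1; first by move=> jm; rewrite (_ : j = m.+1) ?subSnn ?muln0//; lia.
  move=> mj2; have [->|] := eqVneq j m.+2; first by rewrite subnn !muln0.
  by move=> ne; rewrite bin_small// ltn_neqAle eq_sym ne.
have -> : ('C(m.+2, j) = 'C(m.+2, (m - j).+2))%N.
  rewrite -(bin_sub (_ : j <= m.+2)%N); first by congr 'C(_, _); lia.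
  lia.
have -> : ('C(m, j) = 'C(m, m - j))%N by rewrite bin_sub.
rewrite (_ : (m.+2 - j) = (m - j).+2)%N; last lia.
exact: bin_mul2.
Qed.

Lemma bin_smallR n k : (n < k)%N -> 'C(n, k)%:R = 0 :> R.
Proof. by move=> nk; rewrite bin_small. Qed.

(** [gegenD] acts here as it does on 'X^n. The recurrence [eP] turns the terms with a lowered power
    of 1 - X^2 into (1 - y^2) times the sum for n - 2; the terms with a lowered power of X give y^2
    times that sum. *)
Lemma gegenD_gtransM y n : gegenD (gtransM y n) =
  (n * n.-1)%:R%:P * gtransM y n.-2 - (n%:R * (n%:R + 2 * lam))%:P * gtransM y n.
Proof.
rewrite /gtransM gegenD_sum; under eq_bigr do rewrite gegenDZ gegenD_mono mulrBr mulrDr.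
rewrite sumrB; congr (_ - _); last first.
  rewrite mulr_sumr; apply: eq_bigr => i _.
  have [i2|i2] := leqP i.*2 n; last first.
    by rewrite bin_smallR// !mul0r ?polyC0 ?mul0r ?mulr0.
  by rewrite subnK// [LHS]mulrCA.
rewrite big_split /=.
have [n1|] := leqP n 1.
  have c0 k : (k <= 1)%N -> ((k * k.-1)%:R%:P : {poly R}) = 0 by case: k => [|[|]].
  rewrite c0// mul0r !big1 ?addr0// => i _.
    have [->|i0] := posnP i; first by rewrite !mulr0 !mul0r ?polyC0 ?mul0r ?mulr0.
    by rewrite bin_smallR ?mul0r ?polyC0 ?mul0r//; lia.
  by rewrite c0 ?mul0r ?mulr0//; lia.
case: n => [|[|m]]// _.
rewrite /=.
have -> : \sum_(i < m.+3) ('C(m.+2, i.*2)%:R * e i.*2 * (1 - y ^+ 2) ^+ i * y ^+ (m.+2 - i.*2))%:P *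
     (((m.+2 - i.*2) * (m.+2 - i.*2).-1)%:R%:P *
      ('X ^+ (m.+2 - i.*2).-2 * (1 - 'X^2) ^+ i)) =
   (m.+2 * m.+1)%:R%:P * \sum_(i < m.+1) (y ^+ 2)%:P * (('C(m, i.*2)%:R * e i.*2 * (1 - y ^+ 2) ^+ i *
     y ^+ (m - i.*2))%:P * ('X ^+ (m - i.*2) * (1 - 'X^2) ^+ i)).
  have E (i : nat) : ('C(m.+2, i.*2)%:R * e i.*2 * (1 - y ^+ 2) ^+ i * y ^+ (m.+2 - i.*2))%:P *
     (((m.+2 - i.*2) * (m.+2 - i.*2).-1)%:R%:P *
      ('X ^+ (m.+2 - i.*2).-2 * (1 - 'X^2) ^+ i)) =
      (m.+2 * m.+1)%:R%:P * ((y ^+ 2)%:P * (('C(m, i.*2)%:R * e i.*2 * (1 - y ^+ 2) ^+ i *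
     y ^+ (m - i.*2))%:P * ('X ^+ (m - i.*2) * (1 - 'X^2) ^+ i))).
    transitivity (('C(m.+2, i.*2) * ((m.+2 - i.*2) * (m.+2 - i.*2).-1))%:R%:P * ((e i.*2 * (1 - y ^+ 2) ^+ i * y ^+ (m.+2 - i.*2))%:P *
      ('X ^+ (m.+2 - i.*2).-2 * (1 - 'X^2) ^+ i)) : {poly R}).
      by rewrite natrM !polyCM; ring.
    rewrite bin_mul2r natrM; have [im|im] := leqP i.*2 m; last first.
      by rewrite (bin_smallR im) !mulr0 !mul0r ?polyC0 ?mul0r ?mulr0.
    have -> : (m.+2 - i.*2 = (m - i.*2).+2)%N by lia.
    by rewrite /= !exprS expr0 !polyCM; ring.
  rewrite mulr_sumr; under eq_bigr do rewrite E.
  rewrite 2!big_ord_recr /= !bin_smallR; last 2 first.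
  - lia.
  - lia.
  by rewrite !mul0r ?polyC0 ?mul0r ?mulr0 ?addr0.
have -> : \sum_(i < m.+3) ('C(m.+2, i.*2)%:R * e i.*2 * (1 - y ^+ 2) ^+ i * y ^+ (m.+2 - i.*2))%:P *
     ((2 * i%:R * (2 * i%:R - 1 + 2 * lam))%:P *
      ('X ^+ (m.+2 - i.*2) * (1 - 'X^2) ^+ i.-1)) =
   (m.+2 * m.+1)%:R%:P * \sum_(i < m.+1) (1 - y ^+ 2)%:P * (('C(m, i.*2)%:R * e i.*2 * (1 - y ^+ 2) ^+ i *
     y ^+ (m - i.*2))%:P * ('X ^+ (m - i.*2) * (1 - 'X^2) ^+ i)).
  rewrite big_ord_recl /= !mulr0 !mul0r ?polyC0 ?mul0r ?mulr0 add0r.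
  have E (i : nat) : ('C(m.+2, i.*2.+2)%:R * e i.*2.+2 * (1 - y ^+ 2) ^+ i.+1 * y ^+ (m.+2 - i.*2.+2))%:P *
     ((2 * i.+1%:R * (2 * i.+1%:R - 1 + 2 * lam))%:P *
      ('X ^+ (m.+2 - i.*2.+2) * (1 - 'X^2) ^+ i)) =
      (m.+2 * m.+1)%:R%:P * ((1 - y ^+ 2)%:P * (('C(m, i.*2)%:R * e i.*2 * (1 - y ^+ 2) ^+ i *
     y ^+ (m - i.*2))%:P * ('X ^+ (m - i.*2) * (1 - 'X^2) ^+ i))).
    rewrite !subSS.
    have Ee : (2 * i.+1%:R - 1 + 2 * lam) * e i.*2.+2 = i.*2.+1%:R * e i.*2.
      by rewrite -eP -muln2 -!natr1 natrM; congr (_ * _); ring.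
    transitivity (('C(m.+2, i.*2.+2)%:R * i.*2.+2%:R * ((2 * i.+1%:R - 1 + 2 * lam) * e i.*2.+2) * (1 - y ^+ 2) ^+ i.+1 * y ^+ (m - i.*2))%:P *
      ('X ^+ (m - i.*2) * (1 - 'X^2) ^+ i) : {poly R}).
      rewrite [LHS]mulrA -polyCM; congr (_%:P * _); rewrite -doubleS -muln2 natrM; ring.
    rewrite Ee; transitivity (('C(m.+2, i.*2.+2) * (i.*2.+2 * i.*2.+1))%:R%:P *
        ((e i.*2 * (1 - y ^+ 2) ^+ i.+1 * y ^+ (m - i.*2))%:P *
      ('X ^+ (m - i.*2) * (1 - 'X^2) ^+ i)) : {poly R}).
      rewrite [RHS]mulrA -polyCM; congr (_%:P * _); rewrite !natrM; ring.
    rewrite bin_mul2 natrM !mulrA -!polyCM; congr (_%:P * _ * _); rewrite exprS; ring.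
  rewrite mulr_sumr; under eq_bigr do rewrite /bump /= add1n doubleS E.
  rewrite big_ord_recr /= !bin_smallR; last lia.
  by rewrite !mul0r ?polyC0 ?mul0r ?mulr0 ?addr0.
rewrite -mulrDr -big_split; congr (_ * _); apply: eq_bigr => i _ /=.
rewrite -mulrDl -polyCD; set u := _ + _; rewrite (_ : u = 1) ?polyC1 ?mul1r// /u; ring.
Qed.

Lemma gtrans_widen y (p : {poly R}) N : (size p <= N)%N ->
  gtrans y p = \sum_(n < N) (p`_n)%:P * gtransM y n.
Proof.
move=> pN; rewrite /gtrans (big_ord_widen N (fun n => (p`_n)%:P * gtransM y n))//.
rewrite big_mkcond /=; apply: eq_bigr => i _; case: ltnP => // h.
by rewrite nth_default// polyC0 mul0r.
Qed.

Lemma gegenD_gtrans y (p : {poly R}) : gegenD (gtrans y p) = gtrans y (gegenD p).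
Proof.
have sD : (size (gegenD p) <= size p)%N.
  apply/leq_sizeP => j pj; rewrite coef_gegenD !nth_default ?mulr0 ?subrr//.
  by rewrite (leq_trans pj)// ltnW.
rewrite (gtrans_widen _ sD) (@gtrans_widen y p (size p).+2) ?leqW// gegenD_sum.
under eq_bigr do rewrite gegenDZ gegenD_gtransM mulrBr.
rewrite big_split /= sumrN 2!big_ord_recl [X in _ - X]big_ord_recr [X in _ - (X + _)]big_ord_recr /=.
rewrite (@nth_default _ 0 p _ (leqnn _)) (@nth_default _ 0 p _ (leqnSn _)).
rewrite /bump /= ?muln0 ?mul0n ?mulr0n !(polyC0, mul0r, mulr0, addr0, add0r).
rewrite -sumrB; apply: eq_bigr => i _.
rewrite coef_gegenD !add1n polyCD !polyCM polyCN !polyCM mulrBl.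
by rewrite !add0n; ring.
Qed.

Lemma size_gtransM y n : (size (gtransM y n) <= n.+1)%N.
Proof.
apply: (leq_trans (size_sum _ _ _)); apply/bigmax_leqP => i _.
have [i2|i2] := leqP i.*2 n; last by rewrite bin_smallR// !mul0r ?polyC0 ?mul0r size_poly0.
rewrite mul_polyC (leq_trans (size_scale_leq _ _))//.
rewrite (leq_trans (size_polyMleq _ _))// size_polyXn /=.
have : (size ((1 - 'X^2 : {poly R}) ^+ i) <= (2 * i).+1)%N.
  rewrite (leq_trans (size_poly_exp_leq _ _))// ltnS leq_mul2r.
  rewrite (_ : (size _).-1 <= 2)%N ?orbT// -subn1 leq_subLR.
  rewrite (leq_trans (size_polyD _ _))// geq_max size_poly1 size_polyN size_polyXn.
  by [].
move: (size _) => k; lia.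
Qed.

Lemma size_gtrans y (p : {poly R}) : (size (gtrans y p) <= size p)%N.
Proof.
apply: (leq_trans (size_sum _ _ _)); apply/bigmax_leqP => i _.
rewrite mul_polyC (leq_trans (size_scale_leq _ _))// (leq_trans (size_gtransM _ _))//.
Qed.

Lemma gtrans_horner1 y (p : {poly R}) : (gtrans y p).[1] = e 0 * p.[y].
Proof.
rewrite /gtrans horner_sum horner_coef mulr_sumr; apply: eq_bigr => n _.
rewrite hornerM hornerC /gtransM horner_sum big_ord_recl big1 /= => [|i _].
  rewrite double0 subn0 bin0 addr0 hornerM hornerC hornerM hornerXn horner_exp expr1n !expr0; ring.
have w1 : (1 - 'X^2 : {poly R}).[1] = 0 by rewrite hornerD hornerN hornerXn hornerC expr1n subrr.
by rewrite hornerM hornerM hornerXn horner_exp w1 expr0n /= !mulr0.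
Qed.

Lemma gtransZ y c (p : {poly R}) : gtrans y (c%:P * p) = c%:P * gtrans y p.
Proof.
rewrite (@gtrans_widen y _ (size p)); last by rewrite mul_polyC size_scale_leq.
by rewrite mulr_sumr; apply: eq_bigr => i _; rewrite coefCM polyCM mulrA.
Qed.

(** [gtrans y] commutes with [gegenD] and does not raise degrees, so by [gegenD_eigen] it multiplies
    [gegen n] by a constant, which is read off at 1. *)
Lemma gtrans_gegen y n x :
  (gtrans y (gegen n)).[x] * (gegen n).[1] = e 0 * (gegen n).[y] * (gegen n).[x].
Proof.
have [k E] : exists k, gtrans y (gegen n) = k%:P * gegen n.
  apply: gegenD_eigen; first by rewrite -(size_gegen n) size_gtrans.
  by rewrite gegenD_gtrans gegenD_gegen -polyCN gtransZ.
have := gtrans_horner1 y (gegen n); rewrite E !hornerM !hornerC => E1.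
by rewrite mulrAC E1 mulrC.
Qed.

End ProductFormula.

End Gegenbauer.

(** * Integrals against a weight *)

Section WeightedIntegral.
Context {R : realType}.
Notation leb := (@lebesgue_measure R).
Implicit Types (f g w : R -> R) (a b : R).

Definition wint a b w f : R := \int[leb]_(x in `[a, b]) (w x * f x).

Definition weight a b w :=
  leb.-integrable `[a, b] (EFin \o w) /\ forall x, `[a, b]%classic x -> 0 <= w x.

Lemma within_itv_bounded a b f : {within `[a, b], continuous f} ->
  exists M, 0 <= M /\ forall x, a <= x <= b -> `|f x| <= M.
Proof.
move=> cf.
have [|M [_ mrt]] := @compact_bounded _ _ (f @` `[a, b]).
  by apply: (continuous_compact cf); exact: segment_compact.
exists (`|M| + 1); split; first by rewrite addr_ge0.
move=> x xab; apply: (mrt (`|M| + 1)).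
  by rewrite (le_lt_trans (ler_norm _))// ltrDl.
by exists x => //=; rewrite in_itv.
Qed.

Lemma weightP a b w : weight a b w -> forall x, a <= x <= b -> 0 <= w x.
Proof. by move=> [_ w0] x xab; apply: w0; rewrite /= in_itv. Qed.

Lemma wint_integrable a b w f : weight a b w -> {within `[a, b], continuous f} ->
  leb.-integrable `[a, b] (EFin \o (fun x => w x * f x)).
Proof.
move=> [iw w0] cf.
have -> : EFin \o (fun x => w x * f x) = ((EFin \o w) \* (EFin \o f))%E.
  by apply/funext => x /=; rewrite EFinM.
apply: integrableMl => //.
  by apply: subspace_continuous_measurable_fun.
have [M [M0 fM]] := within_itv_bounded cf.
exists M; split; first exact: num_real.
move=> N MN x /= xab; apply: (le_trans (fM x _)); last exact: ltW.
by move: xab; rewrite in_itv.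
Qed.

Lemma eq_wint a b w f g : (forall x, a <= x <= b -> f x = g x) ->
  wint a b w f = wint a b w g.
Proof.
move=> fg; apply: eq_Rintegral => x; rewrite inE /= in_itv /= => xab.
by rewrite fg.
Qed.

Lemma wintD a b w f g : weight a b w -> {within `[a, b], continuous f} ->
  {within `[a, b], continuous g} ->
  wint a b w (fun x => f x + g x) = wint a b w f + wint a b w g.
Proof.
move=> Hw cf cg; rewrite /wint -RintegralD//; [|exact: wint_integrable..].
by apply: eq_Rintegral => x _; rewrite mulrDr.
Qed.

Lemma wintZ a b w f c : weight a b w -> {within `[a, b], continuous f} ->
  wint a b w (fun x => c * f x) = c * wint a b w f.
Proof.
move=> Hw cf; rewrite /wint -RintegralZl//; last exact: wint_integrable.
by apply: eq_Rintegral => x _; rewrite mulrCA.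
Qed.

Lemma within_cst a b c : {within `[a, b], continuous (fun=> c : R)}.
Proof. by apply: continuous_subspaceT; exact: cst_continuous. Qed.

Lemma withinD a b f g : {within `[a, b], continuous f} -> {within `[a, b], continuous g} ->
  {within `[a, b], continuous (fun x => f x + g x)}.
Proof. by move=> cf cg x; apply: continuousD; [exact: cf|exact: cg]. Qed.

Lemma withinM a b f g : {within `[a, b], continuous f} -> {within `[a, b], continuous g} ->
  {within `[a, b], continuous (fun x => f x * g x)}.
Proof. by move=> cf cg x; apply: continuousM; [exact: cf|exact: cg]. Qed.

Lemma withinN a b f : {within `[a, b], continuous f} ->
  {within `[a, b], continuous (fun x => - f x)}.
Proof. by move=> cf x; apply: continuousN; exact: cf. Qed.

Lemma withinB a b f g : {within `[a, b], continuous f} -> {within `[a, b], continuous g} ->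
  {within `[a, b], continuous (fun x => f x - g x)}.
Proof. by move=> cf cg; apply: withinD => //; exact: withinN. Qed.

Lemma within_sum a b (I : Type) (r : seq I) (F : I -> R -> R) :
  (forall i, {within `[a, b], continuous (F i)}) ->
  {within `[a, b], continuous (fun x => \sum_(i <- r) F i x)}.
Proof.
move=> cF; elim: r => [|i r IH].
  have -> : (fun x => \sum_(i <- [::]) F i x) = (fun=> 0) by apply/funext => x; rewrite big_nil.
  exact: within_cst.
have -> : (fun x => \sum_(j <- i :: r) F j x) = (fun x => F i x + \sum_(j <- r) F j x).
  by apply/funext => x; rewrite big_cons.
exact: withinD.
Qed.

Lemma wintB a b w f g : weight a b w -> {within `[a, b], continuous f} ->
  {within `[a, b], continuous g} ->
  wint a b w (fun x => f x - g x) = wint a b w f - wint a b w g.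
Proof.
move=> Hw cf cg; rewrite wintD//; last exact: withinN.
congr (_ + _); rewrite -mulN1r -wintZ//; apply: eq_wint => x _; by rewrite mulN1r.
Qed.

Lemma wint_sum a b w (I : Type) (r : seq I) (F : I -> R -> R) : weight a b w ->
  (forall i, {within `[a, b], continuous (F i)}) ->
  wint a b w (fun x => \sum_(i <- r) F i x) = \sum_(i <- r) wint a b w (F i).
Proof.
move=> Hw cF; elim: r => [|i r IH].
  rewrite big_nil; transitivity (wint a b w (fun=> 0 * 0)).
    by apply: eq_wint => x _; rewrite big_nil mulr0.
  by rewrite wintZ ?mul0r//; exact: within_cst.
rewrite big_cons -IH -wintD//; last exact: within_sum.
by apply: eq_wint => x _; rewrite big_cons.
Qed.

Lemma wint_le a b w f g : weight a b w -> {within `[a, b], continuous f} ->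
  {within `[a, b], continuous g} -> (forall x, a <= x <= b -> f x <= g x) ->
  wint a b w f <= wint a b w g.
Proof.
move=> Hw cf cg fg; apply: le_Rintegral => //; [exact: wint_integrable..|].
by move=> x /=; rewrite in_itv /= => xab; rewrite ler_wpM2l ?fg ?(weightP Hw).
Qed.

Lemma wint_norm_le a b w f M : weight a b w -> {within `[a, b], continuous f} ->
  (forall x, a <= x <= b -> `|f x| <= M) ->
  `|wint a b w f| <= M * wint a b w (fun=> 1).
Proof.
move=> Hw cf fM; rewrite ler_norml -mulNr -!wintZ//; [|exact: within_cst..].
apply/andP; split; apply: wint_le => //; try exact: within_cst.
- by move=> x /fM; rewrite mulr1 ler_norml => /andP[].
- by move=> x /fM; rewrite mulr1 ler_norml => /andP[].
Qed.

Lemma wint_ge0 a b w f : weight a b w -> (forall x, a <= x <= b -> 0 <= f x) ->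
  0 <= wint a b w f.
Proof.
move=> Hw f0; apply: Rintegral_ge0 => x /=; rewrite in_itv /= => xab.
by rewrite mulr_ge0 ?f0 ?(weightP Hw).
Qed.

Lemma within_comp a b f (g : R -> R) : {within `[a, b], continuous f} -> continuous g ->
  {within `[a, b], continuous (fun x => g (f x))}.
Proof.
move=> cf cg; apply/subspace_continuousP => x ax.
have /subspace_continuousP/(_ x ax) h := cf.
exact: (cvg_comp _ _ h (cg (f x))).
Qed.

Lemma within_abs a b f : {within `[a, b], continuous f} ->
  {within `[a, b], continuous (fun x => `|f x|)}.
Proof. by move=> cf; apply: (within_comp cf); exact: norm_continuous. Qed.

Lemma wint_norm a b w f : weight a b w -> {within `[a, b], continuous f} ->
  `|wint a b w f| <= wint a b w (fun x => `|f x|).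
Proof.
move=> Hw cf; rewrite ler_norml; apply/andP; split; last first.
  by apply: wint_le => //; [exact: within_abs|move=> x _; exact: ler_norm].
rewrite -mulN1r -wintZ//; last exact: within_abs.
apply: wint_le => //; first exact: (withinM (within_cst (c := -1)) (within_abs cf)).
by move=> x _; rewrite mulN1r lerNl -normrN ler_norm.
Qed.

Lemma weight_continuous a b w : {within `[a, b], continuous w} ->
  (forall x, a <= x <= b -> 0 <= w x) -> weight a b w.
Proof.
move=> cw w0; split; last by move=> x /=; rewrite in_itv /=; exact: w0.
by apply: continuous_compact_integrable => //; exact: segment_compact.
Qed.

Lemma weight1 a b : weight a b (fun=> 1).
Proof. by apply: weight_continuous => //; exact: within_cst. Qed.

(** The lower bounds on norms and on kernel masses below all come from restriction to a subinterval
    where the integrand is explicitly large. *)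
Lemma wint_ge_itv a b c d w f m : weight a b w -> {within `[a, b], continuous f} ->
  a <= c -> c <= d -> d <= b ->
  (forall x, a <= x <= b -> 0 <= f x) ->
  (forall x, c <= x <= d -> m <= w x * f x) -> m * (d - c) <= wint a b w f.
Proof.
move=> Hw cf ac cd db f0 fm.
have -> : m * (d - c) = \int[leb]_(x in `[c, d]) m.
  by rewrite Rintegral_cst//= lebesgue_measure_itv /= lte_fin; move: cd; rewrite le_eqVlt => /predU1P[->|cd']; rewrite ?ltxx ?cd' /= ?subrr.
have sub : (`[c, d] `<=` `[a, b])%classic.
  by move=> x /=; rewrite !in_itv /= => /andP[cx xd]; rewrite (le_trans ac)// (le_trans xd).
have iwf := wint_integrable Hw cf.
have iwf' : leb.-integrable `[c, d] (EFin \o (fun x => w x * f x)).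
  by apply: integrableS iwf.
have H1 : \int[leb]_(x in `[c, d]) m <= \int[leb]_(x in `[c, d]) (w x * f x).
  apply: le_Rintegral => //.
  apply: continuous_compact_integrable; first exact: segment_compact.
  exact: within_cst.
apply: (le_trans H1).
rewrite /wint /Rintegral fine_le//.
- by apply: integrable_fin_num => //; apply: integrableS iwf.
- by apply: integrable_fin_num.
apply: ge0_subset_integral => //; first by case/integrableP : iwf.
move=> x /=; rewrite in_itv /= lee_fin => xab.
by rewrite mulr_ge0 ?f0 ?(weightP Hw).
Qed.

Lemma FTC a b f F : a <= b -> {within `[a, b], continuous f} ->
  {within `[a, b], continuous F} ->
  (forall x, a < x < b -> is_derive x (1 : R) F (f x)) ->
  wint a b (fun=> 1) f = F b - F a.
Proof.
rewrite le_eqVlt => /predU1P[<- _ _ _|ab cf cF dF].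
  by rewrite subrr /wint set_itv1 Rintegral_set1.
have [dF' FbL FaR] : [/\ {in `]a, b[, forall x, derivable F x 1}, F @ a^'+ --> F a & F @ b^'- --> F b].
  have [cF0 cF1 cF2] := (continuous_within_itvP F ab).1 cF.
  split=> // x; rewrite in_itv /= => xab.
  by case: (dF x xab).
rewrite /wint /Rintegral.
under eq_integral do rewrite mul1r.
rewrite (@continuous_FTC2 _ f F a b) //.
by move=> x; rewrite in_itv /= => xab; have dFx := dF x xab; rewrite derive1E derive_val.
Qed.

End WeightedIntegral.

Section DerivePointwise.
Context {R : realType} {V : normedModType R}.
Implicit Types (f g : V -> R) (x v : V) (a b : R).

Lemma is_derive_addf f g x v a b : is_derive x v f a -> is_derive x v g b ->
  is_derive x v (fun y => f y + g y) (a + b).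
Proof. exact: is_deriveD. Qed.

Lemma is_derive_subf f g x v a b : is_derive x v f a -> is_derive x v g b ->
  is_derive x v (fun y => f y - g y) (a - b).
Proof. exact: is_deriveB. Qed.

Lemma is_derive_oppf f x v a : is_derive x v f a -> is_derive x v (fun y => - f y) (- a).
Proof. exact: is_deriveN. Qed.

Lemma is_derive_cstf c x v : is_derive x v (fun=> c : R) 0.
Proof. exact: is_derive_cst. Qed.

Lemma is_derive_mulf f g x v a b : is_derive x v f a -> is_derive x v g b ->
  is_derive x v (fun y => f y * g y) (a * g x + f x * b).
Proof.
move=> df dg; rewrite [X in is_derive _ _ _ X](_ : _ = f x *: b + g x *: a).
  exact: is_deriveM.
by rewrite /GRing.scale /= addrC (mulrC a).
Qed.

Lemma is_derive_cmulf f x v c a : is_derive x v f a -> is_derive x v (fun y => c * f y) (c * a).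
Proof.
move=> df; have := is_derive_mulf (is_derive_cstf c x v) df.
by rewrite mul0r add0r.
Qed.

End DerivePointwise.

Lemma is_derive_comp1 (R : realType) (h f : R -> R) (x a b : R) :
  is_derive (f x) (1 : R) h a -> is_derive x (1 : R) f b ->
  is_derive x (1 : R) (fun y => h (f y)) (a * b).
Proof. exact: is_derive1_comp. Qed.

(** * Unweighted integrals, substitution and periodicity *)

Section PlainIntegral.
Context {R : realType}.
Notation leb := (@lebesgue_measure R).
Implicit Types (f g : R -> R) (a b : R).

Definition rint a b f : R := wint a b (fun=> 1) f.

Lemma within_cont a b f : continuous f -> {within `[a, b], continuous f}.
Proof. exact: continuous_subspaceT. Qed.

Lemma is_derive_cont f (f' : R -> R) : (forall x, is_derive x (1 : R) f (f' x)) -> continuous f.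
Proof.
by move=> df x; apply/differentiable_continuous/derivable1_diffP; case: (df x).
Qed.

Lemma rintD a b f g : continuous f -> continuous g ->
  rint a b (fun x => f x + g x) = rint a b f + rint a b g.
Proof. by move=> cf cg; apply: wintD; [exact: weight1|exact: within_cont..]. Qed.

Lemma rintB a b f g : continuous f -> continuous g ->
  rint a b (fun x => f x - g x) = rint a b f - rint a b g.
Proof. by move=> cf cg; apply: wintB; [exact: weight1|exact: within_cont..]. Qed.

Lemma rintZ a b c f : continuous f -> rint a b (fun x => c * f x) = c * rint a b f.
Proof. by move=> cf; apply: wintZ; [exact: weight1|exact: within_cont..]. Qed.

Lemma rint_sum a b (I : Type) (r : seq I) (F : I -> R -> R) : (forall i, continuous (F i)) ->
  rint a b (fun x => \sum_(i <- r) F i x) = \sum_(i <- r) rint a b (F i).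
Proof. by move=> cF; apply: wint_sum; [exact: weight1|move=> i; exact: within_cont]. Qed.

Lemma rint_le a b f g : continuous f -> continuous g ->
  (forall x, a <= x <= b -> f x <= g x) -> rint a b f <= rint a b g.
Proof. by move=> cf cg; apply: wint_le; [exact: weight1|exact: within_cont..]. Qed.

Lemma rint_norm a b f : continuous f -> `|rint a b f| <= rint a b (fun x => `|f x|).
Proof. by move=> cf; apply: wint_norm; [exact: weight1|exact: within_cont]. Qed.

Lemma eq_rint a b f g : (forall x, a <= x <= b -> f x = g x) -> rint a b f = rint a b g.
Proof. exact: eq_wint. Qed.

Lemma rint1 a b : a <= b -> rint a b (fun=> 1) = b - a.
Proof.
move=> ab; apply: (FTC ab (F := id)).
- exact: within_cst.
- by apply: within_cont => x; exact: cvg_id.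
Qed.

Lemma rint_norm_le a b f M : a <= b -> continuous f -> (forall x, a <= x <= b -> `|f x| <= M) ->
  `|rint a b f| <= M * (b - a).
Proof.
move=> ab cf fM; rewrite -(rint1 ab).
by apply: wint_norm_le => //; [exact: weight1|exact: within_cont].
Qed.

Lemma rint_FTC a b f F : a <= b -> continuous f ->
  (forall x, is_derive x (1 : R) F (f x)) -> rint a b f = F b - F a.
Proof.
move=> ab cf dF; apply: FTC => //; apply: within_cont => //.
exact: is_derive_cont dF.
Qed.

Lemma rint_cat a b c f : a <= b -> b <= c -> continuous f ->
  rint a c f = rint a b f + rint b c f.
Proof.
move=> ab bc cf; apply/eqP; rewrite addrC -subr_eq; apply/eqP.
have iac : leb.-integrable `[a, c] (EFin \o (fun x => 1 * f x)).
  by apply: wint_integrable; [exact: weight1|exact: within_cont].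
rewrite /rint /wint (@Rintegral_itvB _ _ (BLeft a) (BRight c) b) ?bnd_simp//.
rewrite -Rintegral_itv_obnd_cbnd//.
apply: integrableS iac => //= x; rewrite /= !in_itv /= => /andP[bx ->].
by rewrite (le_trans ab (ltW bx)).
Qed.

(** A primitive on the whole line reduces shifts, reflections and periods of [rint] to evaluations
    of F. *)
Lemma antiderivative f : continuous f -> exists F : R -> R, forall x, is_derive x (1 : R) F (f x).
Proof.
move=> cf.
pose F x := if 0 <= x then rint 0 x f else - rint x 0 f.
have FE a x : a <= 0 -> a <= x -> F x = rint a x f - rint a 0 f.
  move=> a0 ax; rewrite /F; case: ifPn => [x0|].
    by rewrite (rint_cat a0 x0)// addrAC subrr add0r.
  by rewrite -ltNge => /ltW x0; rewrite (rint_cat ax x0)// opprD addrA subrr add0r.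
exists F => x.
(* A base point to the left of both 0 and x: near x, F differs by a constant from the integral
   starting at [a], to which the fundamental theorem applies. *)
pose a := Num.min 0 x - 1.
have a0 : a < 0 by rewrite /a ltrBlDr add0r; case: (leP 0 x) => // /lt_trans; apply.
have ax : a < x by rewrite /a ltrBlDr; case: (leP 0 x) => h; [rewrite ltr_wpDl|rewrite ltrDl].
have i1 : leb.-integrable `[a, x + 1] (EFin \o f).
  by apply: continuous_compact_integrable; [exact: segment_compact|exact: within_cont].
have [d1 d2] := @continuous_FTC1_closed _ f a x (x + 1) (ltr_pwDr ltr01 (lexx x)) i1 ax (cf x).
pose G y := (\int[leb]_(t in `[a, y]) f t)%R.
have GE y : rint a y f = G y.
  by rewrite /rint /wint /G; apply: eq_Rintegral => t _; rewrite mul1r.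
have dG : is_derive x 1 G (f x) by split; [exact: d1|rewrite -derive1E; exact: d2].
have dH : is_derive x 1 (fun y => G y - rint a 0 f) (f x).
  by rewrite -[f x]subr0; exact: (is_derive_subf dG (is_derive_cstf _ _ _)).
apply: near_eq_is_derive dH; near=> y; rewrite (@FE a) ?(ltW a0)// ?GE//.
by rewrite ltW//; near: y; exact: lt_nbhsr ax.
Unshelve. all: by end_near. Qed.

Lemma is_derive_shiftf (F : R -> R) (c x a : R) : is_derive (x + c) (1 : R) F a ->
  is_derive x (1 : R) (fun y => F (y + c)) a.
Proof.
move=> dF; rewrite -[a]mulr1; apply: is_derive_comp1 => //.
by have := is_derive_addf (is_derive_id x (1 : R)) (is_derive_cstf c x (1 : R)); rewrite addr0.
Qed.

Lemma continuous_shiftf f c : continuous f -> continuous (fun x => f (x + c)).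
Proof.
move=> cf x; apply: (@continuous_comp _ _ _ (fun y => y + c) f); last exact: cf.
by apply: cvgD; [exact: cvg_id|exact: cvg_cst].
Qed.

Lemma continuous_oppf f : continuous f -> continuous (fun x => f (- x)).
Proof.
move=> cf x; apply: (@continuous_comp _ _ _ (fun y : R => - y) f); last exact: cf.
by apply: cvgN; exact: cvg_id.
Qed.

Lemma rint_shift a b c f : a <= b -> continuous f ->
  rint a b (fun x => f (x + c)) = rint (a + c) (b + c) f.
Proof.
move=> ab cf; have [F dF] := antiderivative cf.
rewrite (rint_FTC _ cf dF) ?lerD2r//.
exact: (rint_FTC ab (@continuous_shiftf _ c cf) (fun x => is_derive_shiftf (dF (x + c)))).
Qed.

Lemma rint_opp a b f : a <= b -> continuous f ->
  rint a b (fun x => f (- x)) = rint (- b) (- a) f.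
Proof.
move=> ab cf; have [F dF] := antiderivative cf.
rewrite (rint_FTC _ cf dF) ?lerN2//.
have dG x : is_derive x (1 : R) (fun x => - F (- x)) (f (- x)).
  have := is_derive_oppf (is_derive_comp1 (dF (- x)) (is_derive_oppf (is_derive_id x (1 : R)))).
  by rewrite mulrN1 opprK.
by rewrite (rint_FTC ab (continuous_oppf cf) dG) opprK addrC.
Qed.

Lemma rint_period a T f : 0 <= T -> continuous f -> (forall x, f (x + T) = f x) ->
  rint a (a + T) f = rint 0 T f.
Proof.
move=> T0 cf fT; have [F dF] := antiderivative cf.
rewrite !(rint_FTC _ cf dF)// ?lerDl// -[T in RHS]add0r.
apply: (is_derive_0_is_cst (f := fun x => F (x + T) - F x)) => x.
rewrite -(subrr (f x)); apply: (is_derive_subf _ (dF x)).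
by rewrite -[f x]fT; exact: (is_derive_shiftf (dF (x + T))).
Qed.

Lemma rint_period_shift T c f : 0 <= T -> continuous f -> (forall x, f (x + T) = f x) ->
  rint 0 T (fun x => f (x + c)) = rint 0 T f.
Proof. by move=> T0 cf fT; rewrite rint_shift// add0r addrC rint_period. Qed.

(** Uniform continuity in the form suited to positive operators. Pairs at distance at least d, where
    the oscillation may reach 2 M, are absorbed by C = 2 M / d^2 times the squared distance, whose
    mean is a second moment of the kernel. *)
Lemma compact_modulus (A : set (R * R)) (f : R * R -> R) : compact A ->
  {within A, continuous f} -> forall e, 0 < e -> exists C, 0 <= C /\
    forall p q, A p -> A q ->
      `|f p - f q| <= e + C * ((p.1 - q.1) ^+ 2 + (p.2 - q.2) ^+ 2).
Proof.
move=> cA cf e e0.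
have [M [M0 fM]] : exists M, 0 <= M /\ forall p, A p -> `|f p| <= M.
  have [|M [_ mrt]] := @compact_bounded _ _ (f @` A); first exact: continuous_compact.
  exists (`|M| + 1); split; first by rewrite addr_ge0.
  move=> x Ax; apply: (mrt (`|M| + 1)); last by exists x.
  by rewrite (le_lt_trans (ler_norm _))// ltrDl.
pose P (d : R) (p : R * R) := A p -> forall q, A q -> ball p d q -> `|f p - f q| <= e.
have H : \forall d \near (0 : R)^'+, A `<=` P d.
  move/compact_near_coveringP : cA; apply => p Ap.
  have /subspace_continuousP/(_ p Ap)/cvgrPdist_lt/(_ (e / 2)) := cf.
  rewrite divr_gt0// => /(_ isT)/nbhs_ballP[d /= d0 Hd].
  exists (ball p (d / 2), [set x | 0 < x < d / 2]) => /=.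
    split; first by apply: nbhsx_ballx; rewrite divr_gt0.
    by near=> x => /=; apply/andP; split; near: x; [exact: nbhs_right_gt|apply: nbhs_right_lt; rewrite divr_gt0].
  move=> [p' x] /= [pp' /andP[x0 xd]] Ap' q Aq p'q.
  have h1 : `|f p - f p'| < e / 2.
    by apply: Hd => //; apply: le_ball pp'; move: d0; clear; lra.
  have h2 : `|f p - f q| < e / 2.
    apply: Hd => //; rewrite [d]splitr; apply: (ball_triangle pp').
    by apply: le_ball p'q; exact: ltW.
  rewrite (_ : f p' - f q = - (f p - f p') + (f p - f q)); last by ring.
  by apply: (le_trans (ler_normD _ _)); rewrite normrN; move: h1 h2; lra.
have [d [d0 Hd]] : exists d, 0 < d /\ A `<=` P d.
  near (0 : R)^'+ => d; exists d; split; near: d; [exact: nbhs_right_gt|exact: H].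
have C0 : 0 <= 2 * M / d ^+ 2 by rewrite divr_ge0 ?sqr_ge0// mulr_ge0.
exists (2 * M / d ^+ 2); split => //.
move=> p q Ap Aq.
have [pq|npq] := pselect (ball p d q).
  rewrite (le_trans (Hd _ Ap Ap _ Aq pq))// lerDl mulr_ge0 ?addr_ge0 ?sqr_ge0//.
apply: (@le_trans _ _ (2 * M)).
  by rewrite (le_trans (ler_normB _ _))// mulr_natl mulr2n lerD// fM.
rewrite ler_wpDl ?(ltW e0)// mulrAC ler_pdivlMr ?exprn_gt0// ler_wpM2l ?mulr_ge0//.
have [h|h] : d <= `|p.1 - q.1| \/ d <= `|p.2 - q.2|.
  have [h|h] := leP d `|p.1 - q.1|; first by left.
  have [h'|h'] := leP d `|p.2 - q.2|; first by right.
  by exfalso; apply: npq; split.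
- by rewrite ler_wpDr ?sqr_ge0// -[leRHS]real_normK ?num_real// lerXn2r// nnegrE ltW.
- by rewrite ler_wpDl ?sqr_ge0// -[leRHS]real_normK ?num_real// lerXn2r// nnegrE ltW.
Unshelve. all: by end_near. Qed.

End PlainIntegral.

(** * Bernstein polynomials in two variables *)

Section Bernstein.
Context {R : realType}.
Implicit Types (x y z m C e c : R) (f : R -> R -> R).

Inductive is_poly2 : (R -> R -> R) -> Prop :=
| poly2_mono c i j : is_poly2 (fun x y => c * x ^+ i * y ^+ j)
| poly2_add P Q : is_poly2 P -> is_poly2 Q -> is_poly2 (fun x y => P x y + Q x y).

Lemma poly2_cst c : is_poly2 (fun _ _ => c).
Proof.
have -> : (fun _ _ : R => c) = (fun x y => c * x ^+ 0 * y ^+ 0).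
  by apply/funext => x; apply/funext => y; rewrite !expr0 !mulr1.
exact: poly2_mono.
Qed.

Lemma poly2_affx a b P : is_poly2 P -> is_poly2 (fun x y => (a + b * x) * P x y).
Proof.
elim=> [c i j|P1 P2 _ IH1 _ IH2].
  have -> : (fun x y : R => (a + b * x) * (c * x ^+ i * y ^+ j)) =
     (fun x y => (a * c) * x ^+ i * y ^+ j + (b * c) * x ^+ i.+1 * y ^+ j).
    by apply/funext => x; apply/funext => y; rewrite exprS; ring.
  by apply: poly2_add; exact: poly2_mono.
have -> : (fun x y : R => (a + b * x) * (P1 x y + P2 x y)) =
     (fun x y => (a + b * x) * P1 x y + (a + b * x) * P2 x y).
  by apply/funext => x; apply/funext => y; rewrite mulrDr.
exact: poly2_add.
Qed.

Lemma poly2_affy a b P : is_poly2 P -> is_poly2 (fun x y => (a + b * y) * P x y).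
Proof.
elim=> [c i j|P1 P2 _ IH1 _ IH2].
  have -> : (fun x y : R => (a + b * y) * (c * x ^+ i * y ^+ j)) =
     (fun x y => (a * c) * x ^+ i * y ^+ j + (b * c) * x ^+ i * y ^+ j.+1).
    by apply/funext => x; apply/funext => y; rewrite exprS; ring.
  by apply: poly2_add; exact: poly2_mono.
have -> : (fun x y : R => (a + b * y) * (P1 x y + P2 x y)) =
     (fun x y => (a + b * y) * P1 x y + (a + b * y) * P2 x y).
  by apply/funext => x; apply/funext => y; rewrite mulrDr.
exact: poly2_add.
Qed.

(* Expectation of [F] at the position of a random walk after [N] steps from [k],
   each step being +1 with probability (1 + x) / 2 and 0 otherwise. *)
Fixpoint walk (x : R) (N : nat) (F : nat -> R) (k : nat) : R :=
  if N is N'.+1 then (2^-1 + 2^-1 * x) * walk x N' F k.+1 + (2^-1 + - 2^-1 * x) * walk x N' F k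
  else F k.

Lemma walk_le x N F G k : -1 <= x <= 1 -> (forall j, F j <= G j) -> walk x N F k <= walk x N G k.
Proof.
move=> /andP[x1 x2] FG; elim: N k => //= N IH k.
by rewrite lerD// ler_wpM2l//; lra.
Qed.

Lemma walk_lin x N F G a b k :
  walk x N (fun j => a * F j + b * G j) k = a * walk x N F k + b * walk x N G k.
Proof. by elim: N k => //= N IH k; rewrite !IH; ring. Qed.

Lemma walk_cst x N c k : walk x N (fun=> c) k = c.
Proof. by elim: N k => //= N IH k; rewrite !IH; field. Qed.

(** Squared bias plus variance: each step has mean (1 + x) / 2 and variance (1 + x) / 2 times (1 -
    x) / 2. *)
Lemma walk_sqr x N c k : walk x N (fun j => (j%:R - c) ^+ 2) k =
  (k%:R + N%:R * ((1 + x) / 2) - c) ^+ 2 + N%:R * ((1 + x) / 2) * ((1 - x) / 2).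
Proof.
elim: N k => [|N IH] k /=; first by rewrite !mul0r !addr0.
by rewrite !IH -!natr1; field.
Qed.

Lemma eq_walk x N F G k : (forall j, F j = G j) -> walk x N F k = walk x N G k.
Proof. by move=> FG; elim: N k => //= N IH k; rewrite !IH. Qed.

(** The Bernstein operator of the square [-1, 1]^2, as a mean over two independent walks rescaled
    from {0, .., N} to [-1, 1]. *)
Definition bernstein (f : R -> R -> R) (N : nat) (x y : R) : R :=
  walk x N (fun i => walk y N (fun j => f (2 * i%:R / N%:R - 1) (2 * j%:R / N%:R - 1)) 0%N) 0%N.

Lemma poly2_bernstein f N : is_poly2 (bernstein f N).
Proof.
have Hy (g : nat -> R) n k : is_poly2 (fun x y => walk y n g k).
  elim: n k => [|n IH] k /=; first exact: poly2_cst.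
  by apply: poly2_add; apply: poly2_affy.
have Hx (g : nat -> R -> R -> R) : (forall i, is_poly2 (g i)) ->
    forall n k, is_poly2 (fun x y => walk x n (fun i => g i x y) k).
  move=> gP n; elim: n => [|n IH] k /=; first exact: gP.
  by apply: poly2_add; apply: poly2_affx.
apply: (Hx (fun i x y => walk y N (fun j => f (2 * i%:R / N%:R - 1) (2 * j%:R / N%:R - 1)) 0%N)).
by move=> i; exact: Hy.
Qed.

Lemma walk_node_sqr x N : (0 < N)%N ->
  walk x N (fun j => (2 * j%:R / N%:R - 1 - x) ^+ 2) 0 = (1 - x ^+ 2) / N%:R.
Proof.
move=> N0; have N0' : (N%:R : R) != 0 by rewrite pnatr_eq0 -lt0n.
rewrite (@eq_walk _ _ _ (fun j => (4 / N%:R ^+ 2) * (j%:R - N%:R * ((1 + x) / 2)) ^+ 2 + 0 * 0)).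
  by rewrite walk_lin walk_sqr; field.
by move=> j; field.
Qed.

(** Korovkin's argument: positivity transfers a quadratic majorant of f at (x, y), and the variance
    is at most 1 / N in each variable. *)
Lemma bernstein_ub f N x y m C : (0 < N)%N -> -1 <= x <= 1 -> -1 <= y <= 1 -> 0 <= C ->
  (forall u v, f u v <= m + C * ((u - x) ^+ 2 + (v - y) ^+ 2)) ->
  bernstein f N x y <= m + C * (2 / N%:R).
Proof.
move=> N0 x1 y1 C0 fC; have N0' : (0 : R) < N%:R by rewrite ltr0n.
have nn (z : R) : (1 - z ^+ 2) / N%:R <= 1 / N%:R.
  by rewrite ler_pM2r ?invr_gt0// gerBl sqr_ge0.
have H (z w a : R) : -1 <= z <= 1 -> 
   walk z N (fun j => a + w * (2 * j%:R / N%:R - 1 - z) ^+ 2) 0 = a + w * ((1 - z ^+ 2) / N%:R).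
  move=> z1; rewrite (@eq_walk _ _ _ (fun j => a * 1 + w * (2 * j%:R / N%:R - 1 - z) ^+ 2)).
    by rewrite walk_lin walk_cst walk_node_sqr// mulr1.
  by move=> j; rewrite mulr1.
rewrite /bernstein.
apply: (@le_trans _ _ (walk x N (fun i => (m + C * (1 / N%:R)) + C * (2 * i%:R / N%:R - 1 - x) ^+ 2) 0)).
  apply: walk_le => // i.
  apply: (@le_trans _ _ (walk y N (fun j => (m + C * (2 * i%:R / N%:R - 1 - x) ^+ 2) + C * (2 * j%:R / N%:R - 1 - y) ^+ 2) 0)).
    by apply: walk_le => // j; rewrite -addrA -mulrDr.
  by rewrite H// addrAC lerD2r lerD2l ler_wpM2l.
rewrite H// -addrA lerD2l -mulrDr ler_wpM2l//.
by rewrite (le_trans (lerD (lexx _) (nn x)))// -mulrDl.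
Qed.

Lemma bernsteinN f N x y : bernstein (fun u v => - f u v) N x y = - bernstein f N x y.
Proof.
have walkN z F n k : walk z n (fun j => - F j) k = - walk z n F k.
  by elim: n k => //= n IH k; rewrite !IH; ring.
by rewrite /bernstein -walkN; apply: eq_walk => i; rewrite walkN.
Qed.

Lemma bernstein_le f N x y e C : (0 < N)%N -> -1 <= x <= 1 -> -1 <= y <= 1 -> 0 <= C ->
  (forall u v, `|f u v - f x y| <= e + C * ((u - x) ^+ 2 + (v - y) ^+ 2)) ->
  `|bernstein f N x y - f x y| <= e + C * (2 / N%:R).
Proof.
move=> N0 x1 y1 C0 fC; rewrite ler_distl; apply/andP; split; last first.
  rewrite addrA; apply: bernstein_ub => // u v.
  by have := fC u v; rewrite ler_distl addrA => /andP[_].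
suff : bernstein (fun u v => - f u v) N x y <= (e - f x y) + C * (2 / N%:R).
  by rewrite bernsteinN; move: (C * _) (bernstein _ _ _ _) (f x y) => a b c; lra.
apply: bernstein_ub => // u v.
have := fC u v; rewrite ler_distl => /andP[+ _]; move: (C * _) (f u v) (f x y) => a b c; lra.
Qed.

End Bernstein.

(** * Polynomial approximation on compact sets with a retraction *)

Section Weierstrass.
Context {R : realType}.
Implicit Types (F : R * R -> R) (A : set (R * R)).

Definition sqdist (p q : R * R) : R := (p.1 - q.1) ^+ 2 + (p.2 - q.2) ^+ 2.

(** The Bernstein operator samples the whole square, so F is extended by composing with [rho]. As
    [rho] does not increase distances to points of A, the quadratic modulus of F on A serves for the
    extension too. *)
Lemma weierstrass2 A (rho : R * R -> R * R) F e : compact A ->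
  (forall p, A p -> (-1 <= p.1 <= 1) /\ (-1 <= p.2 <= 1)) ->
  (forall p, A (rho p)) -> (forall p, A p -> rho p = p) ->
  (forall p q, A q -> sqdist (rho p) q <= sqdist p q) ->
  {within A, continuous F} -> 0 < e ->
  exists2 P, is_poly2 P & forall p, A p -> `|P p.1 p.2 - F p| <= e.
Proof.
move=> cA A1 rA rid rd cF e0.
have e20 : 0 < e / 2 by rewrite divr_gt0.
have [C [C0 HC]] := compact_modulus cA cF e20.
pose N := (Num.truncn (4 * C / e)).+1.
have NC : C * (2 / N%:R) <= e / 2.
  rewrite mulrA ler_pdivrMr ?ltr0n// mulrAC ler_pdivlMr//.
  have : 4 * C / e < N%:R by rewrite /N truncnS_gt// .
  rewrite ltr_pdivrMr// => h; lra.
exists (bernstein (fun u v => F (rho (u, v))) N); first exact: poly2_bernstein.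
move=> p Ap; have [p1 p2] := A1 p Ap.
have Fp : F p = (fun u v => F (rho (u, v))) p.1 p.2 by rewrite rid -surjective_pairing.
rewrite Fp (le_trans (bernstein_le (e := e / 2) (C := C) _ _ _ _ _))//.
  move=> u v; rewrite -Fp (le_trans (HC _ _ (rA _) Ap))// lerD2l ler_wpM2l//.
  exact: (rd (u, v) p Ap).
by rewrite [leRHS]splitr lerD2l.
Qed.

Definition clamp (x : R) : R := Num.max (-1) (Num.min x 1).

Lemma clampP x : -1 <= clamp x <= 1.
Proof.
by rewrite /clamp; case: (leP x 1) => h1; [case: (leP (-1) x) => h2|case: (leP (-1) (1 : R)) => h2];
  apply/andP; split; lra.
Qed.

Lemma clamp_id x : -1 <= x <= 1 -> clamp x = x.
Proof. by move=> /andP[h1 h2]; rewrite /clamp (min_idPl h2) (max_idPr h1). Qed.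

Lemma clamp_sq x y : -1 <= y <= 1 -> (clamp x - y) ^+ 2 <= (x - y) ^+ 2.
Proof.
move=> /andP[h1 h2]; by rewrite /clamp; case: (leP x 1) => h3; [case: (leP (-1) x) => h4|case: (leP (-1) (1 : R)) => h4]; nra.
Qed.

Let square : set (R * R) := `[-1, 1]%classic `*` `[-1, 1]%classic.

Lemma weierstrass_square F e : {within square, continuous F} -> 0 < e ->
  exists2 P, is_poly2 P & forall x y, -1 <= x <= 1 -> -1 <= y <= 1 -> `|P x y - F (x, y)| <= e.
Proof.
move=> cF e0.
have csq : compact square by apply: compact_setX; exact: segment_compact.
pose rho (p : R * R) := (clamp p.1, clamp p.2).
have sq1 p : square p -> (-1 <= p.1 <= 1) /\ (-1 <= p.2 <= 1) by move=> [/=]; rewrite !in_itv.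
have sq2 p : square (rho p) by split; rewrite /= in_itv /=; exact: clampP.
have sq3 p : square p -> rho p = p.
  by case: p => p1 p2 [/=]; rewrite !in_itv /= /rho /= => h1 h2; rewrite !clamp_id.
have sq4 p q : square q -> sqdist (rho p) q <= sqdist p q.
  by move=> [/=]; rewrite !in_itv /= => h1 h2; rewrite /sqdist /= lerD// clamp_sq.
have [P PP HP] := weierstrass2 csq sq1 sq2 sq3 sq4 cF e0.
exists P => // x y x1 y1; apply: (HP (x, y)); split; by rewrite /= in_itv.
Qed.

Lemma continuous_pairf (T : topologicalType) (f g : T -> R) :
  continuous f -> continuous g -> continuous (fun t => (f t, g t)).
Proof. by move=> cf cg t; exact: (cvg_pair (cf t) (cg t)). Qed.

Notation RR := (measurableTypeR R * measurableTypeR R)%type.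

(** F is the pointwise limit of polynomials that approximate it within 1 / (n + 1) on the square of
    half-side n + 1; polynomials are measurable for the product sigma-algebra. *)
Lemma measurable_continuous2 F : continuous F -> measurable_fun [set: RR] (F : RR -> R).
Proof.
move=> cF.
have H (n : nat) : exists P : R -> R -> R, is_poly2 P /\
   forall x y, -1 <= x <= 1 -> -1 <= y <= 1 -> `|P x y - F (n.+1%:R * x, n.+1%:R * y)| <= n.+1%:R^-1.
  have cFn : {within square, continuous (fun p => F (n.+1%:R * p.1, n.+1%:R * p.2))}.
    apply: continuous_subspaceT => p.
    apply: (@continuous_comp _ _ _ (fun p : R * R => (n.+1%:R * p.1, n.+1%:R * p.2)) F); last exact: cF.
    apply: continuous_pairf => q; apply: cvgM; by [exact: cvg_cst|exact: cvg_fst|exact: cvg_snd].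
  have n0 : 0 < (n.+1%:R^-1 : R) by rewrite invr_gt0.
  have [P PP HP] := weierstrass_square cFn n0.
  by exists P; split.
have [P HP] := choice H.
pose h (n : nat) (p : RR) := P n (n.+1%:R^-1 * p.1) (n.+1%:R^-1 * p.2).
apply: (measurable_fun_cvg (h := h)).
  move=> n; have [c1 c2] : measurable_fun [set: RR] (fun p : RR => n.+1%:R^-1 * p.1 : R) /\
      measurable_fun [set: RR] (fun p : RR => n.+1%:R^-1 * p.2 : R).
    by split; apply: measurable_funM.
  rewrite /h; elim: (HP n).1 => [c i j|P1 P2 _ IH1 _ IH2]; last exact: measurable_funD.
  apply: measurable_funM; last exact: measurable_funX.
  by apply: measurable_funM => //; apply: measurable_funX.
move=> [x y] _; apply/cvgrPdist_le => e e0.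
near=> n.
have n0 : (0 : R) < n.+1%:R by [].
have en : n.+1%:R^-1 <= e.
  by rewrite invf_ple// ?posrE//; apply: (@le_trans _ _ n%:R); [near: n; exact: nbhs_infty_ger|rewrite ler_nat].
have xn : -1 <= n.+1%:R^-1 * x <= 1.
  rewrite -ler_norml normrM gtr0_norm ?invr_gt0// ler_pdivrMl// mulr1.
  by apply: (@le_trans _ _ n%:R); [near: n; exact: nbhs_infty_ger|rewrite ler_nat].
have yn : -1 <= n.+1%:R^-1 * y <= 1.
  rewrite -ler_norml normrM gtr0_norm ?invr_gt0// ler_pdivrMl// mulr1.
  by apply: (@le_trans _ _ n%:R); [near: n; exact: nbhs_infty_ger|rewrite ler_nat].
have := (HP n).2 _ _ xn yn; rewrite distrC !mulVKf ?gt_eqF// => /le_trans; exact.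
Unshelve. all: by end_near. Qed.

End Weierstrass.

(** * Iterated integrals over rectangles *)

Section Fubini.
Context {R : realType}.
Notation leb := (@lebesgue_measure R).
Notation RR := (measurableTypeR R * measurableTypeR R)%type.
Implicit Types (F : R * R -> R) (a b c d : R).

Lemma continuous2_left F y : continuous F -> continuous (fun x => F (x, y)).
Proof.
move=> cF x; apply: (@continuous_comp _ _ _ (fun x => (x, y)) F); last exact: cF.
by apply: continuous_pairf; [move=> z; exact: cvg_id|exact: cst_continuous].
Qed.

Lemma continuous2_right F x : continuous F -> continuous (fun y => F (x, y)).
Proof.
move=> cF y; apply: (@continuous_comp _ _ _ (fun y => (x, y)) F); last exact: cF.
by apply: continuous_pairf; [exact: cst_continuous|move=> z; exact: cvg_id].
Qed.

Lemma continuous_rint F c d : c <= d -> continuous F -> continuous (fun x => rint c d (fun y => F (x, y))).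
Proof.
move=> cd cF x; apply/cvgrPdist_le => e e0.
have cK : compact (`[x - 1, x + 1]%classic `*` `[c, d]%classic : set (R * R)).
  by apply: compact_setX; exact: segment_compact.
pose e' := e / 2 / (d - c + 1).
have dc0 : 0 < d - c + 1 by rewrite ltr_wpDl// subr_ge0.
have e'0 : 0 < e' by rewrite !divr_gt0.
have [C [C0 HC]] := compact_modulus cK (continuous_subspaceT cF) e'0.
pose r := Num.min 1 (e' / (C + 1)).
have C10 : 0 < C + 1 by rewrite ltr_wpDl.
have r0 : 0 < r by rewrite lt_min ltr01 divr_gt0.
near=> z.
have xz : `|x - z| <= r by near: z; apply: cvgr_dist_le => //; exact: cvg_id.
have xz1 : `|x - z| <= 1 by rewrite (le_trans xz)// ge_min lexx.
rewrite -rintB; [|exact: continuous2_right..].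
have H y : c <= y <= d -> `|F (x, y) - F (z, y)| <= 2 * e'.
  move=> cyd; have h1 : (`[x - 1, x + 1]%classic `*` `[c, d]%classic) (x, y).
    by split; rewrite /= in_itv //=; lra.
  have h2 : (`[x - 1, x + 1]%classic `*` `[c, d]%classic) (z, y).
    split; rewrite /= in_itv //=; move: xz1; rewrite ler_norml; lra.
  apply: (le_trans (HC _ _ h1 h2)) => /=; rewrite subrr expr0n addr0.
  rewrite mulr_natl mulr2n lerD2l -real_normK ?num_real//.
  have : `|x - z| ^+ 2 <= `|x - z| by rewrite expr2 ler_piMl.
  move=> /(ler_wpM2l C0)/le_trans; apply.
  apply: (@le_trans _ _ ((C + 1) * r)).
    by rewrite ler_pM// lerDl.
  by rewrite -ler_pdivlMl// mulrC ge_min lexx orbT.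
have cB : continuous (fun y => F (x, y) - F (z, y)).
  by move=> y; apply: cvgB; exact: continuous2_right.
apply: (le_trans (rint_norm_le cd cB H)).
rewrite /e' mulrA [2 * _]mulrC divfK// mulrAC ler_pdivrMr// ler_pM2l//.
by rewrite lerDl.
Unshelve. all: by end_near. Qed.

Lemma rect_bounded F a b c d : continuous F -> exists M, 0 <= M /\
  forall x y, a <= x <= b -> c <= y <= d -> `|F (x, y)| <= M.
Proof.
move=> cF.
have cK : compact (`[a, b]%classic `*` `[c, d]%classic : set (R * R)).
  by apply: compact_setX; exact: segment_compact.
have [|M [_ mrt]] := @compact_bounded _ _ (F @` (`[a, b]%classic `*` `[c, d]%classic)).
  by apply: continuous_compact => //; exact: continuous_subspaceT.
exists (`|M| + 1); split; first by rewrite addr_ge0.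
move=> x y xab ycd; apply: (mrt (`|M| + 1)).
  by rewrite (le_lt_trans (ler_norm _))// ltrDl.
by exists (x, y) => //=; rewrite !in_itv.
Qed.

Lemma integrable_rect F a b c d : continuous F ->
  (leb \x leb)%E.-integrable (`[a, b] `*` `[c, d]) (EFin \o (F : RR -> R)).
Proof.
move=> cF.
have mAB : measurable (`[a, b]%classic `*` `[c, d]%classic : set RR) by exact: measurableX.
apply: measurable_bounded_integrable => //.
- have E : ((leb \x leb) (`[a, b]%classic `*` `[c, d]%classic) = leb `[a, b] * leb `[c, d])%E.
    by apply: product_measure1E.
  have : (leb `[a, b] * leb `[c, d] < +oo)%E.
    rewrite !lebesgue_measure_itv /=.
    by case: ifP => _; case: ifP => _; rewrite ?mule0 ?mul0e // -EFinM ltry.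
  by rewrite -E.
- by apply: measurable_funS (measurable_continuous2 cF).
have [M [M0 FM]] := rect_bounded a b c d cF.
exists M; split; first exact: num_real.
move=> N MN [x y] [/=]; rewrite !in_itv /= => xab ycd.
by rewrite (le_trans (FM _ _ xab ycd))// ltW.
Qed.

Lemma prod_rint_fubini F a b c d : continuous F -> c <= d -> a <= b ->
  \int[(leb \x leb)%E]_(p in (`[a, b] `*` `[c, d])) (F : RR -> R) p =
    rint a b (fun x => rint c d (fun y => F (x, y))) /\
  \int[(leb \x leb)%E]_(p in (`[a, b] `*` `[c, d])) (F : RR -> R) p =
    rint c d (fun y => rint a b (fun x => F (x, y))).
Proof.
move=> cF cd ab.
have iF := integrable_rect a b c d cF.
have mAB : measurable (`[a, b]%classic `*` `[c, d]%classic : set RR) by exact: measurableX.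
have iF' := (integrable_mkcond (EFin \o (F : RR -> R)) mAB).1 iF.
have H1 x : (\int[leb]_y ((EFin \o (F : RR -> R)) \_ (`[a, b] `*` `[c, d])) (x, y) =
    ((fun x => (rint c d (fun y => F (x, y)))%:E) \_ `[a, b]) x)%E.
  rewrite patchE; case: ifPn => xab.
    rewrite /rint /wint /Rintegral fineK; last first.
      apply: integrable_fin_num => //; apply: wint_integrable; first exact: weight1.
      exact/within_cont/continuous2_right.
    rewrite [RHS]integral_mkcond; apply: eq_integral => y _; rewrite !patchE in_setX xab /=.
    by rewrite mul1r.
  rewrite integral0_eq// => y _; rewrite patchE in_setX (negbTE xab).
  by [].
have H2 y : (\int[leb]_x ((EFin \o (F : RR -> R)) \_ (`[a, b] `*` `[c, d])) (x, y) =
    ((fun y => (rint a b (fun x => F (x, y)))%:E) \_ `[c, d]) y)%E.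
  rewrite patchE; case: ifPn => ycd.
    rewrite /rint /wint /Rintegral fineK; last first.
      apply: integrable_fin_num => //; apply: wint_integrable; first exact: weight1.
      exact/within_cont/continuous2_left.
    rewrite [RHS]integral_mkcond; apply: eq_integral => x _; rewrite !patchE in_setX ycd andbT /=.
    by rewrite mul1r.
  rewrite integral0_eq// => x _; rewrite patchE in_setX (negbTE ycd) andbF.
  by [].
rewrite /Rintegral integral_mkcond; split.
  rewrite -(integral12_prod_meas1 iF') /fubini_F.
  under eq_integral do rewrite H1.
  rewrite -integral_mkcond /rint {3}/wint /Rintegral.
  by congr fine; apply: eq_integral => x _; rewrite mul1r.
rewrite -(integral21_prod_meas1 iF') /fubini_G.
under eq_integral do rewrite H2.
rewrite -integral_mkcond /rint {3}/wint /Rintegral.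
by congr fine; apply: eq_integral => x _; rewrite mul1r.
Qed.

Lemma rint_swap F a b c d : continuous F -> c <= d -> a <= b ->
  rint a b (fun x => rint c d (fun y => F (x, y))) =
  rint c d (fun y => rint a b (fun x => F (x, y))).
Proof. by move=> cF cd ab; have [<- <-] := prod_rint_fubini cF cd ab. Qed.

End Fubini.

(** * Singular weights and the product formula *)

Section ImproperFTC.
Context {R : realType}.
Notation leb := (@lebesgue_measure R).
Implicit Types (f F w : R -> R) (a b c d : R).

(** The integrand may be unbounded at the endpoints: the integral function minus F is continuous on
    [a, b] and has derivative 0 inside. *)
Lemma FTC_open a b f F : a < b -> leb.-integrable `[a, b] (EFin \o f) ->
  (forall x, a < x < b -> {for x, continuous f}) ->
  {within `[a, b], continuous F} ->
  (forall x, a < x < b -> is_derive x (1 : R) F (f x)) ->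
  \int[leb]_(x in `[a, b]) f x = F b - F a.
Proof.
move=> ab intf cf cF dF.
pose I x := (\int[leb]_(t in `[a, x]) f t)%R.
have cI : {within `[a, b], continuous I}.
  by apply: (parameterized_integral_continuous (ltW ab)).
have dI x : a < x < b -> is_derive x (1 : R) I (f x).
  move=> /andP[ax xb].
  have xab : a < x < b by rewrite ax.
  have [d1 d2] := continuous_FTC1_closed xb intf ax (cf x xab).
  by split; [exact: d1|rewrite -derive1E; exact: d2].
have [x _] : exists2 c, c \in `]a, b[ & (I b - F b) - (I a - F a) = 0 * (b - a).
  apply: (@MVT _ (fun x => I x - F x) (fun=> 0)) => //; last exact: withinB.
  move=> x; rewrite in_itv /= => xab; rewrite -(subrr (f x)).
  by apply: is_derive_subf; [exact: dI|exact: dF].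
rewrite mul0r {2}/I set_itv1 Rintegral_set1 sub0r opprK -/(I b) => H.
apply/eqP; rewrite -subr_eq0; apply/eqP; rewrite -[RHS]H; ring.
Qed.

Definition jacobi_weight a b (delta : R) x := ((x - a) * (b - x)) `^ delta.

Lemma is_derive_jacobi a b delta x : a < x < b ->
  is_derive x (1 : R) (jacobi_weight a b delta)
    (delta * jacobi_weight a b (delta - 1) x * (b - x - (x - a))).
Proof.
move=> /andP[ax xb].
have h0 : 0 < (x - a) * (b - x) by rewrite mulr_gt0 ?subr_gt0.
have d1 : is_derive x (1 : R) (fun y : R => (y - a) * (b - y)) (b - x - (x - a)).
  have := is_derive_mulf (is_derive_subf (is_derive_id x (1 : R)) (is_derive_cstf a x (1 : R)))
    (is_derive_subf (is_derive_cstf b x (1 : R)) (is_derive_id x (1 : R))).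
  by rewrite subr0 sub0r mul1r mulrN1.
exact: (is_derive_comp1 (f := fun y => (y - a) * (b - y)) (is_derive1_powR delta h0) d1).
Qed.

Lemma continuous_jacobi a b delta x : a < x < b -> {for x, continuous (jacobi_weight a b delta)}.
Proof.
move=> xab; apply/differentiable_continuous/derivable1_diffP.
by case: (is_derive_jacobi delta xab).
Qed.

Lemma within_for a b f : (forall x, a <= x <= b -> {for x, continuous f}) ->
  {within `[a, b], continuous f}.
Proof.
move=> cf; apply: continuous_in_subspaceT => x; rewrite inE /= in_itv /=; exact: cf.
Qed.

Lemma jacobi_ge0 a b delta x : 0 <= jacobi_weight a b delta x.
Proof. exact: powR_ge0. Qed.

Lemma jacobiS a b delta x : a <= x <= b -> -1 < delta ->
  jacobi_weight a b (delta + 1) x = jacobi_weight a b delta x * ((x - a) * (b - x)).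
Proof.
move=> /andP[ax xb] d1; rewrite /jacobi_weight.
have h0 : 0 <= (x - a) * (b - x) by rewrite mulr_ge0 ?subr_ge0.
have d0 : 0 < delta + 1 by rewrite -ltrBlDr sub0r.
by rewrite -(mulr_powRB1 h0 d0) addrK mulrC.
Qed.

Lemma jacobi_le a b delta x : a <= x <= b -> 0 <= delta ->
  jacobi_weight a b delta x <= ((b - a) * (b - a)) `^ delta.
Proof.
move=> /andP[ax xb] d0; apply: ge0_ler_powR => //; rewrite ?nnegrE ?mulr_ge0 ?subr_ge0 ?(le_trans ax xb)//.
by apply: ler_pM; rewrite ?subr_ge0//; lra.
Qed.

(** Let m be the midpoint, h the half-length, w and w1 the weights of exponents delta and delta + 1.
    As (x - a) (b - x) = h^2 - (x - m)^2, h^2 times the integral of w is that of w1 plus that of w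
    (x - m)^2. Integrating the derivative of w1 (x - m) bounds the latter by the former over 2
    (delta + 1); c + d = a + b puts m between c and d, so the boundary terms have the right sign.
    Finally w1 is bounded. *)
Lemma rint_jacobi_le a b delta : a < b -> -1 < delta -> exists B, forall c d,
  a < c -> c <= d -> d < b -> c + d = a + b -> rint c d (jacobi_weight a b delta) <= B.
Proof.
move=> ab d1; have l0 : 0 < delta + 1 by rewrite -ltrBlDr sub0r.
pose h2 := ((b - a) / 2) ^+ 2.
have h20 : 0 < h2 by rewrite exprn_gt0// divr_gt0 ?subr_gt0.
pose B1 := ((b - a) * (b - a)) `^ (delta + 1) * (b - a).
exists (B1 * (1 + (2 * (delta + 1))^-1) / h2) => c d ac cd db cdab.
pose m := (a + b) / 2; pose w := jacobi_weight a b delta.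
pose w1 := jacobi_weight a b (delta + 1).
have inab x : c <= x <= d -> a < x < b.
  by move=> /andP[h1 h2']; rewrite (lt_le_trans ac h1) (le_lt_trans h2' db).
have cw : {within `[c, d], continuous w}.
  by apply: within_for => x /inab; exact: continuous_jacobi.
have cw1 : {within `[c, d], continuous w1}.
  by apply: within_for => x /inab; exact: continuous_jacobi.
have cu : {within `[c, d], continuous (fun x => x - m)}.
  by apply: within_cont => x; apply: cvgB; [exact: cvg_id|exact: cvg_cst].
have cwu : {within `[c, d], continuous (fun x => w x * ((x - m) * (x - m)))}.
  by apply: withinM => //; exact: withinM.
have w1E x : c <= x <= d -> w1 x = h2 * w x - w x * ((x - m) * (x - m)).
  move=> /inab /andP[ax xb]; rewrite /w1 jacobiS//; last by rewrite !ltW.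
  by rewrite -/w /h2 /m; field.
have W1 := weight1 c d.
have V_E : rint c d w1 = h2 * rint c d w - rint c d (fun x => w x * ((x - m) * (x - m))).
  rewrite /rint -wintZ// -wintB//; first exact: eq_wint.
  by apply: withinM => //; exact: within_cst.
have V_le : rint c d w1 <= B1.
  apply: (@le_trans _ _ (((b - a) * (b - a)) `^ (delta + 1) * (d - c))).
    rewrite -(rint1 cd) /rint -wintZ//; last exact: within_cst.
    apply: wint_le => //; first exact: within_cst.
    move=> x /inab /andP[ax xb]; rewrite mulr1 jacobi_le//; [by rewrite !ltW|exact: ltW].
  by rewrite ler_wpM2l ?powR_ge0//; lra.
have dH : rint c d (fun x => w1 x - 2 * (delta + 1) * (w x * ((x - m) * (x - m)))) =
    w1 d * (d - m) - w1 c * (c - m).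
  apply: (FTC (F := fun x => w1 x * (x - m)) cd).
  - by apply: withinB => //; apply: withinM => //; exact: within_cst.
  - exact: withinM.
  move=> x cxd.
  have xab : a < x < b by apply: inab; move: cxd => /andP[/ltW -> /ltW ->].
  have := is_derive_mulf (is_derive_jacobi (delta + 1) xab)
     (is_derive_subf (is_derive_id x (1 : R)) (is_derive_cstf m x (1 : R))).
  rewrite subr0 mulr1 addrK => H; apply: (is_derive_eq H).
  by rewrite -/w -/w1 /m; field.
have dH0 : 0 <= w1 d * (d - m) - w1 c * (c - m).
  by rewrite addr_ge0// -?mulrN mulr_ge0 ?jacobi_ge0// /m; lra.
have U_le : 2 * (delta + 1) * rint c d (fun x => w x * ((x - m) * (x - m))) <= rint c d w1.
  move: dH0; rewrite -dH => dH0; rewrite -subr_ge0 (le_trans dH0)// /rint.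
  have cwu2 : {within `[c, d], continuous (fun x => 2 * (delta + 1) * (w x * ((x - m) * (x - m))))}.
    by apply: withinM => //; exact: within_cst.
  by rewrite (wintB W1 cw1 cwu2) (wintZ _ W1 cwu).
rewrite ler_pdivlMr// mulrC.
have -> : h2 * rint c d w = rint c d w1 + rint c d (fun x => w x * ((x - m) * (x - m))).
  by rewrite V_E subrK.
move: U_le; rewrite -ler_pdivlMl ?mulr_gt0// => U_le.
rewrite mulrDr mulr1 lerD// (le_trans U_le)// mulrC ler_wpM2r// invr_ge0 mulr_ge0// ltW//.
Qed.

Lemma weight_jacobi a b delta : a < b -> -1 < delta -> weight a b (jacobi_weight a b delta).
Proof.
move=> ab d1; split; last by move=> x _; exact: jacobi_ge0.
set w := jacobi_weight a b delta.
have mw : measurable_fun [set: R] w.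
  apply: (measurableT_comp (measurable_powR _)).
  apply: continuous_measurable_fun => x.
  by apply: cvgM; apply: cvgB; try exact: cvg_cst; exact: cvg_id.
have mwE D : measurable D -> measurable_fun D (EFin \o w).
  by move=> mD; apply/measurable_EFinP; apply: measurable_funS mw.
apply/integrableP; split; first exact: mwE.
have [B HB] := rint_jacobi_le ab d1.
under eq_integral do rewrite /= ger0_norm ?jacobi_ge0//.
rewrite integral_itv_bndoo; last exact: mwE.
(* The offset 3 keeps (b - a) / (n + 3) below half of the length, so that these intervals, centred
   at the midpoint, satisfy the hypotheses of [rint_jacobi_le]. *)
pose F (n : nat) : set R := `[a + (b - a) / n.+3%:R, b - (b - a) / n.+3%:R]%classic.
have ba : 0 < b - a by rewrite subr_gt0.
have UF : \bigcup_n F n = `]a, b[%classic.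
  apply/seteqP; split => [x [n _]|x]; rewrite /F /= !in_itv /=.
    move=> /andP[h1 h2]; have n0 : 0 < (b - a) / n.+3%:R by rewrite divr_gt0.
    by rewrite (lt_le_trans _ h1) ?ltrDl// (le_lt_trans h2)// gtrBl.
  move=> /andP[ax xb].
  pose e := Num.min (x - a) (b - x).
  have e0 : 0 < e by rewrite lt_min !subr_gt0 ax.
  exists (Num.truncn ((b - a) / e)) => //=.
  set n := Num.truncn _.
  have ne : (b - a) / n.+3%:R <= e.
    rewrite ler_pdivrMr// mulrC -ler_pdivrMr// (@le_trans _ _ n.+1%:R)//.
      by rewrite ltW// truncnS_gt.
    by rewrite ler_nat ltnW// ltnW.
  have [e1 e2] : e <= x - a /\ e <= b - x by rewrite /e !ge_min !lexx orbT.
  by rewrite /F /= in_itv /=; move: ne e1 e2; move: (_ / _) => t; lra.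
rewrite -UF.
have ndF : nondecreasing_seq F.
  apply/nondecreasing_seqP => n; rewrite subsetEset => x; rewrite /F /= !in_itv /=.
  have : (b - a) / n.+4%:R <= (b - a) / n.+3%:R.
    by rewrite ler_pM2l// lef_pV2 ?posrE// ler_nat.
  move: (_ / _) ((b - a) / _) => u v uv; lra.
have cvgF : (\int[leb]_(x in F i) (EFin \o w) x @[i --> \oo] -->
    \int[leb]_(x in \bigcup_i F i) (EFin \o w) x)%E.
  apply: ge0_nondecreasing_set_cvg_integral => //.
  - by move=> i; exact: measurable_itv.
  - by move=> i; apply: mwE; exact: measurable_itv.
  - by move=> i x _; rewrite /= lee_fin jacobi_ge0.
rewrite -(cvg_lim _ cvgF)//.
apply: (@le_lt_trans _ _ B%:E); last by rewrite ltry.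
apply: lime_le; first by apply/cvg_ex; eexists; exact: cvgF.
near=> n.
have n0 : 0 < (b - a) / n.+3%:R by rewrite divr_gt0.
have n3 : (b - a) / n.+3%:R <= (b - a) / 2 by rewrite ler_pM2l// lef_pV2 ?posrE// ler_nat.
have -> : (\int[leb]_(x in F n) (EFin \o w) x = (rint (a + (b - a) / n.+3%:R) (b - (b - a) / n.+3%:R) w)%:E)%E.
  rewrite /rint /wint /Rintegral fineK.
    by apply: eq_integral => x _ /=; rewrite mul1r.
  apply: integrable_fin_num => //; apply: wint_integrable; first exact: weight1.
  apply: within_for => x /andP[h1 h2]; apply: continuous_jacobi.
  by rewrite (lt_le_trans _ h1) ?ltrDl// (le_lt_trans h2)// gtrBl.
rewrite lee_fin; apply: HB; move: (_ / _) n0 n3 => t t0 t3; lra.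
Unshelve. all: by end_near. Qed.

End ImproperFTC.

(** * The cosine expansion of Gegenbauer polynomials *)

Section GegenbauerTrig.
Context {R : realType}.
Local Open Scope complex_scope.
Implicit Types (s t x y lam : R).

Lemma expiD s t : expi (s + t) = expi s * expi t :> R[i].
Proof. by rewrite /expi; apply/eqP; rewrite eq_complex /= cosD sinD; apply/andP; split; apply/eqP; ring. Qed.

Lemma expi0 : expi 0 = 1 :> R[i].
Proof. by rewrite /expi cos0 sin0. Qed.

Lemma expiX t n : expi t ^+ n = expi (n%:R * t) :> R[i].
Proof.
elim: n => [|n IH]; first by rewrite mul0r expi0.
by rewrite exprS IH -expiD -natr1; congr expi; ring.
Qed.

Lemma sum_complex (I : Type) (r : seq I) (f g : I -> R) :
  \sum_(i <- r) (f i +i* g i) = (\sum_(i <- r) f i) +i* (\sum_(i <- r) g i) :> R[i].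
Proof.
elim: r => [|i r IH]; first by rewrite !big_nil.
by rewrite !big_cons IH; apply/eqP; rewrite eq_complex /= !eqxx.
Qed.

Definition gcos lam (n : nat) t := \sum_(k < n.+1) gcoef lam k * gcoef lam (n - k) * cos ((n%:R - 2 * k%:R) * t).

Lemma gegen_cos lam n t : (gegen lam n).[cos t] = gcos lam n t.
Proof.
have H : ((gegen lam n).[cos t])%:C = gegenH lam (real_complex R) (expi t) (expi (- t)) n :> R[i].
  apply: gegenH_horner.
  - by rewrite -expiD subrr expi0.
  - by rewrite /expi cosN sinN; apply/eqP; rewrite eq_complex /=; apply/andP; split; apply/eqP; ring.
  - by move=> k; rewrite pnatr_eq0.
  - by move=> u v /eqP; rewrite mulf_eq0 => /orP[] /eqP; [left|right].
have : gegenH lam (real_complex R) (expi t) (expi (- t)) n = gcos lam n t +i*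
    \sum_(k < n.+1) gcoef lam k * gcoef lam (n - k) * sin ((n%:R - 2 * k%:R) * t).
  rewrite /gcos -sum_complex; apply: eq_bigr => k _.
  rewrite !expiX -mulrA -expiD.
  have -> : (n - k)%:R * t + k%:R * - t = (n%:R - 2 * k%:R) * t.
    by rewrite natrB -1?ltnS//; ring.
  by apply/eqP; rewrite eq_complex /=; apply/andP; split; apply/eqP; ring.
by rewrite -H => -[].
Qed.

(** All cosine coefficients are positive, so the sum is largest in absolute value at t = 0. *)
Lemma gegen_norm_le lam n x : 0 < lam -> -1 <= x <= 1 -> `|(gegen lam n).[x]| <= (gegen lam n).[1].
Proof.
move=> l0 x1; rewrite -(acosK x1) -[X in _ <= _.[X]]cos0 !gegen_cos /gcos.
rewrite (le_trans (ler_norm_sum _ _ _))// ler_sum// => k _.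
have w0 : 0 < gcoef lam k * gcoef lam (n - k) by rewrite mulr_gt0 ?gcoef_gt0.
rewrite normrM (gtr0_norm w0) ler_wpM2l ?(ltW w0)// mulr0 cos0.
by rewrite ler_norml cos_geN1 cos_le1.
Qed.

End GegenbauerTrig.

(** * The mean against (1 - v^2)^gamma *)

Section SingularMean.
Context {R : realType}.
Notation leb := (@lebesgue_measure R).
Variable gamma : R.
Hypothesis gamma_gtN1 : -1 < gamma.
Notation lam := (gamma + 1).
Implicit Types (F : R -> R) (a b x y v p : R).

(** [powR] has only default values at negative arguments; truncation at 0 gives a power that is
    continuous on the whole line for p > 0. *)
Definition ppow p x := Num.max x 0 `^ p.

Lemma ppowE p x : 0 <= x -> ppow p x = x `^ p.
Proof. by move=> x0; rewrite /ppow; congr (_ `^ _); apply/max_idPl. Qed.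

Lemma continuous_ppow p : 0 < p -> continuous (ppow p).
Proof.
move=> p0 x; apply/cvgrPdist_le => e e0.
have N y : y <= 0 -> ppow p y = 0.
  by move=> y0; rewrite /ppow (max_idPr y0) powR0// gt_eqF.
have [x0|x0|->] := ltgtP x 0.
- near=> y; have y0 : y < 0 by near: y; exact: lt_nbhsl.
  by rewrite (N x (ltW x0)) (N y (ltW y0)) subrr normr0 ltW.
- have cx : {for x, continuous (fun y : R => y `^ p)}.
    apply/differentiable_continuous/derivable1_diffP.
    by case: (is_derive1_powR p x0).
  near=> y; have y0 : 0 < y by near: y; exact: lt_nbhsr.
  rewrite (ppowE p (ltW x0)) (ppowE p (ltW y0)); near: y.
  by move/cvgrPdist_le : cx => /(_ e e0).
near=> y; rewrite (N 0 (lexx 0)) sub0r normrN ger0_norm ?powR_ge0//.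
have [y0|y0] := leP y 0; first by rewrite N// ltW.
rewrite ppowE; last exact: ltW.
have ye : y <= e `^ p^-1.
  by apply: ltW; near: y; apply: lt_nbhsl; rewrite powR_gt0.
apply: (@le_trans _ _ ((e `^ p^-1) `^ p)).
  by apply: ge0_ler_powR => //; rewrite ?nnegrE ?powR_ge0// ltW.
by rewrite -powRrM mulVf ?gt_eqF// powRr1// ltW.
Unshelve. all: by end_near. Qed.

Lemma eq_within_continuous a b (f g : R -> R) : (forall x, a <= x <= b -> f x = g x) ->
  {within `[a, b], continuous f} -> {within `[a, b], continuous g}.
Proof.
move=> fg; apply: subspace_eq_continuous => x; rewrite inE /= in_itv /=; exact: fg.
Qed.

Lemma jacobi_within a b delta : 0 < delta -> {within `[a, b], continuous (jacobi_weight a b delta)}.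
Proof.
move=> d0.
apply: (@eq_within_continuous a b (fun x => ppow delta ((x - a) * (b - x)))).
  move=> x /andP[xa xb]; rewrite /jacobi_weight ppowE// mulr_ge0// subr_ge0//.
apply: within_cont => x; apply: (@continuous_comp _ _ _ (fun x => (x - a) * (b - x)) (ppow delta)).
  by apply: cvgM; apply: cvgB; try exact: cvg_cst; exact: cvg_id.
exact: continuous_ppow.
Qed.

Lemma lam_gt0 : 0 < lam. Proof. by rewrite -ltrBlDr sub0r. Qed.

Definition jmean F := wint (-1) 1 (jacobi_weight (-1) 1 gamma) F.

Definition jmom i := jmean (fun v => v ^+ i).

Lemma jweight : weight (-1) 1 (jacobi_weight (-1) 1 gamma).
Proof. by apply: weight_jacobi => //; rewrite ltrN10 . Qed.

Lemma continuous_expn n : continuous (fun x : R => x ^+ n).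
Proof. exact: exprn_continuous. Qed.

Lemma within_poly a b (p : {poly R}) : {within `[a, b], continuous (fun x => p.[x])}.
Proof. by apply: within_cont; exact: continuous_horner. Qed.

(* The derivative of [(1 - x^2)^(gamma + 1) p] has integral 0. *)
Lemma jmean_parts (p : {poly R}) :
  jmean (fun x => ((1 - 'X^2) * p^`() - (2 * lam)%:P * 'X * p).[x]) = 0.
Proof.
have l0 := lam_gt0.
have N11 : (-1 : R) < 1 by lra.
pose q : {poly R} := (1 - 'X^2) * p^`() - (2 * lam)%:P * 'X * p.
have i1 := wint_integrable jweight (@within_poly (-1) 1 q).
have c1 x : -1 < x < 1 -> {for x, continuous (fun x => jacobi_weight (-1) 1 gamma x * q.[x])}.
  by move=> x1; apply: cvgM; [exact: continuous_jacobi|exact: continuous_horner].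
have c2 : {within `[-1, 1], continuous (fun x => jacobi_weight (-1) 1 lam x * p.[x])}.
  by apply: withinM; [exact: jacobi_within|exact: within_poly].
have d1 x : -1 < x < 1 ->
    is_derive x (1 : R) (fun x => jacobi_weight (-1) 1 lam x * p.[x]) (jacobi_weight (-1) 1 gamma x * q.[x]).
  move=> x1; have H := is_derive_mulf (is_derive_jacobi lam x1) (is_derive_poly p x).
  apply: (is_derive_eq H).
  rewrite addrK jacobiS//; last by case/andP: x1 => ? ?; rewrite !ltW.
  have -> : q.[x] = (1 - x ^+ 2) * p^`().[x] - 2 * lam * x * p.[x] by rewrite /q !hornerE.
  ring.
rewrite /jmean /wint (FTC_open N11 i1 c1 c2 d1).
by rewrite /jacobi_weight subrr mulr0 addrN mul0r powR0 ?gt_eqF// !mul0r subrr.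
Qed.

Lemma jmean_lin (p q : {poly R}) a b : jmean (fun x => (a%:P * p + b%:P * q).[x]) =
  a * jmean (fun x => p.[x]) + b * jmean (fun x => q.[x]).
Proof.
rewrite /jmean -!wintZ; try exact: jweight; try exact: within_poly.
rewrite -wintD; try exact: jweight; try by apply: withinM; [exact: within_cst|exact: within_poly].
by apply: eq_wint => x _; rewrite !hornerE.
Qed.

(** [jmean_parts] at X^(i + 1): the moments satisfy the recurrence assumed of [e] in the product
    formula. *)
Lemma jmom_rec i : (i.+1%:R + 2 * lam) * jmom i.+2 = i.+1%:R * jmom i.
Proof.
have := jmean_parts 'X^(i.+1).
rewrite derivXn /=.
have -> : (1 - 'X ^+ 2) * ('X ^+ i *+ i.+1) - (2 * lam)%:P * 'X * 'X ^+ i.+1 =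
   (i.+1%:R)%:P * 'X ^+ i + (- (i.+1%:R + 2 * lam))%:P * 'X ^+ i.+2 :> {poly R}.
  rewrite -[_ *+ i.+1]mulr_natl -polyC_natr !exprS polyCN polyCD; ring.
rewrite jmean_lin => H.
have E j : jmean (fun x => ('X ^+ j : {poly R}).[x]) = jmom j by apply: eq_wint => x _; rewrite hornerXn.
move: H; rewrite !E => H; lra.
Qed.

Lemma jmom1 : jmom 1 = 0.
Proof.
have := jmean_parts 1; rewrite -polyC1 derivC.
have -> : (1%:P - 'X^2) * 0 - (2 * lam)%:P * 'X * 1%:P = (- (2 * lam))%:P * 'X + 0%:P * 1%:P :> {poly R}.
  rewrite polyCN polyC0; ring.
rewrite jmean_lin mul0r addr0.
have -> : jmean (fun x => 'X.[x]) = jmom 1 by apply: eq_wint => x _; rewrite hornerX.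
by move/eqP; rewrite mulf_eq0 oppr_eq0 mulf_eq0 pnatr_eq0/= gt_eqF ?lam_gt0//= => /eqP.
Qed.

Lemma jmom_odd i : jmom i.*2.+1 = 0.
Proof.
elim: i => [|i IH]; first exact: jmom1.
have := jmom_rec i.*2.+1; rewrite IH mulr0 doubleS => /eqP.
rewrite mulf_eq0 gt_eqF /= => [/eqP//|].
by rewrite addr_gt0// mulr_gt0// lam_gt0.
Qed.

Lemma jmom0_gt0 : 0 < jmom 0.
Proof.
(* On [-1/2, 1/2] the base lies in [3/4, 1]; the exponent |gamma| gives a lower bound whatever the
   sign of gamma. *)
have m0 : 0 < (3 / 4 : R) `^ `|gamma| by rewrite powR_gt0//; lra.
apply: (@lt_le_trans _ _ ((3 / 4) `^ `|gamma| * (1 / 2 - (- (1 / 2))))).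
  by rewrite mulr_gt0//; lra.
apply: wint_ge_itv; try lra.
- exact: jweight.
- by apply: within_cont; exact: continuous_expn.
- by move=> x _; rewrite expr0 ler01.
move=> x /andP[x1 x2]; rewrite expr0 mulr1 /jacobi_weight.
have y0 : 3 / 4 <= (x - -1) * (1 - x) by nra.
have y1 : 0 < (x - -1) * (1 - x) <= 1 by apply/andP; split; nra.
apply: (@le_trans _ _ (((x - -1) * (1 - x)) `^ `|gamma|)).
  by apply: ge0_ler_powR => //; rewrite nnegrE; lra.
by apply: ger_powR => //; exact: ler_norm.
Qed.

Lemma sum_even_odd (g : nat -> R) m :
  \sum_(i < m.*2) g i = \sum_(i < m) (g i.*2 + g i.*2.+1).
Proof.
elim: m => [|m IH]; first by rewrite !big_ord0.
by rewrite doubleS !big_ord_recr /= IH addrA.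
Qed.

Lemma jmean_gtrans (p : {poly R}) x y s : s ^+ 2 = (1 - x ^+ 2) * (1 - y ^+ 2) ->
  jmean (fun v => p.[x * y + v * s]) = (gtrans jmom y p).[x].
Proof.
move=> s2; rewrite /gtrans horner_sum.
transitivity (jmean (fun v => \sum_(n < size p) p`_n * (x * y + v * s) ^+ n)).
  by apply: eq_wint => v _; rewrite horner_coef.
have cl : continuous (fun v => x * y + v * s).
  by move=> v; apply: cvgD; [exact: cvg_cst|apply: cvgM; [exact: cvg_id|exact: cvg_cst]].
have cln n : {within `[-1, 1], continuous (fun v => (x * y + v * s) ^+ n)}.
  apply: within_cont => v.
  exact: (@continuous_comp _ _ _ (fun v => x * y + v * s) (fun u => u ^+ n) _ (cl v) (@continuous_expn n _)).
rewrite /jmean wint_sum; first last.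
- by move=> n; apply: withinM; [exact: within_cst|exact: cln].
- exact: jweight.
apply: eq_bigr => n _; rewrite wintZ; [|exact: jweight|exact: cln].
rewrite hornerM hornerC; congr (_ * _).
transitivity (jmean (fun v => \sum_(j < n.+1) ('C(n, j)%:R * (x * y) ^+ (n - j) * s ^+ j) * v ^+ j)).
  apply: eq_wint => v _; rewrite exprDn; apply: eq_bigr => j _.
  by rewrite [(v * s) ^+ j]exprMn -mulr_natl; ring.
rewrite /jmean wint_sum; first last.
- by move=> j; apply: withinM; [exact: within_cst|apply: within_cont; exact: continuous_expn].
- exact: jweight.
transitivity (\sum_(j < n.+1) ('C(n, j)%:R * (x * y) ^+ (n - j) * s ^+ j) * jmom j).
  by apply: eq_bigr => j _; rewrite wintZ//; [exact: jweight|apply: within_cont; exact: continuous_expn].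
pose g (j : nat) := ('C(n, j)%:R * (x * y) ^+ (n - j) * s ^+ j) * jmom j.
(* The added terms have vanishing binomials; the doubled range can then be split into pairs by
   parity. *)
transitivity (\sum_(j < n.+1.*2) g j).
  rewrite -/(\sum_(j < n.+1) g j) -addnn big_split_ord /= [X in _ + X]big1 ?addr0// => i _.
  by rewrite /g bin_small ?mul0r// leq_addr.
rewrite sum_even_odd /gtransM horner_sum; apply: eq_bigr => i _.
have hx : (1 - 'X^2 : {poly R}).[x] = 1 - x ^+ 2 by rewrite !hornerE.
rewrite /g jmom_odd mulr0 addr0 hornerM hornerC hornerM hornerXn horner_exp hx.
have -> : s ^+ i.*2 = ((1 - x ^+ 2) * (1 - y ^+ 2)) ^+ i by rewrite -s2 -exprM mul2n.
rewrite !exprMn; ring.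
Qed.

(** Gegenbauer's product formula. Only s^2 is prescribed, so s = cos a cos (w - phi) will be
    admissible without regard to signs. *)
Lemma gegen_product n x y s : s ^+ 2 = (1 - x ^+ 2) * (1 - y ^+ 2) ->
  jmean (fun v => (gegen lam n).[x * y + v * s]) =
  jmom 0 * (gegen lam n).[x] * ((gegen lam n).[y] / (gegen lam n).[1]).
Proof.
move=> s2; rewrite (jmean_gtrans _ s2).
have C0 : (gegen lam n).[1] != 0 by rewrite gt_eqF ?gegen1_gt0 ?lam_gt0.
have := gtrans_gegen lam_gt0 jmom_rec y n x.
by move=> H; apply: (mulIf C0); rewrite H; field.
Qed.

End SingularMean.

Section PolySpan.
Context {R : realType}.

Lemma poly_span (Q : nat -> {poly R}) : (forall n, size (Q n) = n.+1) ->
  forall n (q : {poly R}), (size q <= n)%N -> exists c : nat -> R, q = \sum_(j < n) (c j)%:P * Q j.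
Proof.
move=> sQ; elim=> [|n IH] q sq.
  by exists (fun=> 0); rewrite big_ord0; apply/eqP; rewrite -size_poly_leq0.
have lQ : (Q n)`_n != 0.
  by have := lead_coef_eq0 (Q n); rewrite lead_coefE sQ /= => ->; rewrite -size_poly_eq0 sQ.
pose a := q`_n / (Q n)`_n.
have [|c Ec] := IH (q - a%:P * Q n).
  apply/leq_sizeP => j; rewrite leq_eqVlt => /predU1P[<-|nj]; rewrite coefB coefCM.
    by rewrite divfK ?subrr.
  rewrite (leq_sizeP _ _ sq j nj) (leq_sizeP (Q n) n.+1 _ j nj) ?sQ//.
  by rewrite mulr0 subr0.
exists (fun j => if j == n then a else c j).
rewrite big_ord_recr /= eqxx -[LHS](subrK (a%:P * Q n)) Ec; congr (_ + _).
by apply: eq_bigr => j _; rewrite ltn_eqF.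
Qed.

End PolySpan.

(** * Elementary bounds for sine and cosine *)

Section TrigBounds.
Context {R : realType}.
Implicit Types (u x : R).

Lemma sin_MVT u : 0 <= u -> exists2 c, 0 <= c <= u & sin u = cos c * u.
Proof.
move=> u0.
have [c cu E] := @MVT_segment R sin cos 0 u u0 (fun x _ => is_derive_sin x)
  (within_cont (@continuous_sin R)).
by exists c => //; move: E; rewrite sin0 !subr0.
Qed.

Lemma norm_sin_le u : `|sin u| <= `|u|.
Proof.
wlog u0 : u / 0 <= u.
  move=> H; have [/H//|/ltW u0] := leP 0 u.
  by rewrite -normrN -(normrN u) -sinN; apply: H; rewrite oppr_ge0.
have [c _ ->] := sin_MVT u0; rewrite normrM -[leRHS]mul1r ler_wpM2r// ler_norml.
by rewrite cos_geN1 cos_le1.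
Qed.

Lemma cos_half u : 1 - cos u = 2 * sin (u / 2) ^+ 2.
Proof.
have -> : cos u = cos (u / 2 + u / 2) by congr cos; field.
by rewrite cosD -expr2 -expr2 cos2sin2; ring.
Qed.

Lemma one_sub_cos_le u : 1 - cos u <= u ^+ 2 / 2.
Proof.
rewrite cos_half.
have : `|sin (u / 2)| ^+ 2 <= `|u / 2| ^+ 2 by rewrite lerXn2r ?nnegrE// norm_sin_le.
rewrite !real_normK ?num_real// (_ : (u / 2) ^+ 2 = u ^+ 2 / 4); last by field.
by move=> h; lra.
Qed.

Lemma sin_ge_half u : 0 <= u <= 1 -> u / 2 <= sin u.
Proof.
move=> /andP[u0 u1]; have [c /andP[c0 cu] ->] := sin_MVT u0.
have := one_sub_cos_le c; have : c ^+ 2 <= 1 by rewrite expr_le1//; lra.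
nra.
Qed.

End TrigBounds.

(** * The given orthogonal polynomials are Gegenbauer polynomials *)

Section Orthogonality.
Context {R : realType}.
Variable gamma : R.
Hypothesis gamma_gtN1 : -1 < gamma.
Notation lam := (gamma + 1).
Notation C n := (gegen lam n).
Let l0 : 0 < lam. Proof. exact: lam_gt0. Qed.

(** By the derivative bound, C_n stays above half of C_n (1) at distances from 1 up to a multiple of
    n^(-2). The lower bounds for the norms of C_n rest on this. *)
Lemma gegen_lower n (x : R) : -1 <= x <= 1 -> (1 - x) * (2 * (n%:R * (n%:R + 2 * lam) + 1)) <= 1 ->
  (C n).[1] / 2 <= (C n).[x].
Proof.
move=> x1 h; have x11 : x <= 1 by case/andP: x1.
have [c + E] := @MVT_segment R (fun x => (C n).[x]) (fun x => (C n)^`().[x]) x 1 x11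
  (fun x _ => is_derive_poly (C n) x) (within_cont (@continuous_horner _ (C n))).
rewrite in_itv /= => /andP[c1 c2].
have c11 : -1 <= c <= 1 by move: x1; lra.
have dB : (C n)^`().[c] <= n%:R * (n%:R + 2 * lam) * (C n).[1].
  have := @gegen_derivn_le R lam l0 n 1 c (fun k => gegen_norm_le k l0 c11).
  by rewrite derivn1 expr1; apply: le_trans; exact: ler_norm.
have C1 := gegen1_gt0 l0 n.
have k0 : 0 <= n%:R * (n%:R + 2 * lam) by rewrite mulr_ge0// addr_ge0// mulr_ge0// ltW.
have : (C n)^`().[c] * (1 - x) <= n%:R * (n%:R + 2 * lam) * (C n).[1] * (1 - x).
  by rewrite ler_wpM2r// subr_ge0.
pose k := n%:R * (n%:R + 2 * lam).
rewrite -/k in h k0 *; rewrite -/k => h'.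
have kx : k * (1 - x) <= 1 / 2 by move: h x11; clearbody k; clear; lra.
have : 0 <= (C n).[1] * (1 / 2 - k * (1 - x)) by rewrite mulr_ge0 ?subr_ge0// ltW.
by move: E h'; lra.
Qed.

Local Notation gamma' := (gamma + 1 / 2).
Let g1 : -1 < gamma'. Proof. by move: gamma_gtN1; lra. Qed.

(** Lagrange's identity: [jmean_parts] at the Wronskian of C_m and C_n yields the difference of the
    eigenvalues times the inner product, because 2 (gamma' + 1) = 2 lam + 1. *)
Lemma jmeanC_orth m n : m <> n -> jmean gamma' (fun x => (C m * C n).[x]) = 0.
Proof.
move=> mn; have := jmean_parts g1 ((C m)^`() * C n - C m * (C n)^`()).
have -> : (1 - 'X^2) * ((C m)^`() * C n - C m * (C n)^`())^`() -
   (2 * (gamma' + 1))%:P * 'X * ((C m)^`() * C n - C m * (C n)^`()) =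
   gegenD lam (C m) * C n - C m * gegenD lam (C n).
  rewrite /gegenD derivB !derivM (_ : 2 * (gamma' + 1) = 2 * lam + 1); first by ring.
  by field.
rewrite !gegenD_gegen -!polyCN.
set a := n%:R * _; set b := m%:R * _ => H.
have {H} : jmean gamma' (fun x => ((a - b)%:P * (C m * C n) + 0%:P * 0).[x]) = 0.
  rewrite -[RHS]H; apply: eq_wint => x _; congr (_.[x]).
  by rewrite !polyCN polyCB; ring.
rewrite jmean_lin// mul0r addr0 => /eqP; rewrite mulf_eq0 => /orP[|/eqP//].
rewrite subr_eq0 => /eqP ab; exfalso; apply: mn.
have : (n%:R - m%:R) * (n%:R + m%:R + 2 * lam) = 0 :> R.
  by move: ab; rewrite /a /b => ab; lra.
move/eqP; rewrite mulf_eq0 subr_eq0 eqr_nat => /orP[/eqP->//|].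
by rewrite gt_eqF// ltr_wpDl// ?addr_ge0// mulr_gt0.
Qed.

Lemma jmeanC_sqr_gt0 n : 0 < jmean gamma' (fun x => (C n * C n).[x]).
Proof.
have C1 := gegen1_gt0 l0 n.
have k0 : 0 <= n%:R * (n%:R + 2 * lam) by rewrite mulr_ge0// addr_ge0// mulr_ge0// ltW.
(* Chosen so that [gegen_lower] applies on [1 - eta, 1 - eta / 2], an interval that stays away from
   the endpoint, where the weight may degenerate. *)
pose eta := (2 * (n%:R * (n%:R + 2 * lam) + 1))^-1.
have eta0 : 0 < eta by rewrite invr_gt0; lra.
have eta1 : eta <= 1 / 2.
  by rewrite /eta invfM ler_pdivrMr ?ltr_wpDl//; lra.
have m0 : 0 < (eta / 2) `^ `|gamma'| by rewrite powR_gt0//; lra.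
apply: (@lt_le_trans _ _ ((eta / 2) `^ `|gamma'| * ((C n).[1] / 2) ^+ 2 * ((1 - eta / 2) - (1 - eta)))).
  rewrite !mulr_gt0//; lra.
apply: wint_ge_itv; try lra.
- by apply: weight_jacobi => //; lra.
- exact: within_poly.
- by move=> x _; rewrite hornerM -expr2 sqr_ge0.
move=> x /andP[x1 x2].
have y0 : eta / 2 <= (x - -1) * (1 - x) by nra.
have y1 : 0 < (x - -1) * (1 - x) <= 1 by apply/andP; split; nra.
apply: ler_pM; rewrite ?sqr_ge0 ?powR_ge0//.
  apply: (@le_trans _ _ (((x - -1) * (1 - x)) `^ `|gamma'|)).
    by apply: ge0_ler_powR => //; rewrite nnegrE; lra.
  by apply: ger_powR => //; exact: ler_norm.
rewrite hornerM expr2.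
have h : (C n).[1] / 2 <= (C n).[x].
  apply: gegen_lower; first lra.
  have : (1 - x) * eta^-1 <= 1 by rewrite ler_pdivrMr// mul1r; lra.
  by rewrite /eta invrK.
apply: ler_pM => //; lra.
Qed.

Lemma jmeanC_lin_coef n (c : nat -> R) i : (i < n)%N ->
  jmean gamma' (fun x => ((\sum_(j < n) (c j)%:P * C j) * C i).[x]) =
  c i * jmean gamma' (fun x => (C i * C i).[x]).
Proof.
move=> i_n; transitivity (jmean gamma' (fun x => \sum_(j < n) c j * (C j * C i).[x])).
  apply: eq_wint => x _; rewrite mulr_suml horner_sum; apply: eq_bigr => j _.
  by rewrite -mulrA hornerM hornerC.
rewrite /jmean wint_sum; first last.
- by move=> j; apply: withinM; [exact: within_cst|exact: within_poly].
- exact: jweight.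
rewrite (bigD1 (Ordinal i_n))//= wintZ; [|exact: jweight|exact: within_poly].
rewrite [X in _ + X]big1 ?addr0// => j ji; rewrite wintZ; [|exact: jweight|exact: within_poly].
rewrite -/(jmean _ _) jmeanC_orth ?mulr0// => E.
by move: ji; rewrite -val_eqE /= E eqxx.
Qed.

(** For i < n, C_i is a combination of L_0, .., L_(i), all orthogonal to L_n; so in the expansion of
    L_n along the C_j only the term j = n survives, and the degree makes it nonzero. *)
Lemma orthogonal_gegen (L : nat -> {poly R}) : orthogonal_polynomials gamma L ->
  forall n, exists2 k, k != 0 & L n = k%:P * C n.
Proof.
move=> [sL oL] n.
have oL' i j : i <> j -> jmean gamma' (fun x => (L i * L j).[x]) = 0.
  move=> ij; rewrite -[RHS](oL i j ij); apply: eq_Rintegral => x _.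
  rewrite hornerM mulrC; congr (_ * _ `^ _); ring.
have LC i : (i < n)%N -> jmean gamma' (fun x => (L n * C i).[x]) = 0.
  move=> i_n; have [c ->] : exists c : nat -> R, C i = \sum_(j < n) (c j)%:P * L j.
    by apply: (poly_span sL); rewrite size_gegen.
  transitivity (jmean gamma' (fun x => \sum_(j < n) c j * (L n * L j).[x])).
    apply: eq_wint => x _; rewrite mulr_sumr horner_sum; apply: eq_bigr => j _.
    by rewrite mulrCA hornerM hornerC.
  rewrite /jmean wint_sum; first last.
  - by move=> j; apply: withinM; [exact: within_cst|exact: within_poly].
  - exact: jweight.
  apply: big1 => j _; rewrite wintZ; [|exact: jweight|exact: within_poly].
  rewrite -/(jmean _ _) oL' ?mulr0// => E.
  by have := ltn_ord j; rewrite -E ltnn.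
have [c Ec] : exists c : nat -> R, L n = \sum_(j < n.+1) (c j)%:P * C j.
  by apply: (poly_span (size_gegen l0)); rewrite sL.
have c0 i : (i < n)%N -> c i = 0.
  move=> i_n; have := LC i i_n; rewrite Ec (jmeanC_lin_coef c (ltnW i_n : (i < n.+1)%N)).
  by move/eqP; rewrite mulf_eq0 => /orP[/eqP//|]; rewrite gt_eqF// jmeanC_sqr_gt0.
have LE : L n = (c n)%:P * C n.
  rewrite Ec big_ord_recr /= big1 ?add0r// => i _.
  by rewrite c0// polyC0 mul0r.
exists (c n) => //; apply/eqP => cn.
by have := sL n; rewrite LE cn polyC0 mul0r size_poly0.
Qed.

End Orthogonality.

(** * Gegenbauer expansions in the variable sin alpha *)

Section AngularExpansion.
Context {R : realType}.
Variable gamma : R.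
Hypothesis gamma_gtN1 : -1 < gamma.
Notation lam := (gamma + 1).
Notation C n := (gegen lam n).
Implicit Types (f g : R -> R) (x : R).
Let l0 : 0 < lam. Proof. exact: lam_gt0. Qed.
Let l20 : 0 < 2 * lam. Proof. by rewrite mulr_gt0. Qed.

(** The exponent is 2 (2 gamma + 1) - 2 gamma = 2 lam, from the two weights in the inner product and
    its density. Under x = sin alpha this measure is (1 - x^2)^(lam - 1/2) dx. *)
Definition aweight (alpha : R) := ppow (2 * lam) (cos alpha).

Lemma continuous_aweight : continuous aweight.
Proof.
move=> x; apply: (@continuous_comp _ _ _ cos (ppow (2 * lam))); first exact: continuous_cos.
exact: continuous_ppow.
Qed.

Lemma aweight_ge0 x : 0 <= aweight x. Proof. exact: powR_ge0. Qed.

Definition aint f := wint (- (pi / 2)) (pi / 2) aweight f.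

Lemma aweightP : weight (- (pi / 2)) (pi / 2) aweight.
Proof.
apply: weight_continuous; first exact/within_cont/continuous_aweight.
by move=> x _; exact: aweight_ge0.
Qed.

Let pih0 : 0 < pi / 2 :> R. Proof. by rewrite divr_gt0// pi_gt0. Qed.
Let pihN : - (pi / 2) <= pi / 2 :> R. Proof. by rewrite -subr_ge0 opprK addr_ge0// ltW. Qed.

Lemma continuous_sinpoly (p : {poly R}) : continuous (fun x => p.[sin x]).
Proof.
move=> x; apply: (@continuous_comp _ _ _ sin (fun y => p.[y])); first exact: continuous_sin.
exact: continuous_horner.
Qed.

Lemma aintD f g : continuous f -> continuous g -> aint (fun x => f x + g x) = aint f + aint g.
Proof. by move=> cf cg; apply: wintD; [exact: aweightP|exact: within_cont..]. Qed.

Lemma aintB f g : continuous f -> continuous g -> aint (fun x => f x - g x) = aint f - aint g.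
Proof. by move=> cf cg; apply: wintB; [exact: aweightP|exact: within_cont..]. Qed.

Lemma aintZ c f : continuous f -> aint (fun x => c * f x) = c * aint f.
Proof. by move=> cf; apply: wintZ; [exact: aweightP|exact: within_cont..]. Qed.

Lemma aint_norm_le f M : continuous f -> (forall x, - (pi / 2) <= x <= pi / 2 -> `|f x| <= M) ->
  `|aint f| <= M * aint (fun=> 1).
Proof. by move=> cf; apply: wint_norm_le; [exact: aweightP|exact: within_cont]. Qed.

Lemma aint_sum (I : Type) (r : seq I) (F : I -> R -> R) : (forall i, continuous (F i)) ->
  aint (fun x => \sum_(i <- r) F i x) = \sum_(i <- r) aint (F i).
Proof. by move=> cF; apply: wint_sum; [exact: aweightP|move=> i; exact: within_cont]. Qed.

(* With [x = sin alpha], the integrand is the derivative of [(1 - x^2)^(lam + 1 / 2) p]. *)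
Lemma aint_parts (p : {poly R}) :
  aint (fun x => ((1 - 'X^2) * p^`() - (2 * lam + 1)%:P * 'X * p).[sin x]) = 0.
Proof.
pose q : {poly R} := (1 - 'X^2) * p^`() - (2 * lam + 1)%:P * 'X * p.
have qE x : q.[x] = (1 - x ^+ 2) * p^`().[x] - (2 * lam + 1) * x * p.[x] by rewrite /q !hornerE.
have l21 : 0 < 2 * lam + 1 by rewrite addr_gt0.
pose F x := ppow (2 * lam + 1) (cos x) * p.[sin x].
have cF : continuous F.
  move=> x; apply: cvgM; last exact: continuous_sinpoly.
  apply: (@continuous_comp _ _ _ cos (ppow (2 * lam + 1))); first exact: continuous_cos.
  exact: continuous_ppow.
have cf : continuous (fun x => aweight x * q.[sin x]).
  by move=> x; apply: cvgM; [exact: continuous_aweight|exact: continuous_sinpoly].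
have -> : aint (fun x => q.[sin x]) = rint (- (pi / 2)) (pi / 2) (fun x => aweight x * q.[sin x]).
  by apply: eq_Rintegral => x _; rewrite mul1r.
suff dF x : - (pi / 2) < x < pi / 2 -> is_derive x (1 : R) F (aweight x * q.[sin x]).
  rewrite /rint (FTC pihN (within_cont cf) (within_cont cF) dF).
  by rewrite /F cosN cos_pihalf /ppow maxxx powR0 ?gt_eqF// !mul0r subrr.
move=> /andP[x1 x2].
have c0 : 0 < cos x by rewrite cos_gt0_pihalf// x1.
have dpow : is_derive x (1 : R) (fun y => ppow (2 * lam + 1) (cos y)) ((2 * lam + 1) * cos x `^ (2 * lam) * (- sin x)).
  have H : is_derive x (1 : R) (fun y => cos y `^ (2 * lam + 1)) ((2 * lam + 1) * cos x `^ (2 * lam) * (- sin x)).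
    have := @is_derive_comp1 R (fun y => y `^ (2 * lam + 1)) cos x _ _ (is_derive1_powR (2 * lam + 1) c0) (is_derive_cos x).
    by rewrite addrK.
  apply: near_eq_is_derive H; near=> y; rewrite ppowE//.
  rewrite ltW// cos_gt0_pihalf//; apply/andP; split; near: y; [exact: lt_nbhsr|exact: lt_nbhsl].
have H := is_derive_mulf dpow (is_derive_comp1 (is_derive_poly p (sin x)) (is_derive_sin x)).
apply: (is_derive_eq H).
rewrite qE /aweight !ppowE ?ltW//.
have -> : cos x `^ (2 * lam + 1) = cos x `^ (2 * lam) * cos x.
  by rewrite -(mulr_powRB1 (ltW c0) l21) addrK mulrC.
have -> : 1 - sin x ^+ 2 = cos x ^+ 2 by rewrite cos2sin2.
ring.
Unshelve. all: by end_near. Qed.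

Lemma aintC_orth m n : m <> n -> aint (fun x => (C m * C n).[sin x]) = 0.
Proof.
move=> mn; have := aint_parts ((C m)^`() * C n - C m * (C n)^`()).
have -> : (1 - 'X^2) * ((C m)^`() * C n - C m * (C n)^`())^`() -
   (2 * lam + 1)%:P * 'X * ((C m)^`() * C n - C m * (C n)^`()) =
   gegenD lam (C m) * C n - C m * gegenD lam (C n).
  by rewrite /gegenD derivB !derivM; ring.
rewrite !gegenD_gegen -!polyCN.
set a := n%:R * _; set b := m%:R * _ => H.
have {H} : aint (fun x => (a - b) * (C m * C n).[sin x]) = 0.
  rewrite -[RHS]H; apply: eq_wint => x _.
  by rewrite hornerD hornerN !hornerM !hornerC; ring.
rewrite aintZ; last exact: continuous_sinpoly.
move=> /eqP; rewrite mulf_eq0 => /orP[|/eqP//].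
rewrite subr_eq0 => /eqP ab; exfalso; apply: mn.
have : (n%:R - m%:R) * (n%:R + m%:R + 2 * lam) = 0 :> R.
  by move: ab; rewrite /a /b => ab; lra.
move/eqP; rewrite mulf_eq0 subr_eq0 eqr_nat => /orP[/eqP->//|].
by rewrite gt_eqF// ltr_wpDl// ?addr_ge0// mulr_gt0.
Qed.

Definition ngegen n : {poly R} := ((C n).[1]^-1)%:P * C n.
Notation Ct := ngegen.

Let C1 n : 0 < (C n).[1]. Proof. exact: gegen1_gt0. Qed.

Lemma ngegenE n x : (Ct n).[x] = (C n).[x] / (C n).[1].
Proof. by rewrite /ngegen hornerM hornerC mulrC. Qed.

Lemma size_ngegen n : size (Ct n) = n.+1.
Proof. by rewrite /ngegen mul_polyC size_scale ?size_gegen// invr_eq0 gt_eqF. Qed.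

Lemma ngegen_le1 n x : -1 <= x <= 1 -> `|(Ct n).[x]| <= 1.
Proof.
move=> x1; rewrite ngegenE normrM normfV (gtr0_norm (C1 n)) ler_pdivrMr// mul1r.
exact: gegen_norm_le.
Qed.

Lemma ngegen_derivn_le n r x : -1 <= x <= 1 ->
  `|(Ct n)^`(r).[x]| <= (n%:R * (n%:R + 2 * lam)) ^+ r.
Proof.
move=> x1; rewrite /ngegen mul_polyC derivnZ hornerZ normrM normfV (gtr0_norm (C1 n)) mulrC ler_pdivrMr//.
by apply: gegen_derivn_le => // k; exact: gegen_norm_le.
Qed.

Lemma sin_itv x : -1 <= sin x <= 1.
Proof. by rewrite sin_geN1 sin_le1. Qed.

Definition anorm n := aint (fun x => (Ct n * Ct n).[sin x]).

Lemma aintCt_orth m n : m <> n -> aint (fun x => (Ct m * Ct n).[sin x]) = 0.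
Proof.
move=> mn; rewrite -[RHS](mulr0 ((C m).[1]^-1 * (C n).[1]^-1)) -(aintC_orth mn) -aintZ.
  by apply: eq_wint => x _; rewrite !hornerM !hornerC; ring.
exact: continuous_sinpoly.
Qed.

(** The norms decay at most polynomially: at a distance of order r = 1 / (K (n + 1)) from alpha = pi
    / 2 the normalized polynomial is at least 1/2, and the weight is at least a constant times r^M
    for an integer M >= 2 lam. *)
Lemma anorm_lower : exists c p, 0 < c /\ forall n, c / n.+1%:R ^+ p <= anorm n.
Proof.
have l20' := l20; pose K := 1 + 2 * lam.
have K1 : 1 <= K by rewrite lerDl ltW.
pose M := (Num.truncn (2 * lam)).+1.
have lM : 2 * lam <= M%:R by rewrite ltW// truncnS_gt.
exists ((8 * K)^-1 * (4 * K) ^- M), M.+1; split.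
  by rewrite mulr_gt0// ?invr_gt0 ?exprn_gt0//; lra.
move=> n; pose N : R := n.+1%:R.
have N1 : 1 <= N by rewrite ler1n.
(* K = 1 + 2 lam gives n (n + 2 lam) + 1 <= K N^2, so 1 - cos u <= r^2 / 2 meets the condition of
   [gegen_lower] for u <= r. *)
pose r := (K * N)^-1.
have KN1 : 1 <= K * N by rewrite -[leLHS]mulr1 ler_pM.
have r0 : 0 < r by rewrite invr_gt0; lra.
have r1 : r <= 1 by rewrite invf_le1; lra.
have -> : (8 * K)^-1 * (4 * K) ^- M / N ^+ M.+1 = ((r / 4) ^+ M * (1 / 4)) * (r / 2).
  have [K0 N0] : K != 0 /\ N != 0 by rewrite !gt_eqF//; lra.
  have r4 : r / 4 = (4 * K)^-1 * N^-1 by rewrite /r !invfM; ring.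
  rewrite r4 (exprMn M (4 * K)^-1 N^-1) !exprVn exprS /r.
  have : (4 * K) ^+ M != 0 by rewrite expf_neq0// mulf_neq0// pnatr_eq0.
  have : N ^+ M != 0 by rewrite expf_neq0.
  move: ((4 * K) ^+ M) (N ^+ M) => X Y Y0 X0; move: K N K0 N0 {K1 N1 r r0 r1 KN1 r4} => K N K0 N0; field.
  by rewrite K0 N0 X0 Y0.
have pi2 : 1 <= pi / 2 :> R by exact: pihalf_ge1.
have -> : r / 2 = (pi / 2 - r / 2) - (pi / 2 - r) by field.
apply: wint_ge_itv; try (move: r0 r1 pi2; lra).
- exact: aweightP.
- exact/within_cont/continuous_sinpoly.
- by move=> x _; rewrite hornerM -expr2 sqr_ge0.
move=> x /andP[x1 x2].
pose u := pi / 2 - x.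
have u0 : r / 2 <= u by rewrite /u; lra.
have ur : u <= r by rewrite /u; lra.
have cx : cos x = sin u by rewrite /u -opprB sinN sinBpihalf opprK.
have sx : sin x = cos u by rewrite /u -cosN opprB cosBpihalf.
apply: ler_pM; rewrite ?exprn_ge0//; try lra.
  rewrite /aweight cx.
  have su : r / 4 <= sin u.
    have : u / 2 <= sin u by apply: sin_ge_half; lra.
    lra.
  rewrite ppowE; last lra.
  apply: (@le_trans _ _ ((r / 4) `^ (2 * lam))).
    rewrite -powR_mulrn; last lra.
    by apply: ger_powR => //; lra.
  by apply: ge0_ler_powR; rewrite ?nnegrE; lra.
have h : 1 / 2 <= (Ct n).[sin x].
  rewrite ngegenE ler_pdivlMr// mulrC mulrA mulr1.
  apply: gegen_lower => //; first exact: sin_itv.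
  rewrite sx; have := one_sub_cos_le u => hu.
  have hu2 : u ^+ 2 <= r ^+ 2 by rewrite lerXn2r ?nnegrE; lra.
  have : n%:R * (n%:R + 2 * lam) + 1 <= K * N ^+ 2.
    have n0 : 0 <= (n%:R : R) by [].
    by rewrite /K /N -natr1; move: l20; nra.
  have rK : r ^+ 2 * (K * N ^+ 2) <= 1.
    rewrite /r exprVn exprMn ler_pdivrMl; last by rewrite mulr_gt0 ?exprn_gt0//; lra.
    by rewrite mulr1 ler_wpM2r ?sqr_ge0//; nra.
  have k0 : 0 <= n%:R * (n%:R + 2 * lam) by rewrite mulr_ge0// addr_ge0// ltW.
  move=> h2.
  have : (1 - cos u) * (2 * (n%:R * (n%:R + 2 * lam) + 1)) <= r ^+ 2 / 2 * (2 * (K * N ^+ 2)).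
    by apply: ler_pM; rewrite ?subr_ge0 ?cos_le1//; lra.
  by move=> h3; lra.
rewrite hornerM; nra.
Qed.

Definition acoef n f := aint (fun x => f x * (Ct n).[sin x]) / anorm n.

Let cfCt f n : continuous f -> continuous (fun x => f x * (Ct n).[sin x]).
Proof. by move=> cf x; apply: cvgM; [exact: cf|exact: continuous_sinpoly]. Qed.

Lemma anorm_gt0 n : 0 < anorm n.
Proof.
have [c [p [c0 H]]] := anorm_lower.
by apply: lt_le_trans (H n); rewrite divr_gt0// exprn_gt0.
Qed.

Lemma acoef_bound : exists A p, 0 <= A /\ forall n f (M : R), continuous f -> 0 <= M ->
  (forall x, - (pi / 2) <= x <= pi / 2 -> `|f x| <= M) -> `|acoef n f| <= A * n.+1%:R ^+ p * M.
Proof.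
have [c [p [c0 H]]] := anorm_lower.
have W0 : 0 <= aint (fun=> 1) by apply: wint_ge0 => //; exact: aweightP.
exists (aint (fun=> 1) / c), p; split; first by rewrite divr_ge0// ltW.
move=> n f M cf M0 fM.
rewrite /acoef normrM normfV (gtr0_norm (anorm_gt0 n)) ler_pdivrMr ?anorm_gt0//.
have h : `|aint (fun x => f x * (Ct n).[sin x])| <= M * aint (fun=> 1).
  apply: aint_norm_le; first exact: cfCt.
  move=> x /fM h; rewrite normrM -[leRHS]mulr1 ler_pM// ngegen_le1//.
  exact: sin_itv.
apply: (le_trans h).
have np : 0 < n.+1%:R ^+ p :> R by rewrite exprn_gt0.
rewrite -[leLHS]mulr1 (_ : _ / c * _ * M * _ = M * aint (fun=> 1) * (n.+1%:R ^+ p / c * anorm n)); last by ring.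
rewrite ler_wpM2l ?mulr_ge0//.
by rewrite mulrAC ler_pdivlMr// mul1r mulrC -ler_pdivrMr.
Qed.

Lemma acoefB n f g : continuous f -> continuous g ->
  acoef n (fun x => f x - g x) = acoef n f - acoef n g.
Proof.
move=> cf cg; rewrite /acoef -mulrBl -aintB; [|exact: cfCt..].
by congr (_ / _); apply: eq_wint => x _; rewrite mulrBl.
Qed.

Lemma eq_acoef n f g : (forall x, - (pi / 2) <= x <= pi / 2 -> f x = g x) -> acoef n f = acoef n g.
Proof. by move=> fg; congr (_ / _); apply: eq_wint => x /fg ->. Qed.

Let acoef_span n N (c : nat -> R) :
  acoef n (fun x => (\sum_(j < N) (c j)%:P * Ct j).[sin x]) = if (n < N)%N then c n else 0.
Proof.
have E : aint (fun x => (\sum_(j < N) (c j)%:P * Ct j).[sin x] * (Ct n).[sin x]) =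
    \sum_(j < N) c j * aint (fun x => (Ct j * Ct n).[sin x]).
  transitivity (aint (fun x => \sum_(j < N) c j * (Ct j * Ct n).[sin x])).
    apply: eq_wint => x _; rewrite horner_sum mulr_suml; apply: eq_bigr => j _.
    by rewrite hornerM hornerC [in RHS]hornerM mulrA.
  rewrite aint_sum; last by move=> j x; apply: cvgM; [exact: cvg_cst|exact: continuous_sinpoly].
  by apply: eq_bigr => j _; rewrite aintZ//; exact: continuous_sinpoly.
rewrite /acoef E; case: ifPn => [nN|]; last first.
  rewrite -leqNgt => Nn; rewrite big1 ?mul0r// => j _; rewrite aintCt_orth ?mulr0// => jn.
  by have := ltn_ord j; rewrite jn ltnNge Nn.
rewrite (bigD1 (Ordinal nN))//= big1 ?addr0; first by rewrite mulfK// gt_eqF ?anorm_gt0.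
move=> j jn; rewrite aintCt_orth ?mulr0// => E'.
by move: jn; rewrite -val_eqE /= E' eqxx.
Qed.

Lemma acoef_poly N (Q : {poly R}) : (size Q <= N)%N ->
  (forall n, (N <= n)%N -> acoef n (fun x => Q.[sin x]) = 0) /\
  forall x, Q.[sin x] = \sum_(j < N) acoef j (fun x => Q.[sin x]) * (Ct j).[sin x].
Proof.
move=> sQ; have [c ->] := poly_span size_ngegen sQ; split.
  by move=> n Nn; rewrite acoef_span ltnNge Nn.
move=> x; rewrite horner_sum; apply: eq_bigr => j _.
by rewrite acoef_span ltn_ord hornerM hornerC.
Qed.

(** Q equals its own finite expansion, so f differs from its partial sum by f - Q and the partial
    sum of f - Q, each controlled by d up to a power of N. *)
Lemma acoef_expansion : exists A p, 0 <= A /\ forall N (Q : {poly R}) f (d : R),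
  continuous f -> (size Q <= N)%N -> 0 <= d ->
  (forall x, - (pi / 2) <= x <= pi / 2 -> `|f x - Q.[sin x]| <= d) ->
  (forall n, (N <= n)%N -> `|acoef n f| <= A * n.+1%:R ^+ p * d) /\
  (forall x, - (pi / 2) <= x <= pi / 2 ->
     `|f x - \sum_(j < N) acoef j f * (Ct j).[sin x]| <= A * N.+1%:R ^+ p * d).
Proof.
have [A [p [A0 H]]] := acoef_bound.
exists (A + 1), p.+1; split; first by rewrite addr_ge0.
move=> N Q f d cf sQ d0 fQ.
have cQ : continuous (fun x => Q.[sin x]) by exact: continuous_sinpoly.
have cfQ : continuous (fun x => f x - Q.[sin x]).
  by move=> x; apply: cvgB; [exact: cf|exact: cQ].
have [Q1 Q2] := acoef_poly sQ.
have B n := H n _ _ cfQ d0 fQ.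
split.
  move=> n Nn; have := B n; rewrite acoefB// Q1// subr0 => /le_trans; apply.
  rewrite ler_wpM2r// ler_pM ?exprn_ge0 ?lerDl// exprS ler_peMl ?exprn_ge0//.
  by rewrite ler1n.
move=> x xI; rewrite -[f x](subrK Q.[sin x]) -addrA [in X in _ + X]Q2 -sumrB.
apply: (le_trans (ler_normD _ _)).
have h : `|\sum_(j < N) (acoef j (fun x => Q.[sin x]) * (Ct j).[sin x] - acoef j f * (Ct j).[sin x])|
    <= \sum_(j < N) A * N.+1%:R ^+ p * d.
  apply: (le_trans (ler_norm_sum _ _ _)); apply: ler_sum => j _.
  rewrite -mulrBl normrM -[leRHS]mulr1 ler_pM//; last exact/ngegen_le1/sin_itv.
  rewrite distrC -acoefB// (le_trans (B j))// ler_wpM2r// ler_wpM2l// lerXn2r ?nnegrE//.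
  by rewrite ler_nat ltnS ltnW.
apply: (le_trans (lerD (fQ x xI) h)).
rewrite sumr_const card_ord -[_ *+ N]mulr_natl.
have N1 : 1 <= N.+1%:R ^+ p :> R by rewrite exprn_ege1// ler1n.
rewrite exprS; set Y := _ ^+ p in N1 *; rewrite -natr1.
have N0 : 0 <= N%:R :> R by [].
rewrite -subr_ge0.
have -> : (A + 1) * ((N%:R + 1) * Y) * d - (d + N%:R * (A * Y * d)) =
  A * Y * d + N%:R * Y * d + (Y - 1) * d by ring.
have Y0 : 0 <= Y by rewrite (le_trans _ N1).
by rewrite !addr_ge0// !mulr_ge0// subr_ge0.
Qed.

End AngularExpansion.

(** * Jackson's theorem *)

Section Periodic.
Context {R : realType}.
Implicit Types (f g : R -> R) (x t c : R).

Definition pint f : R := rint 0 (2 * pi) f.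

Definition per2pi f := forall x, f (x + 2 * pi) = f x.

Let tp0 : 0 <= 2 * pi :> R. Proof. by rewrite mulr_ge0// pi_ge0. Qed.

Lemma per2piN f x : per2pi f -> f (x - 2 * pi) = f x.
Proof. by move=> pf; rewrite -pf subrK. Qed.

Lemma cos_per : per2pi cos.
Proof. by move=> x; rewrite mulr_natl cosD2pi. Qed.

Lemma sin_per : per2pi sin.
Proof. by move=> x; rewrite mulr_natl sinD2pi. Qed.

Lemma cos_nat_per (m : nat) x : cos (x + m%:R * (2 * pi)) = cos x.
Proof.
elim: m => [|m IH]; first by rewrite mul0r addr0.
by rewrite -natr1 mulrDl mul1r addrA cos_per.
Qed.

Lemma sin_nat_per (m : nat) x : sin (x + m%:R * (2 * pi)) = sin x.
Proof.
elim: m => [|m IH]; first by rewrite mul0r addr0.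
by rewrite -natr1 mulrDl mul1r addrA sin_per.
Qed.

Lemma pint_shift c f : continuous f -> per2pi f -> pint (fun x => f (x + c)) = pint f.
Proof. by move=> cf pf; apply: rint_period_shift. Qed.

Lemma pint_any a f : continuous f -> per2pi f -> rint a (a + 2 * pi) f = pint f.
Proof. by move=> cf pf; apply: rint_period. Qed.

Lemma pint_opp f : continuous f -> per2pi f -> pint (fun x => f (- x)) = pint f.
Proof.
move=> cf pf; by rewrite -(pint_any (- (2 * pi)) cf pf) addNr /pint rint_opp// oppr0.
Qed.

Lemma pint_refl c f : continuous f -> per2pi f -> pint (fun x => f (c - x)) = pint f.
Proof.
move=> cf pf; rewrite -(pint_shift c cf pf) -[RHS]pint_opp.
- by apply: eq_rint => x _; rewrite addrC.
- exact: continuous_shiftf.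
- by move=> x; rewrite addrAC pf.
Qed.

Lemma pint_sym f : continuous f -> per2pi f -> rint (- pi) pi f = pint f.
Proof. by move=> cf pf; rewrite -(pint_any (- pi) cf pf) mulr_natl mulr2n addrA addNr add0r. Qed.

Inductive is_cospoly (n : nat) : (R -> R) -> Prop :=
| cospoly0 : is_cospoly n (fun=> 0)
| cospolyS k m F : (m <= n)%N -> is_cospoly n F -> is_cospoly n (fun x => k * cos (m%:R * x) + F x).

Lemma cospoly_add n F G : is_cospoly n F -> is_cospoly n G -> is_cospoly n (fun x => F x + G x).
Proof.
move=> HF HG; elim: HF => [|k m F' mn _ IH].
  by rewrite (_ : (fun x => 0 + G x) = G)//; apply/funext => x; rewrite add0r.
rewrite (_ : (fun x => _ + G x) = fun x => k * cos (m%:R * x) + (F' x + G x)).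
  exact: cospolyS.
by apply/funext => x; rewrite addrA.
Qed.

Lemma cospoly_cos n m k : (m <= n)%N -> is_cospoly n (fun x => k * cos (m%:R * x)).
Proof.
move=> mn; rewrite (_ : (fun x => _) = fun x => k * cos (m%:R * x) + 0).
  by apply: cospolyS => //; exact: cospoly0.
by apply/funext => x; rewrite addr0.
Qed.

Lemma cospoly_step n F : is_cospoly n F -> is_cospoly n.+1 (fun x => (1 + cos x) / 2 * F x).
Proof.
elim=> [|k m F' mn _ IH].
  rewrite (_ : (fun x => _) = fun=> 0); first exact: cospoly0.
  by apply/funext => x; rewrite mulr0.
(* For m = 0 the lower frequency m - 1 is replaced by 1, cosine being even. *)
have hm : ((if m is m'.+1 then m' else 1) <= n.+1)%N by case: m mn {IH} => // m mn; rewrite ltnW// ltnW.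
have E : (fun x => (1 + cos x) / 2 * (k * cos (m%:R * x) + F' x)) =
   (fun x => (k / 2 * cos (m%:R * x) + (k / 4 * cos (m.+1%:R * x) + k / 4 * cos ((if m is m'.+1 then m' else 1%N)%:R * x))) + (1 + cos x) / 2 * F' x).
  apply/funext => x; rewrite mulrDr; congr (_ + _).
  case: m {mn IH hm} => [|m].
    by rewrite mul0r cos0 mul1r; field.
  have -> : m.+2%:R * x = m.+1%:R * x + x by rewrite -[m.+2%:R]natr1; ring.
  have -> : m%:R * x = m.+1%:R * x - x by rewrite -[m.+1%:R]natr1; ring.
  by rewrite cosD cosB; field.
rewrite E; apply: cospoly_add => //; apply: cospoly_add.
  by apply: cospoly_cos; rewrite leqW.
by apply: cospoly_add; apply: cospoly_cos.
Qed.

(** The de la Vallee Poussin kernel cos^(2 N) (t / 2), not normalized. *)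
Definition kN (N : nat) (t : R) := ((1 + cos t) / 2) ^+ N.

Lemma cospoly_kN N : is_cospoly N (kN N).
Proof.
elim: N => [|N IH].
  rewrite (_ : kN 0 = fun x => 1 * cos (0%:R * x)); first exact: cospoly_cos.
  by apply/funext => x; rewrite /kN expr0 mul0r cos0 mulr1.
rewrite (_ : kN N.+1 = fun x => (1 + cos x) / 2 * kN N x); first exact: cospoly_step.
by apply/funext => x; rewrite /kN exprS.
Qed.

Lemma continuous_kN N : continuous (kN N).
Proof.
move=> x; apply: (@continuous_comp _ _ _ (fun t => (1 + cos t) / 2) (fun u => u ^+ N)).
  apply: cvgM; last exact: cvg_cst.
  by apply: cvgD; [exact: cvg_cst|exact: continuous_cos].
exact: exprn_continuous.
Qed.

Lemma kN_per N : per2pi (kN N).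
Proof. by move=> x; rewrite /kN cos_per. Qed.

Lemma kN_ge0 N t : 0 <= kN N t.
Proof. by rewrite exprn_ge0// divr_ge0//; have := cos_geN1 t; lra. Qed.

Definition kmass N := pint (kN N).

Lemma kmass_gt0 N : 0 < kmass N.
Proof.
have k0 : 0 < ((1 + 1 / 2) / 2 : R) ^+ N by rewrite exprn_gt0//; lra.
apply: (@lt_le_trans _ _ (((1 + 1 / 2) / 2 : R) ^+ N * (1 - 0))); first by rewrite subr0 mulr1.
have p1 : 2 <= pi :> R := pi_ge2 R.
apply: wint_ge_itv; try (move: p1; lra).
- exact: weight1.
- exact/within_cont/continuous_kN.
- by move=> x _; exact: kN_ge0.
move=> x /andP[x0 x1].
have hc : 1 / 2 <= cos x by have := one_sub_cos_le x; nra.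
by rewrite [leRHS]mul1r /kN lerXn2r ?nnegrE//; lra.
Qed.

(** The periodic function sin t (1 + cos t)^N has derivative (1 + cos t)^N (1 - (N + 1) (1 - cos
    t)), whose integral over a period is 0. *)
Lemma kmass_moment N : pint (fun t => kN N t * (1 - cos t)) = kmass N / N.+1%:R.
Proof.
have dF x : is_derive x (1 : R) (fun t => sin t * (1 + cos t) ^+ N)
    ((1 + cos x) ^+ N * (1 - N.+1%:R * (1 - cos x))).
  have H0 : is_derive x (1 : R) (fun t => 1 + cos t) (- sin x).
    by have := is_derive_addf (is_derive_cstf 1 x (1 : R)) (is_derive_cos x); rewrite add0r.
  have H1 : is_derive x (1 : R) (fun t => (1 + cos t) ^+ N) (N%:R * (1 + cos x) ^+ N.-1 * (- sin x)).
    have := is_derive_comp1 (f := fun t => 1 + cos t) (is_derive_poly ('X ^+ N) (1 + cos x)) H0.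
    rewrite derivXn hornerMn hornerXn mulr_natl => H.
    rewrite (_ : (fun t => _) = (fun t => ('X^N).[1 + cos t]))//.
    by apply/funext => t; rewrite hornerXn.
  apply: (is_derive_eq (is_derive_mulf (is_derive_sin x) H1)).
  have s2 : sin x * sin x = (1 - cos x) * (1 + cos x).
    by rewrite -expr2 sin2cos2; ring.
  case: N {H1} => [|N]; first by rewrite !expr0 mul0r; ring.
  rewrite /= exprS -[N.+2%:R]natr1.
  rewrite (_ : sin x * (N.+1%:R * (1 + cos x) ^+ N * - sin x) = - (N.+1%:R * (1 + cos x) ^+ N * (sin x * sin x))); last by ring.
  by rewrite s2; ring.
have c1 : continuous (fun x : R => (1 + cos x) ^+ N * (1 - N.+1%:R * (1 - cos x))).
  have cc : continuous (fun x : R => cos x) by exact: continuous_cos.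
  move=> x; apply: cvgM.
    apply: (@continuous_comp _ _ _ (fun t => 1 + cos t) (fun u => u ^+ N)); last exact: exprn_continuous.
    by apply: cvgD; [exact: cvg_cst|exact: cc].
  apply: cvgB; first exact: cvg_cst.
  by apply: cvgM; [exact: cvg_cst|apply: cvgB; [exact: cvg_cst|exact: cc]].
have := rint_FTC tp0 c1 dF; rewrite -[in sin _](add0r (2 * pi)) sin_per !sin0 !mul0r subrr => H.
have c2 : continuous (fun t => kN N t * (1 - cos t)).
  by move=> x; apply: cvgM; [exact: continuous_kN|apply: cvgB; [exact: cvg_cst|exact: continuous_cos]].
have : pint (fun t => kN N t - N.+1%:R * (kN N t * (1 - cos t))) = 0.
  rewrite -[RHS](mulr0 (2 ^- N)) -{}H -rintZ//.
  by apply: eq_rint => x _; rewrite /kN expr_div_n; ring.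
rewrite /pint rintB; [|exact: continuous_kN|by move=> x; apply: cvgM; [exact: cvg_cst|exact: c2]].
rewrite rintZ// => /eqP; rewrite subr_eq0 => /eqP E.
by rewrite /kmass /pint E [RHS]mulrC mulKf// pnatr_eq0.
Qed.

Lemma sqr_le_cos t : - pi <= t <= pi -> t ^+ 2 <= 32 * (1 - cos t).
Proof.
wlog t0 : t / 0 <= t.
  move=> H /andP[t1 t2]; have [t0|/ltW t0] := leP 0 t; first by apply: H => //; rewrite t1.
  rewrite -sqrrN -cosN; apply: H; first by rewrite oppr_ge0.
  by rewrite lerN2 t2 lerNl.
move=> /andP[_ tpi]; rewrite cos_half.
(* Up to t = 2, [sin_ge_half] gives t / 4; beyond, sin (t / 2) >= sin 1 >= 1/2, and t < 4. Squaring
   t / 8 is the origin of the constant 32. *)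
have h : t / 8 <= sin (t / 2).
  have [t2|t2] := leP t 2.
    have : t / 2 / 2 <= sin (t / 2) by apply: sin_ge_half; lra.
    by move: t0; lra.
  have p1 := @pihalf_ge1 R; have p2 := @pihalf_lt2 R.
  have p3 : t <= 2 * (pi / 2) by rewrite mulrC divfK.
  have : sin 1 <= sin (t / 2).
    have [/ltW//|] := boolP (sin 1 < sin (t / 2)).
    rewrite ltr_sin ?in_itv /=; [|apply/andP; split; lra|apply/andP; split; lra].
    by rewrite -leNgt => ?; lra.
  have : 1 / 2 <= sin 1 :> R by apply: sin_ge_half; lra.
  lra.
by move: h t0; nra.
Qed.

End Periodic.

Section Jackson.
Context {R : realType}.
Implicit Types (f g : R -> R) (x t s K : R).
Let tp0 : 0 <= 2 * pi :> R. Proof. by rewrite mulr_ge0// pi_ge0. Qed.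

Definition jop N g x := (kmass N)^-1 * pint (fun t => kN N t * g (x - t)).

Let cconv N g x : continuous g -> continuous (fun t => kN N t * g (x - t)).
Proof.
move=> cg t; apply: cvgM; first exact: continuous_kN.
apply: (@continuous_comp _ _ _ (fun t => x - t) g); last exact: cg.
by apply: cvgB; [exact: cvg_cst|exact: cvg_id].
Qed.

Let pconv N g x : per2pi g -> per2pi (fun t => kN N t * g (x - t)).
Proof. by move=> pg t; rewrite kN_per opprD addrA per2piN. Qed.

Lemma jopE N g x : continuous g -> per2pi g ->
  jop N g x = (kmass N)^-1 * pint (fun t => kN N (x - t) * g t).
Proof.
move=> cg pg; congr (_ * _).
rewrite -(pint_refl x (@cconv N g x cg) (@pconv N g x pg)).
by apply: eq_rint => t _; rewrite subKr.
Qed.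

(** Every q-fold difference with steps t_1, .., t_q is at most K |t_1 .. t_q|. For smooth g a bound
    on the q-th derivative serves as K; differences, unlike derivatives, pass through [jop] without
    differentiating an integral. *)
Fixpoint lipn q K g : Prop :=
  if q is q'.+1 then forall t, lipn q' (K * `|t|) (fun x => g (x + t) - g x)
  else forall x, `|g x| <= K.

Lemma lipn_le q K K' g : K <= K' -> lipn q K g -> lipn q K' g.
Proof.
elim: q K K' g => [|q IH] K K' g KK' /=; first by move=> H x; apply: le_trans (H x) KK'.
by move=> H t; apply: IH (H t); rewrite ler_wpM2r.
Qed.

Definition jrate (r : nat) : R := 17 / r%:R.

(** |t| <= 1 / (2 r) + r t^2 / 2 <= 1 / (2 r) + 16 r (1 - cos t). With N + 1 = r^2 the kernel mean
    is at most 1 / (2 r) + 16 / r, hence the 17 in [jrate]. *)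
Lemma jop_moment r : (0 < r)%N ->
  rint (- pi) pi (fun t => kN (r ^ 2).-1 t * `|t|) <= jrate r * kmass (r ^ 2).-1.
Proof.
move=> r0; set N := (r ^ 2).-1; have r0' : (0 : R) < r%:R by rewrite ltr0n.
have N1 : N.+1 = (r ^ 2)%N by rewrite /N prednK// expn_gt0 r0.
have pp : - pi <= pi :> R by have := pi_ge0 R; lra.
have cN : continuous (fun t : R => kN N t * `|t|).
  by move=> t; apply: cvgM; [exact: continuous_kN|exact: norm_continuous].
have cU : continuous (fun t : R => kN N t * (1 - cos t)).
  by move=> t; apply: cvgM; [exact: continuous_kN|apply: cvgB; [exact: cvg_cst|exact: continuous_cos]].
have cB : continuous (fun t : R => (2 * r%:R)^-1 * kN N t + (16 * r%:R) * (kN N t * (1 - cos t))).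
  move=> t; apply: cvgD; apply: cvgM; try exact: cvg_cst; [exact: continuous_kN|exact: cU].
have cB1 : continuous (fun t : R => (2 * r%:R)^-1 * kN N t).
  by move=> t; apply: cvgM; [exact: cvg_cst|exact: continuous_kN].
have cB2 : continuous (fun t : R => (16 * r%:R) * (kN N t * (1 - cos t))).
  by move=> t; apply: cvgM; [exact: cvg_cst|exact: cU].
have pU : per2pi (fun t : R => kN N t * (1 - cos t)) by move=> t; rewrite kN_per cos_per.
apply: (@le_trans _ _ (rint (- pi) pi (fun t => (2 * r%:R)^-1 * kN N t + (16 * r%:R) * (kN N t * (1 - cos t))))).
  apply: rint_le => // t tp.
  rewrite (_ : _ + _ = kN N t * ((2 * r%:R)^-1 + 16 * r%:R * (1 - cos t))); last by ring.
  apply: ler_wpM2l; first exact: kN_ge0.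
  have h := sqr_le_cos tp.
  have h2 : 0 <= (r%:R * `|t| - 1) ^+ 2 by exact: sqr_ge0.
  have h3 : (r%:R * `|t| - 1) ^+ 2 = r%:R ^+ 2 * t ^+ 2 - 2 * r%:R * `|t| + 1.
    by rewrite -[t ^+ 2]real_normK ?num_real//; ring.
  rewrite -(@ler_pM2l _ (2 * r%:R)) ?mulr_gt0// mulrDr mulfV ?gt_eqF ?mulr_gt0//.
  have : r%:R ^+ 2 * t ^+ 2 <= r%:R ^+ 2 * (32 * (1 - cos t)) by rewrite ler_wpM2l ?sqr_ge0.
  move: h2; rewrite h3; nra.
rewrite (rintD _ _ cB1 cB2) (rintZ _ _ _ (@continuous_kN R N)) (rintZ _ _ _ cU).
rewrite (pint_sym cU pU) (pint_sym (@continuous_kN R N) (@kN_per R N)).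
rewrite kmass_moment N1 -/(kmass N) natrX /jrate.
have := kmass_gt0 (R := R) N; move: (kmass N) => k k0.
rewrite -subr_ge0 (_ : _ - _ = k / r%:R / 2); last by field; rewrite gt_eqF.
by rewrite !divr_ge0// ltW.
Qed.

(** One smoothing trades one order of difference for a factor [jrate r]. Convolution commutes with
    translations, so the induction on q reduces to the case of a Lipschitz function. *)
Lemma jop_lip r q K g : (0 < r)%N -> continuous g -> per2pi g ->
  lipn q.+1 K g -> lipn q (K * jrate r) (fun x => g x - jop (r ^ 2).-1 g x).
Proof.
move=> r0; set N := (r ^ 2).-1.
have k0 := kmass_gt0 (R := R) N.
elim: q K g => [|q IH] K g cg pg Hg.
  move=> x /=.
  have cgx : continuous (fun t => kN N t * (g x - g (x - t))).
    have -> : (fun t => kN N t * (g x - g (x - t))) = (fun t => kN N t * g x - kN N t * g (x - t)).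
      by apply/funext => t; rewrite mulrBr.
    by move=> t; apply: cvgB; [apply: cvgM; [exact: continuous_kN|exact: cvg_cst]|exact: cconv].
  have E : g x - jop N g x = (kmass N)^-1 * rint (- pi) pi (fun t => kN N t * (g x - g (x - t))).
    rewrite pint_sym//; last by move=> t; rewrite kN_per opprD addrA per2piN.
    have -> : pint (fun t => kN N t * (g x - g (x - t))) = pint (fun t => g x * kN N t - kN N t * g (x - t)).
      by apply: eq_rint => t _; rewrite mulrBr mulrC.
    rewrite /pint rintB; [|by move=> t; apply: cvgM; [exact: cvg_cst|exact: continuous_kN]|exact: cconv].
    rewrite rintZ; last exact: continuous_kN.
    by rewrite mulrBr /jop /pint -/(pint _) -/(kmass N) mulrCA mulVf ?gt_eqF// mulr1.
  rewrite E normrM gtr0_norm ?invr_gt0// mulrC ler_pdivrMr//.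
  have K0 : 0 <= K.
    by have := Hg 1 0 => /=; rewrite normr1 mulr1; apply: le_trans.
  apply: (le_trans (rint_norm _ _ cgx)).
  have cN : continuous (fun t : R => kN N t * `|t|).
    by move=> t; apply: cvgM; [exact: continuous_kN|exact: norm_continuous].
  apply: (@le_trans _ _ (rint (- pi) pi (fun t => K * (kN N t * `|t|)))).
    apply: rint_le; first by move=> t; apply: cvg_norm; exact: cgx.
      by move=> t; apply: cvgM; [exact: cvg_cst|exact: cN].
    move=> t _; rewrite normrM (ger0_norm (kN_ge0 _ _)) mulrCA ler_wpM2l ?kN_ge0//.
    by have := Hg (- t) x => /=; rewrite normrN distrC.
  rewrite rintZ// -mulrA ler_wpM2l//.
  exact: jop_moment.
move=> s.
have cs : continuous (fun x => g (x + s) - g x).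
  by move=> x; apply: cvgB; [exact: continuous_shiftf|exact: cg].
have ps : per2pi (fun x => g (x + s) - g x) by move=> x; rewrite addrAC !pg.
have := IH (K * `|s|) _ cs ps (Hg s).
rewrite mulrAC; congr lipn; apply/funext => x.
have -> : jop N (fun x => g (x + s) - g x) x = jop N g (x + s) - jop N g x.
  rewrite /jop -mulrBr /pint -rintB; [|exact: cconv..].
  by congr (_ * _); apply: eq_rint => t _; rewrite -mulrBr; congr (_ * (g _ - _)); ring.
ring.
Qed.

Lemma cheb_poly m : exists T : {poly R}, (size T <= m.+1)%N /\ forall y, cos (m%:R * y) = T.[cos y].
Proof.
suff : (exists T : {poly R}, (size T <= m.+1)%N /\ forall y, cos (m%:R * y) = T.[cos y]) /\
  (exists T : {poly R}, (size T <= m.+2)%N /\ forall y, cos (m.+1%:R * y) = T.[cos y]) by case.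
elim: m => [|m [[T0 [s0 H0]] [T1 [s1 H1]]]].
  split; first by exists 1; split; [rewrite size_poly1|move=> y; rewrite mul0r cos0 hornerC].
  by exists 'X; split; [rewrite size_polyX|move=> y; rewrite mul1r hornerX].
split; first by exists T1.
exists (2%:P * 'X * T1 - T0); split.
  rewrite (leq_trans (size_polyD _ _))// geq_max size_polyN (leq_trans s0) ?andbT; last by rewrite leqW.
  rewrite -mulrA mul_polyC (leq_trans (size_scale_leq _ _))// (leq_trans (size_polyMleq _ _))//.
  by rewrite size_polyX.
move=> y; rewrite hornerD hornerN !hornerM hornerC hornerX -H1 -H0.
have -> : m.+2%:R * y = m.+1%:R * y + y by rewrite -[m.+2%:R]natr1; ring.
have -> : m%:R * y = m.+1%:R * y - y by rewrite -[m.+1%:R]natr1; ring.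
by rewrite cosD cosB; ring.
Qed.

(** Shifted by pi / 2, g becomes even and its sine coefficients vanish. Each frequency m of the
    kernel then contributes a multiple of cos (m (x - pi / 2)), a Chebyshev polynomial in cos (x -
    pi / 2) = sin x. *)
Lemma conv_cospoly n F g : is_cospoly n F -> continuous g -> per2pi g ->
  (forall x, g (pi - x) = g x) ->
  exists P : {poly R}, (size P <= n.+1)%N /\ forall x, pint (fun t => F (x - t) * g t) = P.[sin x].
Proof.
move=> HF cg pg eg.
have ccos (m : nat) x : continuous (fun t : R => cos (m%:R * (x - t))).
  move=> t; apply: (@continuous_comp _ _ _ (fun t => m%:R * (x - t)) cos); last exact: continuous_cos.
  by apply: cvgM; [exact: cvg_cst|apply: cvgB; [exact: cvg_cst|exact: cvg_id]].
have cF : forall x, continuous (fun t => F (x - t)).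
  elim: HF => [|k m F' mn _ IH] x; first exact: cst_continuous.
  by move=> t; apply: cvgD; [apply: cvgM; [exact: cvg_cst|exact: ccos]|exact: IH].
elim: HF cF => [|k m F' mn HF IH] cF.
  exists 0; split; first by rewrite size_poly0.
  by move=> x; rewrite horner0 -[RHS](mul0r (pint g)) /pint -(rintZ 0 (2 * pi) 0 cg).
have cF' x : continuous (fun t => F' (x - t)).
  have -> : (fun t => F' (x - t)) = (fun t => (k * cos (m%:R * (x - t)) + F' (x - t)) - k * cos (m%:R * (x - t))).
    by apply/funext => t; rewrite addrAC subrr add0r.
  by move=> t; apply: cvgB; [exact: cF|apply: cvgM; [exact: cvg_cst|exact: ccos]].
have [P [sP HP]] := IH cF'.
have [T [sT HT]] := cheb_poly m.
have ccg x : continuous (fun t => cos (m%:R * (x - t)) * g t).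
  by move=> t; apply: cvgM; [exact: ccos|exact: cg].
pose gt t := g (t + pi / 2).
have cgt : continuous gt by exact: continuous_shiftf.
have pgt : per2pi gt by move=> t; rewrite /gt addrAC pg.
have egt t : gt (- t) = gt t by rewrite /gt -[in RHS]eg; congr g; field.
pose c := pint (fun t => cos (m%:R * t) * gt t).
have mp : per2pi (fun t => cos (m%:R * t) : R).
  by move=> t; rewrite mulrDr cos_nat_per.
have smp : per2pi (fun t => sin (m%:R * t) : R).
  by move=> t; rewrite mulrDr sin_nat_per.
have cm : continuous (fun t : R => cos (m%:R * t)).
  move=> t; apply: (@continuous_comp _ _ _ (fun t => m%:R * t) cos); last exact: continuous_cos.
  by apply: cvgM; [exact: cvg_cst|exact: cvg_id].
have sm : continuous (fun t : R => sin (m%:R * t)).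
  move=> t; apply: (@continuous_comp _ _ _ (fun t => m%:R * t) sin); last exact: continuous_sin.
  by apply: cvgM; [exact: cvg_cst|exact: cvg_id].
have ccgt : continuous (fun t => cos (m%:R * t) * gt t).
  by move=> t; apply: cvgM; [exact: cm|exact: cgt].
have csgt : continuous (fun t => sin (m%:R * t) * gt t).
  by move=> t; apply: cvgM; [exact: sm|exact: cgt].
have S0 : pint (fun t => sin (m%:R * t) * gt t) = 0.
  have : pint (fun t => sin (m%:R * t) * gt t) = - pint (fun t => sin (m%:R * t) * gt t).
    rewrite -[LHS]pint_opp//; last by move=> t; rewrite smp pgt.
    rewrite -[RHS]mulN1r /pint -(rintZ _ _ _ csgt); apply: eq_rint => t _.
    by rewrite mulrN sinN egt mulN1r mulNr.
  by move/eqP; rewrite -addr_eq0 -mulr2n mulrn_eq0 => /orP[//|/eqP].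
have key x : pint (fun t => cos (m%:R * (x - t)) * g t) = c * T.[sin x].
  rewrite -(@pint_shift _ (pi / 2) _ (ccg x)); last first.
    move=> t; rewrite pg; congr (_ * _).
    have -> : m%:R * (x - (t + 2 * pi)) = m%:R * (x - t) - m%:R * (2 * pi) by ring.
    by rewrite -[LHS](cos_nat_per m) subrK.
  rewrite -[sin x]cosBpihalf -HT [RHS]mulrC /c /pint -(rintZ _ _ _ ccgt).
  transitivity (rint 0 (2 * pi) (fun t => cos (m%:R * (x - pi / 2)) * (cos (m%:R * t) * gt t) + sin (m%:R * (x - pi / 2)) * (sin (m%:R * t) * gt t))).
    apply: eq_rint => t _; rewrite -/(gt t).
    have -> : m%:R * (x - (t + pi / 2)) = m%:R * (x - pi / 2) - m%:R * t by field.
    by rewrite cosB; ring.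
  rewrite rintD; [|by move=> t; apply: cvgM; [exact: cvg_cst|exact: ccgt]|by move=> t; apply: cvgM; [exact: cvg_cst|exact: csgt]].
  by rewrite (rintZ _ _ _ csgt) -/(pint (fun t => sin (m%:R * t) * gt t)) S0 mulr0 addr0.
exists ((k * c)%:P * T + P); split.
  rewrite (leq_trans (size_polyD _ _))// geq_max sP andbT mul_polyC (leq_trans (size_scale_leq _ _))//.
  by rewrite (leq_trans sT).
move=> x; rewrite hornerD hornerM hornerC -HP -mulrA -key.
rewrite /pint -(rintZ _ _ _ (ccg x)) -rintD; first by apply: eq_rint => t _; rewrite mulrDl mulrA.
  by move=> t; apply: cvgM; [exact: cvg_cst|exact: ccg].
by move=> t; apply: cvgM; [exact: cF'|exact: cg].
Qed.

(** The smoothing error is smoothed again, q times with the same r. Each subtracted term is a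
    polynomial in sin x of size at most r^2, so the degree does not grow with q. The gain per step
    is only the square root of the degree, which smoothness of all orders makes up for. *)
Lemma jackson q r K g : (0 < r)%N -> continuous g -> per2pi g -> (forall x, g (pi - x) = g x) ->
  lipn q K g -> exists Q : {poly R}, (size Q <= r ^ 2)%N /\
    forall x, `|g x - Q.[sin x]| <= K * jrate r ^+ q.
Proof.
move=> r0; elim: q K g => [|q IH] K g cg pg eg Hg.
  exists 0; split; first by rewrite size_poly0.
  by move=> x; rewrite horner0 subr0 expr0 mulr1; exact: Hg.
have N1 : ((r ^ 2).-1.+1 = r ^ 2)%N by rewrite prednK// expn_gt0 r0.
have [P [sP HP]] := conv_cospoly (cospoly_kN (r ^ 2).-1) cg pg eg.
rewrite N1 in sP.
have jE x : jop (r ^ 2).-1 g x = ((kmass (r ^ 2).-1)^-1%:P * P).[sin x].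
  by rewrite jopE// HP hornerM hornerC.
have [||||Q [sQ HQ]] := IH (K * jrate r) (fun x => g x - jop (r ^ 2).-1 g x).
- have -> : (fun x => g x - jop (r ^ 2).-1 g x) = (fun x => g x - ((kmass (r ^ 2).-1)^-1%:P * P).[sin x]).
    by apply/funext => x; rewrite jE.
  move=> x; apply: cvgB; first exact: cg.
  apply: (@continuous_comp _ _ _ sin (fun y => ((kmass (r ^ 2).-1)^-1%:P * P).[y])); first exact: continuous_sin.
  exact: continuous_horner.
- by move=> x; rewrite !jE sin_per pg.
- by move=> x; rewrite !jE eg; congr (_ - _.[_]); rewrite -[pi - x]opprB sinN sinB cospi sinpi; ring.
- exact: jop_lip.
exists (Q + (kmass (r ^ 2).-1)^-1%:P * P); split.
  rewrite (leq_trans (size_polyD _ _))// geq_max sQ mul_polyC (leq_trans (size_scale_leq _ _))//.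
move=> x; rewrite exprS mulrA (le_trans _ (HQ x))// jE hornerD.
by rewrite (_ : _ - (_ + _) = g x - ((kmass (r ^ 2).-1)^-1%:P * P).[sin x] - Q.[sin x])//; ring.
Qed.

End Jackson.

(** * Band-limited functions on a uniform grid *)

Section DiscreteFourier.
Context {R : realType}.
Implicit Types (b : R -> R) (x y t : R).

Definition node (N i : nat) : R := 2 * pi * i%:R / N%:R.

Lemma dft0 (N l : nat) d : (0 < l < N)%N -> \sum_(i < N) cos (l%:R * node N i + d) = 0 :> R.
Proof.
move=> /andP[l0 lN]; have N0 : (0 : R) < N%:R by rewrite ltr0n (leq_trans _ lN).
pose h : R := l%:R * pi / N%:R.
have sh : 0 < sin h.
  have p0 := pi_gt0 R; apply: sin_gt0_pi; apply/andP; split.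
    by rewrite divr_gt0// mulr_gt0// ltr0n.
  by rewrite ltr_pdivrMr// mulrC ltr_pM2l// ltr_nat.
apply: (mulfI (lt0r_neq0 sh)); rewrite mulr0.
apply: (mulfI (_ : 2 != 0 :> R)); first by rewrite pnatr_eq0.
rewrite mulr0 !mulr_sumr.
(* Multiplication by 2 sin h, with h half of the increment of the argument, makes the sum
   telescope. *)
pose u (i : nat) : R := sin (2 * h * i%:R + d - h).
transitivity (\sum_(0 <= i < N) (u i.+1 - u i)).
  rewrite big_mkord; apply: eq_bigr => i _.
  have -> : l%:R * node N i + d = 2 * h * i%:R + d by rewrite /node /h; field; rewrite gt_eqF.
  rewrite /u -[i.+1%:R]natr1.
  have -> : 2 * h * (i%:R + 1) + d - h = (2 * h * i%:R + d) + h by ring.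
  by rewrite sinD sinB; ring.
rewrite telescope_sumr// /u mulr0 add0r.
have -> : 2 * h * N%:R + d - h = (d - h) + l%:R * (2 * pi).
  by rewrite /h; field; rewrite gt_eqF.
by rewrite sin_nat_per subrr.
Qed.

Definition tk (j : nat) (al : nat -> R) (t : R) := \sum_(k < j.+1) al k * cos ((j%:R - 2 * k%:R) * t).

(** Products of two modes have frequencies 2 d with |d| <= j, and 2 |d| < 2 j + 1 excludes aliasing.
    This fixes the number of nodes. *)
Lemma dft_even (j : nat) (d : int) e : (`|d| <= j)%N ->
  (j.*2.+1)%:R^-1 * \sum_(i < j.*2.+1) cos ((2 * d%:~R) * node j.*2.+1 i + e) = if d == 0 then cos e else 0 :> R.
Proof.
move=> dj; case: ifPn => [/eqP->|d0].
  under eq_bigr do rewrite mulr0z mulr0 mul0r add0r.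
  by rewrite sumr_const card_ord -[cos e *+ _]mulr_natl mulKf// pnatr_eq0.
have H (m : nat) e' : (0 < m <= j)%N -> \sum_(i < j.*2.+1) cos (2 * m%:R * node j.*2.+1 i + e') = 0 :> R.
  move=> /andP[m0 mj]; rewrite -natrM; apply: dft0; lia.
case: d dj d0 => m dj d0.
  by rewrite H ?mulr0//; move: dj d0; lia.
rewrite -[RHS](mulr0 (j.*2.+1)%:R^-1); congr (_ * _).
rewrite -[RHS](H m.+1 (- e)); last by move: dj; lia.
apply: eq_bigr => i _; rewrite -cosN; congr cos.
by rewrite NegzE mulrNz; rewrite -pmulrn; ring.
Qed.

Lemma dconv1 (j k k' : nat) x y : (k <= j)%N -> (k' <= j)%N ->
  (j.*2.+1)%:R^-1 * \sum_(i < j.*2.+1) cos ((j%:R - 2 * k%:R) * (x - node j.*2.+1 i)) *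
     cos ((j%:R - 2 * k'%:R) * (node j.*2.+1 i - y)) =
  ((k == k')%:R + (k + k' == j)%:R) / 2 * cos ((j%:R - 2 * k%:R) * (x - y)) :> R.
Proof.
move=> kj k'j; set N := j.*2.+1.
pose d1 : int := k%:Z - k'%:Z; pose d2 : int := k%:Z + k'%:Z - j%:Z.
pose e1 := (j%:R - 2 * k%:R) * x - (j%:R - 2 * k'%:R) * y.
pose e2 := (j%:R - 2 * k%:R) * x + (j%:R - 2 * k'%:R) * y.
have E i : cos ((j%:R - 2 * k%:R) * (x - node N i)) * cos ((j%:R - 2 * k'%:R) * (node N i - y)) =
   2^-1 * cos ((2 * d1%:~R) * node N i + e1) + 2^-1 * cos ((2 * d2%:~R) * node N i + e2).
  have -> : (2 * d1%:~R) * node N i + e1 = (j%:R - 2 * k%:R) * (x - node N i) + (j%:R - 2 * k'%:R) * (node N i - y).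
    by rewrite /d1 /e1 rmorphB /= -!pmulrn; ring.
  have -> : (2 * d2%:~R) * node N i + e2 = (j%:R - 2 * k%:R) * (x - node N i) - (j%:R - 2 * k'%:R) * (node N i - y).
    by rewrite /d2 /e2 rmorphB rmorphD /= -!pmulrn; ring.
  by rewrite cosD cosB; field.
under eq_bigr do rewrite E.
rewrite big_split /= -!mulr_sumr mulrDr !(mulrCA _ 2^-1) !dft_even; [|rewrite /d2; lia|rewrite /d1; lia].
have -> : (d1 == 0) = (k == k') by rewrite /d1; apply/eqP/eqP; lia.
have -> : (d2 == 0) = (k + k' == j)%N by rewrite /d2; apply/eqP/eqP; lia.
have H1 : k == k' -> e1 = (j%:R - 2 * k%:R) * (x - y) by move=> /eqP kk; rewrite /e1 -kk; ring.
have H2 : (k + k' == j)%N -> e2 = (j%:R - 2 * k%:R) * (x - y).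
  by move=> /eqP kk; rewrite /e2 -{3}kk -{1}kk -{1}kk natrD; ring.
case: ifPn => [/H1->|_]; case: ifPn => [/H2->|_] /=; by field.
Qed.

(** The modes k and j - k have the same cosine, so k interacts with k' = k and k' = j - k, each with
    weight 1/2; the symmetry of [be] merges the two contributions. *)
Lemma dconv (j : nat) (al be : nat -> R) x y : (forall k, (k <= j)%N -> be (j - k)%N = be k) ->
  (j.*2.+1)%:R^-1 * \sum_(i < j.*2.+1) tk j al (x - node j.*2.+1 i) * tk j be (node j.*2.+1 i - y) =
  tk j (fun k => al k * be k) (x - y).
Proof.
move=> sbe; set N := j.*2.+1.
transitivity (\sum_(k < j.+1) \sum_(k' < j.+1) al k * be k' * (N%:R^-1 *
    \sum_(i < N) cos ((j%:R - 2 * k%:R) * (x - node N i)) * cos ((j%:R - 2 * k'%:R) * (node N i - y)))).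
  rewrite mulr_sumr.
  transitivity (\sum_(i < N) \sum_(k < j.+1) \sum_(k' < j.+1) al k * be k' * (N%:R^-1 *
     (cos ((j%:R - 2 * k%:R) * (x - node N i)) * cos ((j%:R - 2 * k'%:R) * (node N i - y))))).
    apply: eq_bigr => i _; rewrite /tk mulr_suml mulr_sumr; apply: eq_bigr => k _.
    by rewrite !mulr_sumr; apply: eq_bigr => k' _; ring.
  rewrite exchange_big; apply: eq_bigr => k _; rewrite exchange_big; apply: eq_bigr => k' _.
  by rewrite !mulr_sumr.
apply: eq_bigr => k _.
have kj : (k <= j)%N by rewrite -ltnS.
have jk : (j - k < j.+1)%N by rewrite ltnS leq_subr.
transitivity (\sum_(k' < j.+1) (al k * be k' / 2 * (k == k' :> nat)%:R * cos ((j%:R - 2 * k%:R) * (x - y)) +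
    al k * be k' / 2 * (k + k' == j)%N%:R * cos ((j%:R - 2 * k%:R) * (x - y)))).
  apply: eq_bigr => k' _; rewrite dconv1//; last by rewrite -ltnS.
  by field.
rewrite big_split /= (bigD1 k)//= eqxx big1 ?addr0; last first.
  by move=> k' kk'; rewrite eq_sym -val_eqE in kk'; rewrite (negbTE kk') mulr0 mul0r.
rewrite (bigD1 (Ordinal jk))//= subnKC// eqxx big1 ?addr0; last first.
  move=> k' kk'; rewrite (_ : (k + k' == j)%N = false) ?mulr0 ?mul0r//.
  apply/negP => /eqP kk; move: kk'; rewrite -val_eqE /= -{2}kk addKn eqxx//.
by rewrite sbe//=; field.
Qed.

Lemma jop_cvg g x : continuous g -> per2pi g -> jop M g x @[M --> \oo] --> g x.
Proof.
move=> cg pg; apply/cvgrPdist_le => e e0.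
(* The second factor is a point, since [compact_modulus] concerns two variables. *)
have cK : compact (`[- pi, pi]%classic `*` `[0, 0]%classic : set (R * R)).
  by apply: compact_setX; exact: segment_compact.
have cF : continuous (fun p : R * R => g (x - p.1)).
  move=> p; apply: (@continuous_comp _ _ _ (fun p : R * R => x - p.1) g); last exact: cg.
  by apply: cvgB; [exact: cvg_cst|exact: cvg_fst].
have e20 : 0 < e / 2 by rewrite divr_gt0.
have [C [C0 HC]] := compact_modulus cK (continuous_subspaceT cF) e20.
have pp : - pi <= pi :> R by have := pi_ge0 R; lra.
have B t : - pi <= t <= pi -> `|g (x - t) - g x| <= e / 2 + C * (32 * (1 - cos t)).
  move=> tp.
  have h1 : (`[- pi, pi]%classic `*` `[0, 0]%classic) (t, 0 : R) by split; rewrite /= in_itv //= lexx.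
  have h2 : (`[- pi, pi]%classic `*` `[0, 0]%classic) (0 : R, 0 : R).
    by split; rewrite /= in_itv //= ?lexx// oppr_le0 pi_ge0.
  have := HC _ _ h1 h2; rewrite /= !subr0 expr0n addr0 => /le_trans; apply.
  by rewrite lerD2l ler_wpM2l// sqr_le_cos.
near=> M.
have k0 := kmass_gt0 (R := R) M.
have cN := @continuous_kN R M.
have cgx : continuous (fun t => kN M t * g (x - t)).
  move=> t; apply: cvgM; first exact: cN.
  apply: (@continuous_comp _ _ _ (fun t => x - t) g); last exact: cg.
  by apply: cvgB; [exact: cvg_cst|exact: cvg_id].
have cd : continuous (fun t => kN M t * g x - kN M t * g (x - t)).
  by move=> t; apply: cvgB; [apply: cvgM; [exact: cN|exact: cvg_cst]|exact: cgx].
have cU : continuous (fun t : R => kN M t * (1 - cos t)).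
  by move=> t; apply: cvgM; [exact: cN|apply: cvgB; [exact: cvg_cst|exact: continuous_cos]].
have pU : per2pi (fun t : R => kN M t * (1 - cos t)) by move=> t; rewrite kN_per cos_per.
have E : g x - jop M g x = (kmass M)^-1 * rint (- pi) pi (fun t => kN M t * g x - kN M t * g (x - t)).
  rewrite pint_sym//; last by move=> t; rewrite kN_per opprD addrA per2piN.
  rewrite /pint rintB//; last by move=> t; apply: cvgM; [exact: cN|exact: cvg_cst].
  rewrite (_ : rint 0 (2 * pi) (fun t => kN M t * g x) = g x * kmass M); last first.
    by rewrite /kmass /pint -(rintZ _ _ _ cN); apply: eq_rint => t _; rewrite mulrC.
  by rewrite mulrBr /jop /pint mulrCA mulVf ?gt_eqF// mulr1.
rewrite E normrM gtr0_norm ?invr_gt0// mulrC ler_pdivrMr//.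
have c1 : continuous (fun t => e / 2 * kN M t) by move=> t; apply: cvgM; [exact: cvg_cst|exact: cN].
have c2 : continuous (fun t => (32 * C) * (kN M t * (1 - cos t))).
  by move=> t; apply: cvgM; [exact: cvg_cst|exact: cU].
apply: (le_trans (rint_norm _ _ cd)).
apply: (@le_trans _ _ (rint (- pi) pi (fun t => e / 2 * kN M t + (32 * C) * (kN M t * (1 - cos t))))).
  apply: rint_le; first by move=> t; apply: cvg_norm; exact: cd.
    by move=> t; apply: cvgD; [exact: c1|exact: c2].
  move=> t tp; rewrite -mulrBr normrM (ger0_norm (kN_ge0 _ _)).
  rewrite [leRHS](_ : _ = kN M t * (e / 2 + C * (32 * (1 - cos t)))); last by ring.
  by rewrite ler_wpM2l ?kN_ge0// distrC B.
rewrite (rintD _ _ c1 c2) (rintZ _ _ _ cN) (rintZ _ _ _ cU).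
rewrite (pint_sym cU pU) (pint_sym cN (@kN_per R M)) -/(kmass M) kmass_moment.
have MC : 32 * C / M.+1%:R <= e / 2.
  rewrite ler_pdivrMr// [leRHS]mulrC -ler_pdivrMr//.
  apply: (@le_trans _ _ M%:R); last by rewrite ler_nat.
  by near: M; exact: nbhs_infty_ger.
rewrite (_ : 32 * C * (kmass M / M.+1%:R) = (32 * C / M.+1%:R) * kmass M); last by rewrite mulrA [RHS]mulrAC.
by rewrite -mulrDl ler_wpM2r ?(ltW k0)// [leRHS](splitr e) lerD2l.
Unshelve. all: by end_near. Qed.

Lemma tk_delta j k' (t : R) : (k' <= j)%N ->
  tk j (fun k => ((k == k')%:R + (k == j - k')%N%:R) / 2) t = cos ((j%:R - 2 * k'%:R) * t).
Proof.
move=> kj; rewrite /tk.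
have k1 : (k' < j.+1)%N by []. have k2 : (j - k' < j.+1)%N by rewrite ltnS leq_subr.
transitivity (\sum_(k < j.+1) ((k == k' :> nat)%:R / 2 * cos ((j%:R - 2 * k%:R) * t) +
    (k == j - k' :> nat)%N%:R / 2 * cos ((j%:R - 2 * k%:R) * t))).
  by apply: eq_bigr => k _; rewrite -!mulrDl.
rewrite big_split /= (bigD1 (Ordinal k1))//= eqxx big1 ?addr0; last first.
  by move=> k kk; rewrite -val_eqE /= in kk; rewrite (negbTE kk) !mul0r.
rewrite (bigD1 (Ordinal k2))//= eqxx big1 ?addr0; last first.
  by move=> k kk; rewrite -val_eqE /= in kk; rewrite (negbTE kk) !mul0r.
rewrite natrB// -(cosN ((j%:R - 2 * (j%:R - k'%:R)) * t)).
rewrite (_ : - ((j%:R - 2 * (j%:R - k'%:R)) * t) = (j%:R - 2 * k'%:R) * t); last by ring.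
by rewrite /=; field.
Qed.

Lemma tk_reproduce j k' x y : (k' <= j)%N ->
  (j.*2.+1)%:R^-1 * \sum_(i < j.*2.+1) tk j (fun=> 1) (x - node j.*2.+1 i) * cos ((j%:R - 2 * k'%:R) * (node j.*2.+1 i - y)) =
  cos ((j%:R - 2 * k'%:R) * (x - y)) :> R.
Proof.
move=> kj; under eq_bigr do rewrite -tk_delta//.
rewrite dconv; last first.
  move=> k kk; congr (_ / 2); rewrite addrC; congr (_%:R + _%:R); congr nat_of_bool; apply/eqP/eqP; lia.
rewrite -(tk_delta (x - y) kj).
by apply: eq_bigr => k _; rewrite mul1r.
Qed.

(** Only frequencies of the parity of j are tested; [half_turn] disposes of the other parity. *)
Definition band_limited (j : nat) b := forall m, (j < m)%N -> ~~ odd (m + j) ->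
  pint (fun t => b t * cos (m%:R * t)) = 0 /\ pint (fun t => b t * sin (m%:R * t)) = 0.

Definition half_turn (j : nat) b := forall x, b (x + pi) = (-1) ^+ j * b x.

Lemma continuous_scale (h : R -> R) (m : R) : continuous h -> continuous (fun t => h (m * t)).
Proof.
move=> ch t; apply: (@continuous_comp _ _ _ (fun t => m * t) h); last exact: ch.
by apply: cvgM; [exact: cvg_cst|exact: cvg_id].
Qed.

Lemma cos_nat_pi (m : nat) t : cos (m%:R * (t + pi)) = (-1) ^+ m * cos (m%:R * t) :> R.
Proof.
have E : m%:R * (t + pi) = m%:R * t + m%:R * pi by ring.
rewrite E; elim: m {E} (m%:R * t) => [|m IH] s; first by rewrite mul0r addr0 expr0 mul1r.
by rewrite -[m.+1%:R]natr1 mulrDl mul1r addrA cosDpi IH exprS; ring.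
Qed.

Lemma sin_nat_pi (m : nat) t : sin (m%:R * (t + pi)) = (-1) ^+ m * sin (m%:R * t) :> R.
Proof.
have E : m%:R * (t + pi) = m%:R * t + m%:R * pi by ring.
rewrite E; elim: m {E} (m%:R * t) => [|m IH] s; first by rewrite mul0r addr0 expr0 mul1r.
by rewrite -[m.+1%:R]natr1 mulrDl mul1r addrA sinDpi IH exprS; ring.
Qed.

Lemma half_turn_mode j m b (h : R -> R) : continuous b -> continuous h -> per2pi b -> per2pi h ->
  half_turn j b -> half_turn m h -> odd (m + j) -> pint (fun t => b t * h t) = 0.
Proof.
move=> cb ch pb ph hb hh om.
have cbh : continuous (fun t => b t * h t) by move=> t; apply: cvgM; [exact: cb|exact: ch].
have pbh : per2pi (fun t => b t * h t) by move=> t; rewrite pb ph.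
have := pint_shift pi cbh pbh.
rewrite (_ : (fun x => _) = (fun x => -1 * (b x * h x))); last first.
  apply/funext => x; rewrite hb hh mulrACA -exprD addnC -signr_odd om expr1 //.
rewrite /pint (rintZ _ _ _ cbh) => H.
by move: H; lra.
Qed.

(** b is merely continuous and its Fourier series need not converge. The identity is therefore
    checked mode by mode on the smoothed [jop M b], which involves finitely many modes, and M tends
    to infinity at x and at the nodes. *)
Lemma reproducing j b x : continuous b -> per2pi b -> half_turn j b -> band_limited j b ->
  b x = (j.*2.+1)%:R^-1 * \sum_(i < j.*2.+1) tk j (fun=> 1) (x - node j.*2.+1 i) * b (node j.*2.+1 i).
Proof.
move=> cb pb hb lb; set N := j.*2.+1.
have ccos (m : nat) : continuous (fun t : R => cos (m%:R * t)).
  exact: (@continuous_scale cos _ (@continuous_cos R)).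
have csin (m : nat) : continuous (fun t : R => sin (m%:R * t)).
  exact: (@continuous_scale sin _ (@continuous_sin R)).
have cF n (F : R -> R) : is_cospoly n F -> continuous F.
  move=> HF; elim: HF => [|k m F' _ _ IH]; first by move=> t; exact: cvg_cst.
  have c : continuous (fun t => k * cos (m%:R * t)) by move=> t; apply: cvgM; [exact: cvg_cst|exact: ccos].
  by move=> t; apply: cvgD; [exact: c|exact: IH].
have cc (F : R -> R) y : continuous F -> continuous (fun t => F (y - t) * b t).
  move=> cF' t; apply: cvgM; last exact: cb.
  apply: (@continuous_comp _ _ _ (fun t => y - t) F); last exact: cF'.
  by apply: cvgB; [exact: cvg_cst|exact: cvg_id].
have rep n (F : R -> R) : is_cospoly n F -> forall y, pint (fun t => F (y - t) * b t) =
    N%:R^-1 * \sum_(i < N) tk j (fun=> 1) (y - node N i) * pint (fun t => F (node N i - t) * b t).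
  move=> HF; elim: HF => [|k m F' mn hF' IH] y.
    have Z : pint (fun t => 0 * b t) = 0 :> R.
      by rewrite /pint rintZ// mul0r.
    by rewrite /= Z big1 ?mulr0// => i _; rewrite mulr0.
  have D z : pint (fun t => (k * cos (m%:R * (z - t)) + F' (z - t)) * b t) =
     k * pint (fun t => cos (m%:R * (z - t)) * b t) + pint (fun t => F' (z - t) * b t).
    rewrite /pint -rintZ; last exact: (cc (fun t => cos (m%:R * t))).
    rewrite -rintD; first by apply: eq_rint => t _; ring.
      by move=> t; apply: cvgM; [exact: cvg_cst|exact: (cc (fun t => cos (m%:R * t)))].
    exact: cc (cF _ _ hF').
  rewrite D {}IH.
  have -> : pint (fun t => cos (m%:R * (y - t)) * b t) =
     N%:R^-1 * \sum_(i < N) tk j (fun=> 1) (y - node N i) * pint (fun t => cos (m%:R * (node N i - t)) * b t).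
    (* Admissible modes are reproduced exactly by the kernel; every other mode integrates to 0
       against b. *)
    have [om|om] := boolP (~~ odd (m + j) && (m <= j)%N).
      move: om => /andP[om mj].
      have [k' k'j mE] : exists2 k', (k' <= j)%N & m%:R = j%:R - 2 * k'%:R :> R.
        exists (j - m)./2; first by lia.
        have -> : (j = m + 2 * (j - m)./2)%N by lia.
        have -> : ((m + 2 * (j - m)./2 - m)./2 = (j - m)./2)%N by lia.
        by rewrite natrD natrM; ring.
      have cci i : continuous (fun t => tk j (fun=> 1) (y - node N i) * (cos (m%:R * (node N i - t)) * b t)).
        by move=> t; apply: cvgM; [exact: cvg_cst|exact: (cc (fun t => cos (m%:R * t)))].
      under [in RHS]eq_bigr => i _ do
        rewrite /pint -(rintZ 0 (2 * pi) (tk j (fun=> 1) (y - node N i)) (cc (fun t => cos (m%:R * t)) (node N i) (ccos m))).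
      rewrite -rint_sum// -rintZ; last first.
        by move=> t; apply: cvg_big => //; [move=> z; exact: add_continuous|move=> i _; exact: cci].
      apply: eq_rint => t _; rewrite mE -(tk_reproduce y t k'j) -mulrA mulr_suml.
      by congr (_ * _); apply: eq_bigr => i _; rewrite mulrA.
    have Z z : pint (fun t => cos (m%:R * (z - t)) * b t) = 0.
      have [Zc Zs] : pint (fun t => b t * cos (m%:R * t)) = 0 /\ pint (fun t => b t * sin (m%:R * t)) = 0.
        have [om'|om'] := boolP (odd (m + j)).
          split; apply: (half_turn_mode cb _ pb _ hb _ om') => //.
          - by move=> t; rewrite mulrDr cos_nat_per.
          - by move=> t; rewrite cos_nat_pi.
          - by move=> t; rewrite mulrDr sin_nat_per.
          - by move=> t; rewrite sin_nat_pi.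
        by apply: lb => //; move: om; rewrite om' /= -ltnNge.
      have c1 : continuous (fun t => b t * cos (m%:R * t)) by move=> t; apply: cvgM; [exact: cb|exact: ccos].
      have c2 : continuous (fun t => b t * sin (m%:R * t)) by move=> t; apply: cvgM; [exact: cb|exact: csin].
      rewrite (_ : pint _ = cos (m%:R * z) * pint (fun t => b t * cos (m%:R * t)) + sin (m%:R * z) * pint (fun t => b t * sin (m%:R * t))).
        by rewrite Zc Zs !mulr0 addr0.
      rewrite /pint -(rintZ _ _ _ c1) -(rintZ _ _ _ c2) -rintD.
      - by apply: eq_rint => t _; rewrite mulrBr cosB; ring.
      - by move=> t; apply: cvgM; [exact: cvg_cst|exact: c1].
      - by move=> t; apply: cvgM; [exact: cvg_cst|exact: c2].
    by rewrite Z big1 ?mulr0// => i _; rewrite Z mulr0.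
  rewrite mulrCA mulr_sumr -mulrDr -big_split; congr (_ * _); apply: eq_bigr => i _ /=.
  by rewrite D; ring.
have L := jop_cvg (x := x) cb pb.
have E : (fun M => jop M b x) = (fun M => N%:R^-1 * \sum_(i < N) tk j (fun=> 1) (x - node N i) * jop M b (node N i)).
  apply/funext => M; rewrite jopE// (rep _ _ (cospoly_kN M)) mulrCA mulr_sumr; congr (_ * _).
  by apply: eq_bigr => i _; rewrite jopE//; ring.
rewrite E in L; apply: (cvg_unique _ L) => //.
apply: cvgM; first exact: cvg_cst.
apply: cvg_big => //; first by move=> z; exact: add_continuous.
by move=> i _; apply: cvgM; [exact: cvg_cst|exact: jop_cvg].
Qed.

Lemma tk_norm j (al : nat -> R) t : `|tk j al t| <= \sum_(k < j.+1) `|al k|.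
Proof.
apply: le_trans (ler_norm_sum _ _ _) _; apply: ler_sum => k _.
rewrite normrM -[leRHS]mulr1 ler_wpM2l// ler_norml cos_geN1 cos_le1 //.
Qed.

(** Discrete deconvolution: the kernel with the inverse coefficients [be], applied to b by
    quadrature and evaluated at the node shifted by [c]. The shift will be pi / 2, which passes from
    cosine to sine. *)
Definition grid_sol j (be : nat -> R) b c (i : nat) : R :=
  (j.*2.+1)%:R^-1 * \sum_(i' < j.*2.+1) tk j be (node j.*2.+1 i + c - node j.*2.+1 i') * b (node j.*2.+1 i').

Lemma grid_solP j (al be : nat -> R) b c x : continuous b -> per2pi b -> half_turn j b -> band_limited j b ->
  (forall k, (k <= j)%N -> be (j - k)%N = be k) -> (forall k, (k <= j)%N -> al k * be k = 1) ->
  (j.*2.+1)%:R^-1 * \sum_(i < j.*2.+1) tk j al (x - node j.*2.+1 i) * grid_sol j be b c i = b (x + c).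
Proof.
move=> cb pb hb lb sbe ab; rewrite (reproducing (x + c) cb pb hb lb); congr (_ * _).
set N := j.*2.+1.
transitivity (\sum_(i < N) \sum_(i' < N) N%:R^-1 * (tk j al (x - node N i) * tk j be (node N i - (node N i' - c)) * b (node N i'))).
  apply: eq_bigr => i _; rewrite /grid_sol mulrCA mulr_sumr mulr_sumr; apply: eq_bigr => i' _.
  by rewrite -/N (_ : node N i - (node N i' - c) = node N i + c - node N i'); [ring|ring].
rewrite exchange_big; apply: eq_bigr => i' _.
rewrite -mulr_sumr -mulr_suml mulrA dconv//; congr (_ * _).
rewrite (_ : x - (node N i' - c) = x + c - node N i'); last by ring.
by apply: eq_bigr => k _; rewrite ab// -ltnS.
Qed.

Lemma grid_sol_norm j (be : nat -> R) b c i B : (forall x, `|b x| <= B) ->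
  `|grid_sol j be b c i| <= B * \sum_(k < j.+1) `|be k|.
Proof.
move=> bB; rewrite /grid_sol normrM ger0_norm ?invr_ge0// ler_pdivrMl ?ltr0n//.
apply: le_trans (ler_norm_sum _ _ _) _.
apply: (@le_trans _ _ (\sum_(i < j.*2.+1) B * \sum_(k < j.+1) `|be k|)); last first.
  by rewrite sumr_const card_ord mulr_natl.
apply: ler_sum => i' _; rewrite normrM mulrC ler_pM//; exact: tk_norm.
Qed.

End DiscreteFourier.

(** * Ridge functions on the disk *)

Section Disc.
Context {R : realType}.
Implicit Types (p q : R * R).

Definition disc : set (R * R) := [set p | p.1 ^+ 2 + p.2 ^+ 2 <= 1].

Lemma disc_square p : disc p -> (-1 <= p.1 <= 1) /\ (-1 <= p.2 <= 1).
Proof. by rewrite /disc /= => h; split; apply/andP; split; nra. Qed.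

Lemma continuous_sqnorm : continuous (fun p : R * R => p.1 ^+ 2 + p.2 ^+ 2).
Proof.
move=> p; apply: cvgD.
  apply: (@continuous_comp _ _ _ fst (fun x : R => x ^+ 2)); [exact: cvg_fst|exact: exprn_continuous].
by apply: (@continuous_comp _ _ _ snd (fun x : R => x ^+ 2)); [exact: cvg_snd|exact: exprn_continuous].
Qed.

Lemma closed_disc : closed disc.
Proof.
rewrite (_ : disc = (fun p : R * R => p.1 ^+ 2 + p.2 ^+ 2) @^-1` [set x | x <= 1])//.
by apply: preimage_closed; [move=> p _; exact: continuous_sqnorm|exact: closed_le].
Qed.

Lemma compact_disc : compact disc.
Proof.
apply: (@subclosed_compact _ disc (`[-1, 1]%classic `*` `[-1, 1]%classic)); first exact: closed_disc.
  by apply: compact_setX; exact: segment_compact.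
by move=> p /disc_square [h1 h2]; split; rewrite /= in_itv.
Qed.

Definition disc_retract p : R * R :=
  let r := Num.max 1 (Num.sqrt (p.1 ^+ 2 + p.2 ^+ 2)) in (p.1 / r, p.2 / r).

Lemma disc_retractP p : exists2 r, 1 <= r & [/\ p.1 = r * (disc_retract p).1,
  p.2 = r * (disc_retract p).2, disc (disc_retract p) &
  r = 1 \/ (disc_retract p).1 ^+ 2 + (disc_retract p).2 ^+ 2 = 1].
Proof.
have n0 : 0 <= p.1 ^+ 2 + p.2 ^+ 2 by rewrite addr_ge0 ?sqr_ge0.
exists (Num.max 1 (Num.sqrt (p.1 ^+ 2 + p.2 ^+ 2))); first by rewrite le_max lexx.
rewrite /disc_retract /disc /=.
have [h|h] := leP (Num.sqrt (p.1 ^+ 2 + p.2 ^+ 2)) 1.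
  rewrite !divr1 !mul1r; split => //; last by left.
  rewrite -[leLHS]sqr_sqrtr// -[leRHS](expr1n _ 2) lerXn2r ?nnegrE ?sqrtr_ge0//.
have s0 : Num.sqrt (p.1 ^+ 2 + p.2 ^+ 2) != 0 by rewrite gt_eqF// (lt_trans _ h).
have E : (p.1 / Num.sqrt (p.1 ^+ 2 + p.2 ^+ 2)) ^+ 2 + (p.2 / Num.sqrt (p.1 ^+ 2 + p.2 ^+ 2)) ^+ 2 = 1.
  by rewrite !expr_div_n sqr_sqrtr// -mulrDl divff// -[X in X != 0](sqr_sqrtr n0) sqrf_eq0.
by rewrite E; split => //; rewrite ?(mulrC (Num.sqrt _)) ?divfK//; right.
Qed.

(** For p = r u with |u| = 1 the squared distances differ by (r - 1) (r + 1 - 2 u.q), and u.q <= 1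
    <= r. *)
Lemma disc_retract_contracting p q : disc q -> sqdist (disc_retract p) q <= sqdist p q.
Proof.
move=> dq; have [r r1 [p1 p2 dp e]] := disc_retractP p.
rewrite /sqdist p1 p2; move: dp dq e {p1 p2}; move: (disc_retract p) => [a b].
case: q => c d; rewrite /disc /= => h1 h2 [->|h3]; first by rewrite !mul1r.
have h4 : a * c + b * d <= 1 by have := sqr_ge0 (a - c); have := sqr_ge0 (b - d); nra.
rewrite -subr_ge0 (_ : _ - _ = (r ^+ 2 - 1) * (a ^+ 2 + b ^+ 2) - 2 * (r - 1) * (a * c + b * d)); last by ring.
rewrite h3 (_ : _ - _ = (r - 1) * (r + 1 - 2 * (a * c + b * d))); last by ring.
by rewrite mulr_ge0//; lra.
Qed.

Lemma disc_retract_id p : disc p -> disc_retract p = p.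
Proof.
case: p => x y dp; rewrite /disc_retract /=.
have -> : Num.max 1 (Num.sqrt (x ^+ 2 + y ^+ 2)) = 1.
  apply/max_idPl; rewrite -[leRHS]sqrtr1 ler_sqrt//.
by rewrite !divr1.
Qed.

Lemma weierstrass_disc (F : R * R -> R) e : {within disc, continuous F} -> 0 < e ->
  exists2 P, is_poly2 P & forall p, disc p -> `|P p.1 p.2 - F p| <= e.
Proof.
apply: (@weierstrass2 _ _ disc_retract _ _ compact_disc) => //.
- exact: disc_square.
- by move=> p; have [r _ []] := disc_retractP p.
- exact: disc_retract_id.
- exact: disc_retract_contracting.
Qed.

End Disc.

(** * Ridge functions span the polynomials in two variables *)

Section Ridge.
Context {R : realType}.
Variable lam : R.
Hypothesis lam0 : 0 < lam.

Inductive is_ridge : (R -> R -> R) -> Prop :=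
| ridge0 : is_ridge (fun _ _ => 0)
| ridgeS c phi j F : is_ridge F ->
    is_ridge (fun x y => c * (gegen lam j).[x * cos phi + y * sin phi] + F x y).

Lemma ridge_add F G : is_ridge F -> is_ridge G -> is_ridge (fun x y => F x y + G x y).
Proof.
move=> HF HG; elim: HF => [|c phi j F' _ IH].
  by rewrite (_ : (fun x y => 0 + G x y) = G)//; apply/funext => x; apply/funext => y; rewrite add0r.
rewrite (_ : (fun x y => _) = (fun x y => c * (gegen lam j).[x * cos phi + y * sin phi] + (F' x y + G x y))).
  exact: ridgeS.
by apply/funext => x; apply/funext => y; rewrite addrA.
Qed.

Lemma ridge_sum n (F : nat -> R -> R -> R) : (forall i, (i < n)%N -> is_ridge (F i)) ->
  is_ridge (fun x y => \sum_(i < n) F i x y).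
Proof.
elim: n => [|n IH] H.
  rewrite (_ : (fun x y => _) = fun _ _ => 0); first exact: ridge0.
  by apply/funext => x; apply/funext => y; rewrite big_ord0.
rewrite (_ : (fun x y => _) = (fun x y => \sum_(i < n) F i x y + F n x y)).
  by apply: ridge_add; [apply: IH => i /ltnW; exact: H|exact: H].
by apply/funext => x; apply/funext => y; rewrite big_ord_recr.
Qed.

(** With phi = atan t, x + t y is (x cos phi + y sin phi) / cos phi, and the N-th power expands
    along the [gegen]. *)
Lemma ridge_power N (t k : R) : is_ridge (fun x y => k * (x + t * y) ^+ N).
Proof.
have /andP[t1 t2] : - (pi / 2) < atan t < pi / 2 by rewrite atan_gtNpi2 atan_ltpi2.
have c0 : 0 < cos (atan t) by apply: cos_gt0_pihalf; apply/andP.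
pose q : {poly R} := (k / cos (atan t) ^+ N)%:P * 'X ^+ N.
have [c qE] : exists c : nat -> R, q = \sum_(j < N.+1) (c j)%:P * gegen lam j.
  apply: poly_span; first by move=> n; exact: size_gegen.
  by rewrite /q mul_polyC (leq_trans (size_scale_leq _ _))// size_polyXn.
rewrite (_ : (fun x y => _) = (fun x y => \sum_(j < N.+1) c j * (gegen lam j).[x * cos (atan t) + y * sin (atan t)])).
  apply: (ridge_sum (F := fun j x y => c j * (gegen lam j).[x * cos (atan t) + y * sin (atan t)])) => i _.
  rewrite (_ : (fun x y => _) = (fun x y => c i * (gegen lam i).[x * cos (atan t) + y * sin (atan t)] + 0)).
    by apply: ridgeS; exact: ridge0.
  by apply/funext => x; apply/funext => y; rewrite addr0.
apply/funext => x; apply/funext => y.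
transitivity (q.[x * cos (atan t) + y * sin (atan t)]).
  have -> : sin (atan t) = t * cos (atan t).
    by rewrite -{2}(atanK t) /tan divfK// gt_eqF.
  rewrite /q hornerM hornerC hornerXn (_ : x * _ + _ = cos (atan t) * (x + t * y)); last by ring.
  by rewrite [(cos _ * _) ^+ N]exprMn mulrA divfK// expf_neq0// gt_eqF.
by rewrite qE horner_sum; apply: eq_bigr => j _; rewrite hornerM hornerC.
Qed.

Lemma vandermonde_inverse n (l : nat) : (l < n)%N -> exists c : nat -> R,
  forall k, (k < n)%N -> \sum_(j < n) j%:R ^+ k * c j = (k == l)%:R.
Proof.
move=> ln; pose a : 'rV[R]_n := \row_j j%:R.
have V : Vandermonde n a \in unitmx.
  rewrite unitmxE unitfE det_Vandermonde; apply/prodf_neq0 => i _; apply/prodf_neq0 => j ij.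
  by rewrite !mxE subr_eq0 eqr_nat gtn_eqF.
pose d : 'cV[R]_n := delta_mx (Ordinal ln) 0.
pose c := invmx (Vandermonde n a) *m d.
case: n => [//|n] in ln a V d c *.
exists (fun j => c (inord j) 0) => k kn.
have := congr1 (fun M : 'cV_n.+1 => M (Ordinal kn) 0) (mulKVmx V d).
rewrite -/c !mxE eqxx andbT -val_eqE /= => <-.
by apply: eq_bigr => j _; rewrite !mxE inord_val.
Qed.

(** A combination of the powers (x + j y)^N over the slopes j = 0, .., N isolates one term of the
    binomial expansion, the Vandermonde matrix of the slopes being invertible. *)
Lemma ridge_monomial c a b : is_ridge (fun x y => c * x ^+ a * y ^+ b).
Proof.
pose N := (a + b)%N.
have bN : (b < N.+1)%N by rewrite ltnS leq_addl.
have [w Hw] := vandermonde_inverse bN.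
rewrite (_ : (fun x y => _) = (fun x y => \sum_(j < N.+1) (c * w j / 'C(N, b)%:R) * (x + j%:R * y) ^+ N)).
  by apply: (ridge_sum (F := fun j x y => (c * w j / 'C(N, b)%:R) * (x + j%:R * y) ^+ N)) => j _; exact: ridge_power.
apply/funext => x; apply/funext => y.
have C0 : 'C(N, b)%:R != 0 :> R by rewrite pnatr_eq0 -lt0n bin_gt0 leq_addl.
transitivity (\sum_(k < N.+1) c / 'C(N, b)%:R * (x ^+ (N - k) * y ^+ k *+ 'C(N, k)) * \sum_(j < N.+1) j%:R ^+ k * w j).
  rewrite (bigD1 (Ordinal bN))//= [X in _ = _ + X]big1 ?addr0; last first.
    by move=> k kb; rewrite Hw// -val_eqE /= in kb *; rewrite (negbTE kb) mulr0.
  by rewrite Hw// eqxx addnK -[(x ^+ a * y ^+ b) *+ _]mulr_natl mulr1; field.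
under eq_bigr do rewrite mulr_sumr.
rewrite exchange_big; apply: eq_bigr => j _; rewrite exprDn mulr_sumr; apply: eq_bigr => k _.
by rewrite [(j%:R * y) ^+ k]exprMn -[_ *+ 'C(N, k)]mulr_natl -[_ *+ 'C(N, k)]mulr_natl; field.
Qed.

Lemma poly2_ridge P : is_poly2 P -> is_ridge P.
Proof. by move=> HP; elim: HP => [c i j|P' Q _ H1 _ H2]; [exact: ridge_monomial|exact: ridge_add]. Qed.

End Ridge.

(** * Moments of chord integrals *)

Section Chord.
Context {R : realType}.
Variable gamma : R.
Hypothesis gamma_gtN1 : -1 < gamma.
Notation lam := (gamma + 1).
Notation C := (gegen lam).
Notation Ct := (ngegen gamma).
Let l0 : 0 < lam. Proof. exact: lam_gt0. Qed.
Let tp0 : 0 <= 2 * pi :> R. Proof. by rewrite mulr_ge0// pi_ge0. Qed.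
Implicit Types (f : R * R -> R) (G : R -> R -> R) (w a v e : R).

(** Real coordinates of e^(i w) (v cos a - i sin a): |v| is the distance to the midpoint of the
    chord in units of the half-length cos a. *)
Definition chord_pt w a v : R * R :=
  (cos w * (v * cos a) + sin w * sin a, sin w * (v * cos a) - cos w * sin a).

Definition chord f w a := jmean gamma (fun v => f (chord_pt w a v)).

Lemma chord_pt_sqr w a v : (chord_pt w a v).1 ^+ 2 + (chord_pt w a v).2 ^+ 2 = v ^+ 2 * cos a ^+ 2 + sin a ^+ 2.
Proof.
rewrite /chord_pt /=.
transitivity ((cos w ^+ 2 + sin w ^+ 2) * (v ^+ 2 * cos a ^+ 2 + sin a ^+ 2)); first by ring.
by rewrite cos2Dsin2 mul1r.
Qed.

Lemma disc_chord_pt w a v : -1 <= v <= 1 -> disc (chord_pt w a v).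
Proof.
move=> v1; rewrite /disc /= chord_pt_sqr -[leRHS](cos2Dsin2 a) lerD2r ler_piMl ?sqr_ge0//.
by nra.
Qed.

Lemma within_chord f w a : {within disc, continuous f} ->
  {within `[-1, 1], continuous (fun v => f (chord_pt w a v))}.
Proof.
move=> cf; apply/subspace_continuousP => v vI.
have cp : continuous (chord_pt w a).
  have c1 : continuous (fun v : R => v * cos a) by move=> x; apply: cvgM; [exact: cvg_id|exact: cvg_cst].
  apply: continuous_pairf => x; [apply: cvgD|apply: cvgB]; try exact: cvg_cst;
    by apply: cvgM; [exact: cvg_cst|exact: c1].
have dv : disc (chord_pt w a v) by apply: disc_chord_pt; move: vI; rewrite /= in_itv.
move/subspace_continuousP : cf => /(_ _ dv) cf.
move=> S /cf; rewrite /= /within /= => HS.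
have H' := cp v _ HS.
apply: (@filterS _ (nbhs (v : R)) _ _ _ _ H') => x /= Hx xI; apply: Hx.
by apply: disc_chord_pt; move: xI; rewrite /= in_itv.
Qed.

Lemma chord_dist f g w a e : {within disc, continuous f} -> {within disc, continuous g} ->
  (forall p, disc p -> `|f p - g p| <= e) -> `|chord f w a - chord g w a| <= e * jmom gamma 0.
Proof.
move=> cf cg fg; have jw := jweight gamma_gtN1.
rewrite /chord /jmean -wintB//; try exact: within_chord.
rewrite /jmom /jmean (_ : (fun v => v ^+ 0) = fun=> 1); last by apply/funext => v; rewrite expr0.
apply: wint_norm_le => //; first by apply: withinB; exact: within_chord.
by move=> v v1; apply: fg; exact: disc_chord_pt.
Qed.

(** The component of the chord point along phi is sin a sin (w - phi) + v cos a cos (w - phi), the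
    argument in the product formula. *)
Lemma chord_ridge n phi w a : chord (fun p => (C n).[p.1 * cos phi + p.2 * sin phi]) w a =
  jmom gamma 0 * (C n).[sin a] * (Ct n).[sin (w - phi)].
Proof.
rewrite ngegenE -(@gegen_product _ _ gamma_gtN1 _ _ _ (cos a * cos (w - phi))); last first.
  by rewrite exprMn !cos2sin2.
apply: eq_wint => v _; congr (_.[_]); rewrite /chord_pt /= sinB cosB; ring.
Qed.

Lemma pint_cos (l : nat) (d : R) : (0 < l)%N -> pint (fun w => cos (l%:R * w + d)) = 0.
Proof.
move=> l0'; have l0R : l%:R != 0 :> R by rewrite pnatr_eq0 -lt0n.
have dl x : is_derive x (1 : R) (fun w => l%:R * w + d) l%:R.
  have := is_derive_addf (is_derive_cmulf l%:R (is_derive_id x (1 : R))) (is_derive_cstf d x 1).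
  by rewrite mulr1 addr0.
have dF x : is_derive x (1 : R) (fun w => l%:R^-1 * sin (l%:R * w + d)) (cos (l%:R * x + d)).
  have := is_derive_cmulf l%:R^-1 (is_derive_comp1 (f := fun w => l%:R * w + d) (is_derive_sin _) (dl x)).
  by rewrite mulrC mulfK.
rewrite /pint (rint_FTC tp0 _ dF); last first.
  move=> x; apply: (@continuous_comp _ _ _ (fun w => l%:R * w + d) cos); last exact: continuous_cos.
  by apply: cvgD; [apply: cvgM; [exact: cvg_cst|exact: cvg_id]|exact: cvg_cst].
by rewrite mulr0 add0r [_ + d]addrC sin_nat_per subrr.
Qed.

(** C_n (sin (w - phi)) contains only frequencies up to n < m, so all product frequencies m +- (n -
    2 k) are positive. For the same reason the natural subtractions in [g] are not truncated. *)
Lemma pint_mode_gegen n m phi e : (n < m)%N -> pint (fun w => cos (m%:R * w + e) * (C n).[sin (w - phi)]) = 0.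
Proof.
move=> nm; pose h (l : nat) d w : R := cos (l%:R * w + d).
have ch l d : continuous (h l d).
  move=> x; apply: (@continuous_comp _ _ _ (fun w => l%:R * w + d) cos); last exact: continuous_cos.
  by apply: cvgD; [apply: cvgM; [exact: cvg_cst|exact: cvg_id]|exact: cvg_cst].
pose s := phi + pi / 2.
pose c k := gcoef lam k * gcoef lam (n - k) / 2.
pose g (k : nat) w := c k * (h (m + n - 2 * k)%N (e - (n%:R - 2 * k%:R) * s) w + h (m + 2 * k - n)%N (e + (n%:R - 2 * k%:R) * s) w).
have cg k : continuous (g k).
  by move=> x; apply: cvgM; [exact: cvg_cst|apply: cvgD; exact: ch].
transitivity (pint (fun w => \sum_(k < n.+1) g k w)).
  apply: eq_rint => w _; rewrite (_ : sin (w - phi) = cos (w - s)); last first.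
    by rewrite /s opprD addrA cosBpihalf.
  rewrite gegen_cos /gcos mulr_sumr; apply: eq_bigr => k _; rewrite /g /h /c.
  have k1 : (k <= n)%N by rewrite -ltnS.
  rewrite (_ : (m + n - 2 * k)%:R * w + _ = (m%:R * w + e) + (n%:R - 2 * k%:R) * (w - s)); last first.
    by rewrite natrB; [rewrite natrD natrM; ring|lia].
  rewrite (_ : (m + 2 * k - n)%:R * w + _ = (m%:R * w + e) - (n%:R - 2 * k%:R) * (w - s)); last first.
    by rewrite natrB; [rewrite natrD natrM; ring|lia].
  by move: (m%:R * w + e) (_ * (w - s)) => u u'; rewrite cosD cosB; field.
rewrite /pint rint_sum// big1// => k _; have k1 : (k <= n)%N by rewrite -ltnS.
rewrite rintZ; last by move=> x; apply: cvgD; exact: ch.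
by rewrite rintD//; rewrite -!/(pint _) !pint_cos ?addr0 ?mulr0//; lia.
Qed.

(** The phase [e] treats cosine and sine moments at once. *)
Definition moment n m e G :=
  pint (fun w => cos (m%:R * w + e) * aint gamma (fun a => G w a * (C n).[sin a])).

Lemma aint_rint g : aint gamma g = rint (- (pi / 2)) (pi / 2) (fun a => aweight gamma a * g a).
Proof. by rewrite /aint /rint /wint; apply: eq_Rintegral => x _; rewrite mul1r. Qed.

Lemma continuous_aint G : continuous (fun p : R * R => G p.1 p.2) -> continuous (fun w => aint gamma (G w)).
Proof.
move=> cG; rewrite (_ : (fun w => _) = (fun w => rint (- (pi / 2)) (pi / 2) (fun a => aweight gamma a * G w a))).
  apply: (@continuous_rint _ (fun p : R * R => aweight gamma p.2 * G p.1 p.2)).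
    by have := @pi_gt0 R; lra.
  move=> p; apply: cvgM; last exact: cG.
  by apply: (@continuous_comp _ _ _ snd (aweight gamma)); [exact: cvg_snd|exact: continuous_aweight].
by apply/funext => w; rewrite aint_rint.
Qed.

(** Besides the vanishing moment, H records the chord transform of F as an explicit jointly
    continuous function, which is what the estimates of moments ask for. *)
Lemma ridge_moment n m e F : (n < m)%N -> is_ridge lam F ->
  {within disc, continuous (fun p => F p.1 p.2)} /\
  exists H : R -> R -> R, [/\ forall w a, chord (fun p => F p.1 p.2) w a = H w a,
    continuous (fun p : R * R => H p.1 p.2) & moment n m e H = 0].
Proof.
move=> nm HF.
have ccos : continuous (fun w => cos (m%:R * w + e)).
  move=> x; apply: (@continuous_comp _ _ _ (fun w => m%:R * w + e) cos); last exact: continuous_cos.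
  by apply: cvgD; [apply: cvgM; [exact: cvg_cst|exact: cvg_id]|exact: cvg_cst].
elim: HF => [|c phi j F' HF' [cF' [H [HE cH mH]]]].
  split; first by apply: continuous_subspaceT; exact: cst_continuous.
  exists (fun _ _ => 0); split.
  - move=> w a; rewrite /chord /jmean -[RHS](mul0r (wint (-1) 1 (jacobi_weight (-1) 1 gamma) (fun=> 1))) -wintZ.
    + by apply: eq_wint => v _; rewrite mul0r.
    + exact: jweight.
    + exact: within_cst.
  - exact: cst_continuous.
  rewrite /moment -[RHS](mul0r (pint (fun=> 1))) /pint -rintZ; last exact: cst_continuous.
  apply: eq_rint => w _; rewrite (_ : aint gamma _ = 0) ?mulr0 ?mul0r//.
  rewrite -[RHS](mul0r (aint gamma (fun=> 1))) -aintZ//; last exact: cst_continuous.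
  by apply: eq_wint => a _; rewrite !mul0r.
have cr : continuous (fun p : R * R => (C j).[p.1 * cos phi + p.2 * sin phi]).
  move=> p; apply: (@continuous_comp _ _ _ (fun p : R * R => p.1 * cos phi + p.2 * sin phi) (fun x => (C j).[x])); last exact: continuous_horner.
  by apply: cvgD; apply: cvgM; [exact: cvg_fst|exact: cvg_cst|exact: cvg_snd|exact: cvg_cst].
have ccr : continuous (fun p : R * R => c * (C j).[p.1 * cos phi + p.2 * sin phi]).
  by move=> p; apply: cvgM; [exact: cvg_cst|exact: cr].
have cF : {within disc, continuous (fun p : R * R => c * (C j).[p.1 * cos phi + p.2 * sin phi] + F' p.1 p.2)}.
  move/subspace_continuousP : (continuous_subspaceT ccr (A := disc)) => c1.
  move/subspace_continuousP : cF' => c2; apply/subspace_continuousP => p dp.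
  by apply: cvgD; [exact: c1|exact: c2].
split => //.
have jw := jweight gamma_gtN1.
pose H0 w a := c * (jmom gamma 0 * (C j).[sin a] * (Ct j).[sin (w - phi)]).
have cH0 : continuous (fun p : R * R => H0 p.1 p.2).
  move=> p; apply: cvgM; first exact: cvg_cst.
  apply: cvgM.
    apply: cvgM; first exact: cvg_cst.
    by apply: (@continuous_comp _ _ _ snd (fun a => (C j).[sin a])); [exact: cvg_snd|exact: continuous_sinpoly].
  apply: (@continuous_comp _ _ _ (fun p : R * R => p.1 - phi) (fun a => (Ct j).[sin a])); last exact: continuous_sinpoly.
  by apply: cvgB; [exact: cvg_fst|exact: cvg_cst].
exists (fun w a => H0 w a + H w a); split.
- move=> w a; rewrite -HE /H0 -chord_ridge /chord /jmean -wintZ; first last.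
  + exact: (@within_chord (fun p => (C j).[p.1 * cos phi + p.2 * sin phi]) w a (continuous_subspaceT cr)).
  + exact: jw.
  rewrite -wintD//; first exact: (@within_chord (fun p => c * (C j).[p.1 * cos phi + p.2 * sin phi]) w a (continuous_subspaceT ccr)).
  exact: (@within_chord (fun p => F' p.1 p.2) w a cF').
- by move=> p; apply: cvgD; [exact: cH0|exact: cH].
have cS : continuous (fun a => (C n).[sin a]) by exact: continuous_sinpoly.
have cS2 : continuous (fun p : R * R => (C n).[sin p.2]).
  by move=> p; apply: (@continuous_comp _ _ _ snd (fun a => (C n).[sin a])); [exact: cvg_snd|exact: continuous_sinpoly].
have cHS (K : R -> R -> R) : continuous (fun p : R * R => K p.1 p.2) -> continuous (fun p : R * R => K p.1 p.2 * (C n).[sin p.2]).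
  by move=> cK p; apply: cvgM; [exact: cK|exact: cS2].
have cHw (K : R -> R -> R) w : continuous (fun p : R * R => K p.1 p.2) -> continuous (fun a => K w a * (C n).[sin a]).
  by move=> cK; exact: (@continuous2_right _ (fun p => K p.1 p.2 * (C n).[sin p.2]) w (cHS K cK)).
have cM (K : R -> R -> R) : continuous (fun p : R * R => K p.1 p.2) -> continuous (fun w => cos (m%:R * w + e) * aint gamma (fun a => K w a * (C n).[sin a])).
  move=> cK w; apply: cvgM; first exact: ccos.
  exact: (continuous_aint (G := fun w a => K w a * (C n).[sin a]) (cHS K cK)).
(* For j different from n the integral over a vanishes by orthogonality; for j = n the integral over
   w does, because m > n. *)
have mH0 : moment n m e H0 = 0.
  have [jn|jn] := eqVneq j n; last first.
    rewrite /moment -[RHS](mul0r (pint (fun=> 1))) /pint -rintZ; last exact: cst_continuous.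
    apply: eq_rint => w _; rewrite (_ : aint gamma _ = 0) ?mulr0 ?mul0r//.
    rewrite -[RHS](mulr0 (c * jmom gamma 0 * (Ct j).[sin (w - phi)])).
    rewrite -(aintC_orth gamma_gtN1 (m := j) (n := n)); last by apply/eqP.
    rewrite -aintZ//; last exact: continuous_sinpoly.
    by apply: eq_wint => a _; rewrite /H0 [(C j * C n).[_]]hornerM; ring.
  pose k := c * jmom gamma 0 / (C j).[1] * aint gamma (fun a => ((C j) * (C n)).[sin a]).
  rewrite -[RHS](mulr0 k) -(@pint_mode_gegen j m phi e); last by rewrite jn.
  rewrite /moment /pint -rintZ; last first.
    move=> x; apply: cvgM; first exact: ccos.
    apply: (@continuous_comp _ _ _ (fun w : R => w - phi) (fun a => (C j).[sin a])); last exact: continuous_sinpoly.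
    by apply: cvgB; [exact: cvg_id|exact: cvg_cst].
  apply: eq_rint => w _.
  rewrite (_ : aint gamma (fun a => H0 w a * (C n).[sin a]) = c * jmom gamma 0 * (Ct j).[sin (w - phi)] * aint gamma (fun a => ((C j) * (C n)).[sin a])).
    by rewrite ngegenE /k; ring.
  rewrite -aintZ//; last exact: continuous_sinpoly.
  by apply: eq_wint => a _; rewrite /H0 [(C j * C n).[_]]hornerM; ring.
rewrite /moment -[RHS]addr0 -[X in _ = X + _]mH0 -[X in _ = _ + X]mH /moment /pint.
rewrite -rintD; [|exact: cM|exact: cM].
apply: eq_rint => w _; rewrite -mulrDr -aintD//; [|exact: cHw|exact: cHw].
by congr (_ * _); apply: eq_wint => a _; rewrite mulrDl.
Qed.

(** G is compared with chord means only at interior angles; continuity carries the bound to the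
    endpoints. *)
Lemma closed_bound (h : R -> R) x y M : x < y -> continuous h -> (forall z, x < z < y -> `|h z| <= M) ->
  forall z, x <= z <= y -> `|h z| <= M.
Proof.
move=> xy ch H z zI; rewrite leNgt; apply/negP => Mz.
have cn : continuous (fun z => `|h z|) by move=> u; apply: cvg_norm; exact: ch.
have [d d0 Hd] : exists2 d : R, 0 < d & forall u, `|z - u| < d -> M < `|h u|.
  have : \forall u \near z, M < `|h u| by exact: (cn z _ (lt_nbhsr Mz)).
  by move=> /nbhs_ballP[d /= d0 Hd]; exists d => // u zu; exact: Hd.
pose t := Num.min (d / 2) ((y - x) / 4).
have t0 : 0 < t by rewrite lt_min !divr_gt0// subr_gt0.
have t1 : t <= d / 2 by rewrite ge_min lexx.
have t2 : t <= (y - x) / 4 by rewrite ge_min lexx orbT.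
have [zl|zl] := leP z ((x + y) / 2).
  have : M < `|h (z + t)| by apply: Hd; rewrite opprD addNKr normrN gtr0_norm//; lra.
  by apply/negP; rewrite -leNgt H//; lra.
have : M < `|h (z - t)| by apply: Hd; rewrite opprB addrC subrK gtr0_norm//; lra.
by apply/negP; rewrite -leNgt H//; lra.
Qed.

(** A uniform error d on f changes the moment by at most d K, and the moment vanishes for
    polynomials, which are dense. *)
Lemma chord_moment f G n m e : (n < m)%N -> {within disc, continuous f} ->
  continuous (fun p : R * R => G p.1 p.2) ->
  (forall w a, - (pi / 2) < a < pi / 2 -> G w a = chord f w a) -> moment n m e G = 0.
Proof.
move=> nm cf cG GE.
have p0 := @pi_gt0 R.
have cS2 : continuous (fun p : R * R => (C n).[sin p.2]).
  by move=> p; apply: (@continuous_comp _ _ _ snd (fun a => (C n).[sin a])); [exact: cvg_snd|exact: continuous_sinpoly].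
have cHS (K : R -> R -> R) : continuous (fun p : R * R => K p.1 p.2) -> continuous (fun p : R * R => K p.1 p.2 * (C n).[sin p.2]).
  by move=> cK p; apply: cvgM; [exact: cK|exact: cS2].
have ccos : continuous (fun w => cos (m%:R * w + e)).
  move=> x; apply: (@continuous_comp _ _ _ (fun w => m%:R * w + e) cos); last exact: continuous_cos.
  by apply: cvgD; [apply: cvgM; [exact: cvg_cst|exact: cvg_id]|exact: cvg_cst].
have cM (K : R -> R -> R) : continuous (fun p : R * R => K p.1 p.2) -> continuous (fun w => cos (m%:R * w + e) * aint gamma (fun a => K w a * (C n).[sin a])).
  move=> cK w; apply: cvgM; first exact: ccos.
  exact: (continuous_aint (G := fun w a => K w a * (C n).[sin a]) (cHS K cK)).
have C1 : 0 < (C n).[1] by exact: gegen1_gt0.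
have a1 : 0 <= aint gamma (fun=> 1).
  by apply: wint_ge0; [exact: aweightP|move=> *; exact: ler01].
pose K := jmom gamma 0 * (C n).[1] * aint gamma (fun=> 1) * (2 * pi).
have j0 := jmom0_gt0 gamma_gtN1.
have K0 : 0 <= K.
  by apply: mulr_ge0 => //; apply: mulr_ge0 => //; apply: mulr_ge0; exact: ltW.
have B d : 0 < d -> `|moment n m e G| <= d * K.
  move=> d0; have [P HP PE] := weierstrass_disc cf d0.
  have [cP [H [HE cH mH]]] := ridge_moment e nm (poly2_ridge l0 HP).
  rewrite -[moment _ _ _ _]subr0 -mH /moment /pint -rintB; [|exact: cM|exact: cM].
  have -> : d * K = (d * jmom gamma 0 * (C n).[1] * aint gamma (fun=> 1)) * (2 * pi - 0) by rewrite /K; ring.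
  apply: rint_norm_le => //.
    by move=> w; apply: cvgB; exact: cM.
  move=> w _; rewrite -mulrBr normrM -[leRHS]mul1r.
  apply: ler_pM => //; first by rewrite ler_norml cos_geN1 cos_le1.
  have cw (G' : R -> R -> R) : continuous (fun p : R * R => G' p.1 p.2) -> continuous (G' w).
    by move=> cG'; exact: (@continuous2_right _ (fun p => G' p.1 p.2) w cG').
  have cwS (G' : R -> R -> R) : continuous (fun p : R * R => G' p.1 p.2) -> continuous (fun a => G' w a * (C n).[sin a]).
    by move=> cG'; exact: (@continuous2_right _ (fun p => G' p.1 p.2 * (C n).[sin p.2]) w (cHS G' cG')).
  rewrite -aintB; [|exact: gamma_gtN1|exact: cwS|exact: cwS].
  apply: aint_norm_le => //; first by move=> a; apply: cvgB; exact: cwS.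
  move=> a aI; rewrite -mulrBl normrM; apply: ler_pM => //; last first.
    by apply: gegen_norm_le => //; exact: sin_itv.
  apply: (closed_bound (x := - (pi / 2)) (y := pi / 2) (h := fun a => G w a - H w a)) => //; first by lra.
    by move=> z; apply: cvgB; exact: cw.
  move=> z zI; rewrite GE// -HE; apply: chord_dist => // p dp.
  by rewrite distrC; exact: PE.
apply/eqP; rewrite -normr_eq0; apply/eqP/le_anti; rewrite normr_ge0 andbT.
apply/ler_addgt0Pl => d d0; rewrite addr0.
have K1 : 0 < K + 1 by lra.
apply: le_trans (B (d / (K + 1)) (divr_gt0 d0 K1)) _.
by rewrite mulrAC ler_pdivrMr// ler_wpM2l ?(ltW d0)//; lra.
Qed.

End Chord.

(** * Decay of the Gegenbauer coefficients *)

Section SmoothFamily.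
Context {R : realType}.
Implicit Types (D : nat -> nat -> R -> R -> R) (M : nat -> nat -> R).

Lemma mean_value_bound (f f' : R -> R) (a b x y M : R) : (forall z, is_derive z (1 : R) f (f' z)) ->
  (forall z, a <= z <= b -> `|f' z| <= M) -> a <= x <= b -> a <= y <= b -> `|f y - f x| <= M * `|y - x|.
Proof.
move=> df fM; wlog xy : x y / x <= y.
  move=> H xI yI; have [/H|/ltW/H] := leP x y; first exact.
  by rewrite distrC (distrC x); apply.
move=> xI yI.
have [c cxy ->] := @MVT_segment R f f' x y xy (fun z _ => df z) (within_cont (is_derive_cont df)).
rewrite normrM ler_wpM2r// fM//; move: cxy xI yI; rewrite in_itv /=; lra.
Qed.

Lemma continuous_cos_affine (c e : R) : continuous (fun w : R => cos (c * w + e)).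
Proof.
move=> x; apply: (@continuous_comp _ _ _ (fun w : R => c * w + e) cos); last exact: continuous_cos.
by apply: cvgD; [apply: cvgM; [exact: cvg_cst|exact: cvg_id]|exact: cvg_cst].
Qed.

Definition smooth_family D := forall j k x y,
  is_derive x (1 : R) (fun x => D j k x y) (D j.+1 k x y) /\
  is_derive y (1 : R) (fun y => D j k x y) (D j k.+1 x y).

(** The sum of binomial (q, k) M (q - k) k: a bound for the q-th derivative along the direction (-1,
    1). *)
Fixpoint family_bound q M : R :=
  if q is q'.+1 then family_bound q' (fun j k => M j.+1 k + M j k.+1) else M 0%N 0%N.

Lemma family_boundZ q M c : family_bound q (fun j k => M j k * c) = family_bound q M * c.
Proof.
elim: q M => [//|q IH] M /=; rewrite -IH; congr family_bound.
by apply/funext => j; apply/funext => k; rewrite mulrDl.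
Qed.

(** The difference of a smooth family along (- t, t) is again a smooth family, whose bounds are
    those of the next order times |t|. *)
Lemma lipn_family q D M w : smooth_family D -> (forall j k x y, `|D j k x y| <= M j k) ->
  lipn q (family_bound q M) (fun a => D 0%N 0%N (w - a) a).
Proof.
elim: q D M => [|q IH] D M sD bD /=; first by move=> x; exact: bD.
move=> t.
pose D' j k x y := D j k (x - t) (y + t) - D j k x y.
have sD' : smooth_family D'.
  move=> j k x y; split.
    have [H1 _] := sD j k x y; have [H2 _] := sD j k (x - t) (y + t).
    exact: is_derive_subf (is_derive_shiftf (F := fun x => D j k x (y + t)) H2) H1.
  have [_ H1] := sD j k x y; have [_ H2] := sD j k (x - t) (y + t).
  exact: is_derive_subf (is_derive_shiftf (F := fun y => D j k (x - t) y) H2) H1.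
have bD' j k x y : `|D' j k x y| <= (M j.+1 k + M j k.+1) * `|t|.
  rewrite /D' [X in `|X|](_ : _ = (D j k (x - t) (y + t) - D j k x (y + t)) + (D j k x (y + t) - D j k x y)); last by ring.
  apply: le_trans (ler_normD _ _) _; rewrite mulrDl lerD//.
    have := @mean_value_bound _ _ (Num.min x (x - t)) (Num.max x (x - t)) x (x - t) (M j.+1 k)
      (fun z => (sD j k z (y + t)).1) (fun z _ => bD j.+1 k z (y + t)).
    by rewrite (_ : x - t - x = - t) ?normrN; [apply|ring]; rewrite ge_min le_max lexx ?orbT.
  have := @mean_value_bound _ _ (Num.min y (y + t)) (Num.max y (y + t)) y (y + t) (M j k.+1)
      (fun z => (sD j k x z).2) (fun z _ => bD j k.+1 x z).
  by rewrite (_ : y + t - y = t); [apply|ring]; rewrite ge_min le_max lexx ?orbT.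
rewrite -family_boundZ.
have := IH D' _ sD' bD'; rewrite /D'.
rewrite (_ : (fun a => _ - _) = (fun a => D 0%N 0%N (w - (a + t)) (a + t) - D 0%N 0%N (w - a) a))//.
by apply/funext => a; rewrite opprD addrA.
Qed.

End SmoothFamily.

Section Decay.
Context {R : realType}.
Variable gamma : R.
Hypothesis gamma_gtN1 : -1 < gamma.
Notation lam := (gamma + 1).
Notation C := (gegen lam).
Notation Ct := (ngegen gamma).
Variable G : R -> R -> R.
Hypothesis cG : continuous (fun p : R * R => G p.1 p.2).
Hypothesis perw : forall a, per2pi (fun w => G w a).
Hypothesis pera : forall w, per2pi (G w).
Hypothesis Grefl : forall w a, G w (pi - a) = G w a.
Hypothesis Gflip : forall w a, - (pi / 2) <= a <= pi / 2 -> G (w + pi) (- a) = G w a.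
Hypothesis Glip : forall q, exists K, forall w, lipn q K (G w).

Definition fcoef j w := acoef gamma j (G w).

Lemma cGw w : continuous (G w).
Proof. exact: (@continuous2_right _ (fun p => G p.1 p.2) w cG). Qed.

Lemma nat_sqrt (n : nat) : exists r, (r ^ 2 <= n < r.+1 ^ 2)%N.
Proof.
elim: n => [|n [r /andP[r1 r2]]]; first by exists 0%N.
have [h|h] := ltnP n.+1 (r.+1 ^ 2); first by exists r; rewrite h leqW.
by exists r.+1; rewrite h /=; nia.
Qed.

Lemma nat_sqrt_le r n : (0 < r)%N -> (n < r.+1 ^ 2)%N -> (n.+1 <= 4 * r ^ 2)%N.
Proof. by move=> r0 nr; apply: leq_trans nr _; rewrite -(expnMn 2 r 2) leq_exp2r//; lia. Qed.

Lemma fcoef_decay P : exists K, 0 <= K /\ forall j w, `|fcoef j w| <= K / j.+1%:R ^+ P.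
Proof.
have [A [p [A0 HA]]] := acoef_expansion gamma_gtN1.
have [A' [p' [A'0 HA']]] := acoef_bound gamma_gtN1.
(* Differences of order 2 s give r^(- 2 s), comparable to j^(- s); the part j^(- p) pays for the
   growth in [acoef_expansion]. *)
pose s := (p + P)%N.
have [K0 HK0] := Glip 0; have [K1 HK1] := Glip (2 * s).
pose K := `|K1|.
have HK w : lipn (2 * s) K (G w) by apply: lipn_le (HK1 w); exact: ler_norm.
have n0 : 0 <= `|K0| by []. have k0 : 0 <= K by rewrite /K.
(* 1156 = 17^2 * 4: the square of the constant in [jrate], times the 4 of [nat_sqrt_le]. *)
have [c c0 cE] : exists2 c : R, 0 <= c & c = 1156.
  by exists 1156%:R; [exact: ler0n|reflexivity].
have t0 : 0 <= A * c ^+ s * K by rewrite !mulr_ge0// exprn_ge0.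
exists (A * c ^+ s * K + A' * `|K0|); split; first by rewrite addr_ge0// mulr_ge0.
move=> [|j] w.
  rewrite expr1n divr1; have := HA' 0%N (G w) `|K0| (cGw (w := w)) n0.
  rewrite expr1n mulr1 => H; apply: (le_trans (H _)); last by rewrite lerDr.
  by move=> x _; apply: le_trans (HK0 w x) (ler_norm _).
have [r /andP[r1 r2]] := nat_sqrt j.+1.
have r0 : (0 < r)%N by case: r r1 r2.
have [Q [sQ HQ]] := jackson r0 (cGw (w := w)) (pera w) (Grefl w) (HK w).
have j0 : 0 <= K * jrate r ^+ (2 * s) by rewrite mulr_ge0// exprn_ge0// divr_ge0.
have [H _] := HA (r ^ 2)%N Q (G w) _ (cGw (w := w)) sQ j0 (fun x _ => HQ x).
apply: le_trans (H _ r1) _.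
set J : R := j.+2%:R.
have J0 : 0 < J by rewrite ltr0n.
have jr : jrate r ^+ 2 <= c / J :> R.
  rewrite cE /jrate expr_div_n ler_pdivlMr// mulrAC ler_pdivrMr ?exprn_gt0 ?ltr0n// /J -!natrX -!natrM ler_nat.
  have h := nat_sqrt_le r0 r2.
  by rewrite (_ : 1156 = 17 ^ 2 * 4)%N// -mulnA leq_mul2l h orbT.
have jrs : jrate r ^+ (2 * s) <= c ^+ s / J ^+ s :> R.
  by rewrite exprM -expr_div_n lerXn2r// nnegrE ?exprn_ge0// ?divr_ge0// ltW.
apply: (@le_trans _ _ (A * J ^+ p * (K * (c ^+ s / J ^+ s)))).
  by rewrite ler_wpM2l ?mulr_ge0 ?exprn_ge0 ?(ltW J0)// ler_wpM2l.
rewrite {2}/s exprD [leLHS](_ : _ = A * c ^+ s * K / J ^+ P).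
  by rewrite ler_wpM2r ?invr_ge0 ?exprn_ge0 ?(ltW J0)// lerDl mulr_ge0.
by field; rewrite !expf_neq0// gt_eqF.
Qed.

Lemma fcoef_expansion : exists K, 0 <= K /\ forall r w x, (0 < r)%N -> - (pi / 2) <= x <= pi / 2 ->
  `|G w x - \sum_(j < r ^ 2) fcoef j w * (Ct j).[sin x]| <= K / r%:R ^+ 2.
Proof.
have [A [p [A0 HA]]] := acoef_expansion gamma_gtN1.
(* Order 2 (p + 1) leaves r^(-2) after the loss of (r^2)^p. *)
have [K1 HK1] := Glip (2 * p.+1).
pose K := `|K1|.
have k0 : 0 <= K by rewrite /K.
have HK w : lipn (2 * p.+1) K (G w) by apply: lipn_le (HK1 w); exact: ler_norm.
have [c c0 cE] : exists2 c : R, 0 <= c & 17 ^+ 2 = c by exists (17 ^+ 2); rewrite ?exprn_ge0.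
exists (A * 2 ^+ p * (K * c ^+ p.+1)); split; first by rewrite !mulr_ge0// exprn_ge0.
move=> r w x r0 xI.
have [Q [sQ HQ]] := jackson r0 (cGw (w := w)) (pera w) (Grefl w) (HK w).
have j0 : 0 <= K * jrate r ^+ (2 * p.+1) by rewrite mulr_ge0// exprn_ge0// divr_ge0.
have [_ H] := HA (r ^ 2)%N Q (G w) _ (cGw (w := w)) sQ j0 (fun x _ => HQ x).
apply: le_trans (H _ xI) _.
have r0' : 0 < r%:R :> R by rewrite ltr0n.
have h1 : (r ^ 2).+1%:R ^+ p <= 2 ^+ p * (r%:R ^+ 2) ^+ p :> R.
  rewrite -exprMn lerXn2r ?nnegrE ?mulr_ge0 ?exprn_ge0//.
  by rewrite -natrX -natrM ler_nat; nia.
have -> : jrate r ^+ (2 * p.+1) = c ^+ p.+1 / (r%:R ^+ 2) ^+ p.+1 :> R.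
  by rewrite exprM /jrate expr_div_n cE -expr_div_n.
apply: (@le_trans _ _ (A * (2 ^+ p * (r%:R ^+ 2) ^+ p) * (K * (c ^+ p.+1 / (r%:R ^+ 2) ^+ p.+1)))).
  rewrite ler_wpM2r//; first by rewrite mulr_ge0// divr_ge0// exprn_ge0// exprn_ge0 ?(ltW r0').
  by rewrite ler_wpM2l.
rewrite [X in _ / X]exprS le_eqVlt; apply/orP; left; apply/eqP; field.
have rn : r%:R != 0 :> R by rewrite gt_eqF.
by rewrite rn /= !expf_neq0.
Qed.

Lemma gegenNx n x : (C n).[- x] = (-1) ^+ n * (C n).[x].
Proof.
suff [] : (C n).[- x] = (-1) ^+ n * (C n).[x] /\ (C n.+1).[- x] = (-1) ^+ n.+1 * (C n.+1).[x] by [].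
elim: n => [|n [IH1 IH2]].
  by rewrite gegen0 gegen1 !hornerM !hornerC !hornerX expr0 expr1; split; ring.
split=> //.
have E y : (C n.+2).[y] = n.+2%:R^-1 * (2 * (n.+1%:R + lam) * y * (C n.+1).[y] - (n%:R + 2 * lam) * (C n).[y]).
  have := congr1 (fun p => p.[y]) (gegen_rec lam n); rewrite /= hornerM hornerC hornerD hornerN !hornerM !hornerC hornerX => <-.
  by rewrite mulKf// pnatr_eq0.
by rewrite !E IH1 IH2 !exprS; ring.
Qed.

Let cGCt j : continuous (fun p : R * R => G p.1 p.2 * (Ct j).[sin p.2]).
Proof.
move=> p; apply: cvgM; first exact: cG.
by apply: (@continuous_comp _ _ _ snd (fun a => (Ct j).[sin a])); [exact: cvg_snd|exact: continuous_sinpoly].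
Qed.

Lemma continuous_fcoef j : continuous (fcoef j).
Proof.
have cA : continuous (fun w => aint gamma (fun a => G w a * (Ct j).[sin a])).
  exact: (@continuous_aint _ _ gamma_gtN1 (fun w a => G w a * (Ct j).[sin a]) (@cGCt j)).
by move=> w; apply: cvgM; [exact: cA|exact: cvg_cst].
Qed.

Lemma fcoef_per j : per2pi (fcoef j).
Proof. by move=> w; apply: eq_acoef => x _; exact: (perw x). Qed.

(** Replacing a by - a in the integral exchanges G at w + pi with G at w by [Gflip], while C_j (sin
    a) acquires the sign (-1)^j. *)
Lemma fcoef_half_turn j : half_turn j (fcoef j).
Proof.
move=> w; rewrite /fcoef /acoef mulrA; congr (_ / _).
have p0 : - (pi / 2) <= pi / 2 :> R by have := pi_gt0 R; lra.
have cW : continuous (fun a => G w a * (Ct j).[sin a]).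
  exact: (@continuous2_right _ (fun p => G p.1 p.2 * (Ct j).[sin p.2]) w (@cGCt j)).
have cA : continuous (fun a => aweight gamma a * (G w a * (Ct j).[sin a])).
  by move=> a; apply: cvgM; [exact: continuous_aweight|exact: cW].
have H := rint_opp p0 cA; rewrite opprK in H.
have cN : continuous (fun a : R => aweight gamma (- a) * (G w (- a) * (Ct j).[sin (- a)])).
  move=> a; apply: (@continuous_comp _ _ _ -%R (fun a => aweight gamma a * (G w a * (Ct j).[sin a]))); last exact: cA.
  exact: opp_continuous.
rewrite !aint_rint -H -rintZ//; apply: eq_rint => a aI.
rewrite /aweight cosN sinN !ngegenE gegenNx -[a in G _ a]opprK Gflip; last by move: aI; lra.
rewrite [RHS](_ : _ = ((-1) ^+ j * (-1) ^+ j) * (ppow (2 * lam) (cos a) * (G w (- a) * ((C j).[sin a] / (C j).[1])))); last by ring.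
by rewrite -expr2 sqrr_sign mul1r.
Qed.

Lemma fcoef_band_limited j :
  (forall n m e, (n < m)%N -> ~~ odd (m + n) -> moment gamma n m e G = 0) -> band_limited j (fcoef j).
Proof.
move=> H m jm ev.
have E (e : R) : pint (fun t : R => fcoef j t * cos (m%:R * t + e)) = 0.
  have := H j m e jm ev; rewrite /moment => /(congr1 (fun x => ((C j).[1]^-1 / anorm gamma j) * x)).
  have cG2 : continuous (fun p : R * R => G p.1 p.2 * (C j).[sin p.2]).
    move=> p; apply: cvgM; first exact: cG.
    by apply: (@continuous_comp _ _ _ snd (fun a => (C j).[sin a])); [exact: cvg_snd|exact: continuous_sinpoly].
  have cA : continuous (fun w => aint gamma (fun a => G w a * (C j).[sin a])).
    exact: (@continuous_aint _ _ gamma_gtN1 (fun w a => G w a * (C j).[sin a]) cG2).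
  have ccos : continuous (fun w : R => cos (m%:R * w + e)).
    exact: continuous_cos_affine.
  have cM : continuous (fun w : R => cos (m%:R * w + e) * aint gamma (fun a => G w a * (C j).[sin a])).
    by move=> w; apply: cvgM; [exact: ccos|exact: cA].
  rewrite mulr0 /pint -rintZ// => H'; rewrite -[RHS]H'; apply: eq_rint => t _.
  rewrite /fcoef /acoef (_ : aint gamma (fun x => G t x * (Ct j).[sin x]) = (C j).[1]^-1 * aint gamma (fun a => G t a * (C j).[sin a])).
    by ring.
  rewrite -aintZ//; first by apply: eq_wint => a _; rewrite ngegenE; ring.
  move=> a; apply: cvgM; [exact: cGw|exact: continuous_sinpoly].
split; first by rewrite -[RHS](E 0); congr pint; apply/funext => t; rewrite addr0.
by rewrite -[RHS](E (- (pi / 2))); congr pint; apply/funext => t; rewrite cosBpihalf.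
Qed.

End Decay.

(** * Smooth series of ridge functions *)

Section SquareSummable.
Context {R : realType}.
Implicit Types (u v x : nat -> R) (K e t : R).

Definition sq_summable K u := forall j : nat, `|u j| <= K / j.+1%:R ^+ 2.

Definition total u : R := limn (series u).

Lemma small_inv K e : 0 < e -> exists2 n : nat, (0 < n)%N & forall m : nat, (n <= m)%N -> K / m%:R <= e.
Proof.
move=> e0; exists (Num.truncn (`|K| / e)).+1 => // m nm.
have m0 : 0 < m%:R :> R by rewrite ltr0n (leq_trans _ nm).
rewrite ler_pdivrMr// (le_trans (ler_norm K))// mulrC -ler_pdivrMr//.
by apply: ltW; apply: lt_le_trans (truncnS_gt _) _; rewrite ler_nat.
Qed.

(** 1 / (m + 1)^2 <= 1 / m - 1 / (m + 1), so the tail is dominated by a telescoping sum. *)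
Lemma sum_tail K u n k : 0 <= K -> sq_summable K u -> (0 < n)%N ->
  `|\sum_(j < n + k) u j - \sum_(j < n) u j| <= K / n%:R - K / (n + k)%:R.
Proof.
move=> K0 uK n0; elim: k => [|k IH]; first by rewrite addn0 !subrr normr0.
rewrite addnS big_ord_recr /= (_ : _ + _ - _ = (\sum_(j < n + k) u j - \sum_(j < n) u j) + u (n + k)%N); last by ring.
apply: le_trans (ler_normD _ _) _; apply: le_trans (lerD IH (uK _)) _.
set m := (n + k)%N; have m0 : 0 < m%:R :> R by rewrite ltr0n /m addn_gt0 n0.
rewrite -natr1; set M : R := m%:R in m0 *.
have M1 : 0 < M + 1 by lra.
rewrite -subr_ge0 (_ : _ - _ = K / (M * (M + 1) ^+ 2)).
  by rewrite divr_ge0// mulr_ge0 ?(ltW m0)// exprn_ge0// ltW.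
have nn : n%:R != 0 :> R by rewrite pnatr_eq0 -lt0n.
by field; rewrite ?nn ?(gt_eqF m0) ?(gt_eqF M1).
Qed.

Lemma sum_tail_le K u n k : 0 <= K -> sq_summable K u -> (0 < n)%N ->
  `|\sum_(j < n + k) u j - \sum_(j < n) u j| <= K / n%:R.
Proof.
move=> K0 uK n0; apply: le_trans (sum_tail k K0 uK n0) _.
by rewrite gerBl divr_ge0.
Qed.

Lemma total_cvg K u : 0 <= K -> sq_summable K u -> \sum_(j < n) u j @[n --> \oo] --> total u.
Proof.
move=> K0 uK.
have E : series u = fun n => \sum_(j < n) u j by apply/funext => n; rewrite /series /= big_mkord.
rewrite -E; apply/cauchy_cvgP/cauchy_exP => e e0.
have e2 : 0 < e / 2 by rewrite divr_gt0.
have [n n0 Hn] := small_inv K e2.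
exists (series u n); exists n => // m /= nm.
rewrite /ball /= E distrC -(subnKC nm).
apply: le_lt_trans (sum_tail_le _ K0 uK n0) _; apply: le_lt_trans (Hn n (leqnn n)) _.
by rewrite ltr_pdivrMr// ltr_pMr// ltr1n.
Qed.

Lemma total_tail K u n : 0 <= K -> sq_summable K u -> (0 < n)%N -> `|total u - \sum_(j < n) u j| <= K / n%:R.
Proof.
move=> K0 uK n0; apply/ler_addgt0Pl => e e0.
have /cvgrPdist_le/(_ e e0) := total_cvg K0 uK.
move=> [N _ HN].
have := HN (n + N)%N (leq_addl _ _) => /= H.
rewrite (_ : _ - _ = (total u - \sum_(j < n + N) u j) + (\sum_(j < n + N) u j - \sum_(j < n) u j)); last by ring.
by apply: le_trans (ler_normD _ _) _; rewrite lerD// sum_tail_le.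
Qed.

(** Sums a termwise estimate: with x the derivatives this is differentiation term by term, with t =
    0 it gives Lipschitz bounds. The factor 2 bounds the sum of 1 / (j + 1)^2. *)
Lemma total_comb K1 K u v x t : 0 <= K1 -> sq_summable K1 u -> sq_summable K1 v -> sq_summable K1 x -> 0 <= K ->
  (forall j : nat, `|u j - v j - t * x j| <= K / j.+1%:R ^+ 2) -> `|total u - total v - t * total x| <= 2 * K.
Proof.
move=> K10 uK vK xK K0 H; apply/ler_addgt0Pl => e e0.
have [n n0 Hn] := small_inv (K1 * (2 + `|t|)) e0.
pose z j := u j - v j - t * x j.
have zn : `|\sum_(j < n) z j| <= 2 * K.
  have := sum_tail_le n.-1 K0 (H : sq_summable K z) (ltn0Sn 0); rewrite add1n prednK// divr1 big_ord_recl big_ord0 addr0.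
  have := H 0%N; rewrite expr1n divr1 -/(z 0%N) => h1 h2.
  rewrite -[X in `|X|](subrK (z 0%N)); apply: le_trans (ler_normD _ _) _; move: h1 h2; lra.
have zE : \sum_(j < n) z j = \sum_(j < n) u j - \sum_(j < n) v j - t * \sum_(j < n) x j.
  by rewrite /z !sumrB mulr_sumr.
rewrite (_ : _ - _ = (\sum_(j < n) z j) + ((total u - \sum_(j < n) u j) - (total v - \sum_(j < n) v j) - t * (total x - \sum_(j < n) x j))); last first.
  by rewrite zE; ring.
apply: le_trans (ler_normD _ _) _; rewrite addrC lerD//.
apply: le_trans (Hn n (leqnn n)).
have h1 := total_tail K10 uK n0; have h2 := total_tail K10 vK n0; have h3 := total_tail K10 xK n0.
apply: le_trans (ler_normB _ _) _.
rewrite (_ : K1 * (2 + `|t|) / n%:R = (K1 / n%:R + K1 / n%:R) + `|t| * (K1 / n%:R)); last by ring.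
by rewrite lerD//; [apply: le_trans (ler_normB _ _) _; rewrite lerD|rewrite normrM ler_wpM2l].
Qed.

(** Second-order remainders can be summed over the terms of a series before any limit in t is
    taken. *)
Lemma is_derive_quadratic (f : R * R -> R) (p v : R * R) (L K d : R) : 0 < d ->
  (forall t : R, `|t| <= d -> `|f (t *: v + p) - f p - t * L| <= K * t ^+ 2) -> is_derive p v f L.
Proof.
move=> d0 H.
have c : h^-1 *: ((f \o shift p) (h *: v) - f p) @[h --> (0 : R)^'] --> L.
  apply/cvgrPdist_le => e e0.
  have k0 : 0 < `|K| + 1 by rewrite addrC ltr_pwDl.
  pose b := Num.min d (e / (`|K| + 1)).
  have b0 : 0 < b by rewrite lt_min d0 divr_gt0.
  near=> h.
  have h0 : h != 0 by near: h; exact: nbhs_dnbhs_neq.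
  have hb : `|h| <= b.
    near: h; apply: dnbhs0_le; exact: b0.
  have hd : `|h| <= d by apply: le_trans hb _; rewrite ge_min lexx.
  have he : `|h| * (`|K| + 1) <= e.
    by rewrite -ler_pdivlMr//; apply: le_trans hb _; rewrite ge_min lexx orbT.
  have hn : 0 < `|h| by rewrite normr_gt0.
  rewrite -(ler_pM2l hn) -normrM.
  rewrite (_ : h * _ = - (f (h *: v + p) - f p - h * L)); last first.
    by rewrite /= mulrBr [h^-1 *: _]/(h^-1 * _) mulVKf//; ring.
  rewrite normrN; apply: le_trans (H h hd) _.
  rewrite -[h ^+ 2]real_normK ?num_real// expr2 mulrCA ler_wpM2l//.
  apply: le_trans he; rewrite mulrC ler_wpM2l// (le_trans (ler_norm K))// lerDl//.
apply: DeriveDef; first by apply/cvg_ex; exists L.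
exact: cvg_lim c.
Unshelve. all: by end_near. Qed.

Lemma poly_lipschitz (q : {poly R}) (M x y : R) : (forall z, -1 <= z <= 1 -> `|q^`().[z]| <= M) ->
  -1 <= x <= 1 -> -1 <= y <= 1 -> `|q.[y] - q.[x]| <= M * `|y - x|.
Proof.
move=> qM x1 y1.
exact: (@mean_value_bound _ (fun z => q.[z]) (fun z => q^`().[z]) (-1) 1 x y M (fun z => is_derive_poly q z)).
Qed.

Lemma poly_taylor (q : {poly R}) (M x y : R) : (forall z, -1 <= z <= 1 -> `|q^`()^`().[z]| <= M) ->
  -1 <= x <= 1 -> -1 <= y <= 1 -> `|q.[y] - q.[x] - (y - x) * q^`().[x]| <= M * (y - x) ^+ 2.
Proof.
move=> qM x1 y1.
have M0 : 0 <= M by apply: le_trans (qM 0 _) => //; lra.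
pose g := q - (q^`().[x])%:P * 'X.
have gE z : g.[z] = q.[z] - q^`().[x] * z by rewrite /g hornerD hornerN hornerM hornerC hornerX.
have g'E z : g^`().[z] = q^`().[z] - q^`().[x].
  by rewrite /g derivB derivM derivC derivX mul0r add0r mulr1 hornerD hornerN hornerC.
have := @mean_value_bound _ (fun z => g.[z]) (fun z => g^`().[z]) (Num.min x y) (Num.max x y) x y (M * `|y - x|)
   (fun z => is_derive_poly g z).
rewrite !gE -mulrA -expr2 real_normK ?num_real// => H.
rewrite (_ : _ - _ - _ = q.[y] - q^`().[x] * y - (q.[x] - q^`().[x] * x)); last by ring.
apply: H; rewrite ?ge_min ?le_max ?lexx ?orbT//.
move=> z; have [xy|xy] := leP x y => zI; rewrite g'E.
  apply: le_trans (poly_lipschitz qM x1 _) _; first by move: zI x1 y1; lra.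
  by rewrite ler_wpM2l// !ger0_norm ?subr_ge0//; move: zI; lra.
apply: le_trans (poly_lipschitz qM x1 _) _; first by move: zI x1 y1; lra.
by rewrite ler_wpM2l// !ler0_norm ?subr_le0//; move: zI xy; lra.
Qed.

End SquareSummable.

Section RidgeSeries.
Context {R : realType}.
Variable gamma : R.
Hypothesis gamma_gtN1 : -1 < gamma.
Notation lam := (gamma + 1).
Notation C := (gegen lam).
Notation Ct := (ngegen gamma).
Variables (N : nat -> nat) (w phi : nat -> nat -> R).
Hypothesis Hw : forall P, exists B, 0 <= B /\ forall j, \sum_(i < N j) `|w j i| <= B / j.+1%:R ^+ P.
Implicit Types (p q : R * R) (t : R).

Definition ridge_arg (f : R) p := p.1 * cos f + p.2 * sin f.

Lemma ridge_arg_itv f p : disc p -> -1 <= ridge_arg f p <= 1.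
Proof.
move=> dp; have h : ridge_arg f p ^+ 2 <= 1.
  apply: (@le_trans _ _ ((p.1 ^+ 2 + p.2 ^+ 2) * (cos f ^+ 2 + sin f ^+ 2))); last by rewrite cos2Dsin2 mulr1.
  rewrite -subr_ge0 (_ : _ - _ = (p.1 * sin f - p.2 * cos f) ^+ 2) ?sqr_ge0// /ridge_arg; ring.
by apply/andP; split; nra.
Qed.

(** The partial derivative of order r in the first and s in the second variable of the j-th sum of
    ridge polynomials. *)
Definition ridge_term r s p j := \sum_(i < N j) (w j i * cos (phi j i) ^+ r * sin (phi j i) ^+ s) *
  ((Ct j)^`(r + s)).[ridge_arg (phi j i) p].

Definition ridge_series r s p := total (ridge_term r s p).

Definition ridge_size k j : R := (\sum_(i < N j) `|w j i|) * (j%:R * (j%:R + 2 * lam)) ^+ k.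

Lemma ridge_size_le k : exists K, 0 <= K /\ forall j, ridge_size k j <= K / j.+1%:R ^+ 2.
Proof.
have l0 := lam_gt0 gamma_gtN1.
have [B [B0 HB]] := Hw (2 * k + 2).
have L0 : 0 <= 1 + 2 * lam by rewrite addr_ge0// mulr_ge0// ltW.
exists (B * (1 + 2 * lam) ^+ k); split; first by rewrite mulr_ge0// exprn_ge0.
move=> j; have J0 : 0 < j.+1%:R :> R by rewrite ltr0n.
apply: (@le_trans _ _ ((B / j.+1%:R ^+ (2 * k + 2)) * ((1 + 2 * lam) * j.+1%:R ^+ 2) ^+ k)).
  have j0 : 0 <= j%:R :> R by [].
  have jj : 0 <= j%:R * (j%:R + 2 * lam) by rewrite mulr_ge0// addr_ge0// mulr_ge0// ltW.
  apply: ler_pM => //; [exact: sumr_ge0|by rewrite exprn_ge0|].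
  have j1 : j.+1%:R = j%:R + 1 :> R by rewrite natr1.
  apply: lerXn2r; rewrite ?nnegrE//; first by rewrite mulr_ge0// exprn_ge0.
  by rewrite j1; move: l0 j0; nra.
rewrite le_eqVlt; apply/orP; left; apply/eqP.
rewrite exprMn exprD exprM; field.
by rewrite !expf_neq0// gt_eqF.
Qed.

Lemma ridge_sum_le k r s j (v : nat -> R) (X : R) : 0 <= X ->
  (forall i, `|v i| <= X * (j%:R * (j%:R + 2 * lam)) ^+ k) ->
  `|\sum_(i < N j) (w j i * cos (phi j i) ^+ r * sin (phi j i) ^+ s) * v i| <= X * ridge_size k j.
Proof.
move=> X0 H; apply: le_trans (ler_norm_sum _ _ _) _.
rewrite /ridge_size mulrCA mulr_suml; apply: ler_sum => i _.
rewrite normrM; apply: ler_pM => //.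
rewrite !normrM !normrX -mulrA -[leRHS]mulr1 ler_wpM2l// -[leRHS]mulr1.
by apply: ler_pM; rewrite ?exprn_ge0// exprn_ile1// ler_norml ?cos_geN1 ?cos_le1 ?sin_geN1 ?sin_le1.
Qed.

Lemma ridge_term_le r s p j : disc p -> `|ridge_term r s p j| <= ridge_size (r + s) j.
Proof.
move=> dp; rewrite -[leRHS]mul1r; apply: (@ridge_sum_le (r + s) r s j (fun i => (Ct j)^`(r + s).[ridge_arg (phi j i) p]) 1) => // i; rewrite mul1r.
by apply: ngegen_derivn_le => //; exact: ridge_arg_itv.
Qed.

Lemma ridge_term_lip r s p q j : disc p -> disc q ->
  `|ridge_term r s p j - ridge_term r s q j| <= (`|p.1 - q.1| + `|p.2 - q.2|) * ridge_size (r + s).+1 j.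
Proof.
move=> dp dq; rewrite /ridge_term -sumrB.
under eq_bigr do rewrite -mulrBr.
apply: (@ridge_sum_le (r + s).+1 r s j (fun i => (Ct j)^`(r + s).[ridge_arg (phi j i) p] - (Ct j)^`(r + s).[ridge_arg (phi j i) q])).
  by rewrite addr_ge0.
move=> i; apply: le_trans (poly_lipschitz (M := (j%:R * (j%:R + 2 * lam)) ^+ (r + s).+1) _ (ridge_arg_itv _ dq) (ridge_arg_itv _ dp)) _.
  by move=> z zI; rewrite -derivnS; exact: ngegen_derivn_le.
rewrite [leRHS]mulrC ler_wpM2l//.
  by rewrite exprn_ge0// mulr_ge0// addr_ge0// mulr_ge0// ltW// lam_gt0.
rewrite (_ : _ - _ = (p.1 - q.1) * cos (phi j i) + (p.2 - q.2) * sin (phi j i)); last by rewrite /ridge_arg; ring.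
apply: le_trans (ler_normD _ _) _; rewrite !normrM.
by rewrite lerD// -[leRHS]mulr1 ler_wpM2l// ler_norml ?cos_geN1 ?cos_le1 ?sin_geN1 ?sin_le1.
Qed.

Lemma ridge_term_taylor1 r s p t j : disc p -> disc (p.1 + t, p.2) ->
  `|ridge_term r s (p.1 + t, p.2) j - ridge_term r s p j - t * ridge_term r.+1 s p j| <= t ^+ 2 * ridge_size (r + s).+2 j.
Proof.
move=> dp dq; rewrite /ridge_term mulr_sumr -!sumrB.
pose v (i : nat) := (Ct j)^`(r + s).[ridge_arg (phi j i) (p.1 + t, p.2)] - (Ct j)^`(r + s).[ridge_arg (phi j i) p] -
  (ridge_arg (phi j i) (p.1 + t, p.2) - ridge_arg (phi j i) p) * (Ct j)^`((r + s).+1).[ridge_arg (phi j i) p].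
rewrite (_ : \sum_(i < N j) _ = \sum_(i < N j) (w j i * cos (phi j i) ^+ r * sin (phi j i) ^+ s) * v i); last first.
  apply: eq_bigr => i _; rewrite addSn exprS /v (_ : ridge_arg _ (p.1 + t, p.2) - ridge_arg _ p = t * cos (phi j i)); last by rewrite /ridge_arg /=; ring.
  by ring.
apply: (@ridge_sum_le (r + s).+2 r s j v); first exact: sqr_ge0.
move=> i; rewrite /v derivnS; apply: le_trans (poly_taylor (M := (j%:R * (j%:R + 2 * lam)) ^+ (r + s).+2) _ (ridge_arg_itv _ dp) (ridge_arg_itv _ dq)) _.
  by move=> z zI; rewrite -!derivnS; exact: ngegen_derivn_le.
rewrite [leRHS]mulrC ler_wpM2l//.
  by rewrite exprn_ge0// mulr_ge0// addr_ge0// mulr_ge0// ltW// lam_gt0.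
rewrite (_ : _ - _ = t * cos (phi j i)); last by rewrite /ridge_arg /=; ring.
by rewrite exprMn -[leRHS]mulr1 ler_wpM2l ?sqr_ge0// -(cos2Dsin2 (phi j i)) lerDl sqr_ge0.
Qed.

Lemma ridge_term_taylor2 r s p t j : disc p -> disc (p.1, p.2 + t) ->
  `|ridge_term r s (p.1, p.2 + t) j - ridge_term r s p j - t * ridge_term r s.+1 p j| <= t ^+ 2 * ridge_size (r + s).+2 j.
Proof.
move=> dp dq; rewrite /ridge_term mulr_sumr -!sumrB.
pose v (i : nat) := (Ct j)^`(r + s).[ridge_arg (phi j i) (p.1, p.2 + t)] - (Ct j)^`(r + s).[ridge_arg (phi j i) p] -
  (ridge_arg (phi j i) (p.1, p.2 + t) - ridge_arg (phi j i) p) * (Ct j)^`((r + s).+1).[ridge_arg (phi j i) p].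
rewrite (_ : \sum_(i < N j) _ = \sum_(i < N j) (w j i * cos (phi j i) ^+ r * sin (phi j i) ^+ s) * v i); last first.
  apply: eq_bigr => i _; rewrite addnS exprS /v (_ : ridge_arg _ (p.1, p.2 + t) - ridge_arg _ p = t * sin (phi j i)); last by rewrite /ridge_arg /=; ring.
  by ring.
apply: (@ridge_sum_le (r + s).+2 r s j v); first exact: sqr_ge0.
move=> i; rewrite /v derivnS; apply: le_trans (poly_taylor (M := (j%:R * (j%:R + 2 * lam)) ^+ (r + s).+2) _ (ridge_arg_itv _ dp) (ridge_arg_itv _ dq)) _.
  by move=> z zI; rewrite -!derivnS; exact: ngegen_derivn_le.
rewrite [leRHS]mulrC ler_wpM2l//.
  by rewrite exprn_ge0// mulr_ge0// addr_ge0// mulr_ge0// ltW// lam_gt0.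
rewrite (_ : _ - _ = t * sin (phi j i)); last by rewrite /ridge_arg /=; ring.
by rewrite exprMn -[leRHS]mulr1 ler_wpM2l ?sqr_ge0// -(cos2Dsin2 (phi j i)) lerDr sqr_ge0.
Qed.

Lemma ridge_summable r s : exists K, 0 <= K /\ forall p, disc p -> sq_summable K (ridge_term r s p).
Proof.
have [K [K0 HK]] := ridge_size_le (r + s); exists K; split=> // p dp j.
exact: le_trans (ridge_term_le _ _ _ dp) (HK j).
Qed.

Lemma total_comb_family (u v x : nat -> R) t c k : (exists2 K, 0 <= K & sq_summable K u) ->
  (exists2 K, 0 <= K & sq_summable K v) -> (exists2 K, 0 <= K & sq_summable K x) -> 0 <= c ->
  forall K, 0 <= K -> (forall j, ridge_size k j <= K / j.+1%:R ^+ 2) ->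
  (forall j, `|u j - v j - t * x j| <= c * ridge_size k j) -> `|total u - total v - t * total x| <= 2 * (c * K).
Proof.
move=> [K1 K10 H1] [K2 K20 H2] [K3 K30 H3] c0 K K0 HK H.
have S (K' : R) z : K' <= K1 + K2 + K3 -> sq_summable K' z -> sq_summable (K1 + K2 + K3) z.
  by move=> le Hz j; apply: le_trans (Hz j) _; rewrite ler_wpM2r// invr_ge0 exprn_ge0.
apply: (@total_comb _ (K1 + K2 + K3)).
- by lra.
- by apply: S H1; lra.
- by apply: S H2; lra.
- by apply: S H3; lra.
- exact: mulr_ge0.
by move=> j; apply: le_trans (H j) _; rewrite -mulrA ler_wpM2l.
Qed.

Lemma ridge_summable2 r s p : disc p -> exists2 K, 0 <= K & sq_summable K (ridge_term r s p).
Proof. by move=> dp; have [K [K0 H]] := ridge_summable r s; exists K => //; exact: H. Qed.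

Lemma ridge_series_continuous r s : {within disc, continuous (ridge_series r s)}.
Proof.
have [K [K0 HK]] := ridge_size_le (r + s).+1.
have L p q : disc p -> disc q -> `|ridge_series r s p - ridge_series r s q| <= 2 * ((`|p.1 - q.1| + `|p.2 - q.2|) * K).
  move=> dp dq; rewrite (_ : _ - _ = ridge_series r s p - ridge_series r s q - 0 * total (ridge_term r s p)); last by rewrite mul0r subr0.
  apply: (@total_comb_family _ _ _ 0 _ (r + s).+1) => //; try exact: ridge_summable2.
  by move=> j; rewrite mul0r subr0; exact: ridge_term_lip.
apply/subspace_continuousP => p dp; apply/cvgrPdist_le => e e0.
have k1 : 0 < 4 * (K + 1) by lra.
have b0 : 0 < e / (4 * (K + 1)) by rewrite divr_gt0.
have c1 : continuous (fst : R * R -> R) by move=> q; exact: cvg_fst.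
have c2 : continuous (snd : R * R -> R) by move=> q; exact: cvg_snd.
have /cvgrPdist_le/(_ _ b0) n1 := c1 p.
have /cvgrPdist_le/(_ _ b0) n2 := c2 p.
suff : \forall q \near p, disc q -> `|ridge_series r s p - ridge_series r s q| <= e by [].
near=> q => dq.
apply: le_trans (L _ _ dp dq) _.
have h1 : `|p.1 - q.1| <= e / (4 * (K + 1)) by near: q; exact: n1.
have h2 : `|p.2 - q.2| <= e / (4 * (K + 1)) by near: q; exact: n2.
apply: (@le_trans _ _ (2 * ((e / (4 * (K + 1)) + e / (4 * (K + 1))) * (K + 1)))).
  by rewrite ler_wpM2l// ler_pM ?addr_ge0// ?lerD//; lra.
rewrite le_eqVlt; apply/orP; left; apply/eqP; field; lra.
Unshelve. all: by end_near. Qed.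

Lemma disc_room p : p.1 ^+ 2 + p.2 ^+ 2 < 1 -> exists2 d : R, 0 < d &
  forall t, `|t| <= d -> disc (p.1 + t, p.2) /\ disc (p.1, p.2 + t).
Proof.
(* A step t with |t| <= 1 raises the squared norm by at most 2 |t| + t^2 <= 3 |t|, whence the 3. *)
move=> p1; exists ((1 - (p.1 ^+ 2 + p.2 ^+ 2)) / 3); first by rewrite divr_gt0// subr_gt0.
move=> t ht; rewrite /disc /=; have [] := @disc_square _ p (ltW p1).
have := sqr_ge0 p.1; have := sqr_ge0 p.2.
move: p.1 p.2 p1 ht => a b p1 ht a0 b0 a1 b1.
have t2 : t ^+ 2 <= `|t| by rewrite -[t ^+ 2]real_normK ?num_real// expr2 ler_piMr//; lra.
have ta : a * t <= `|t|.
  apply: le_trans (ler_norm _) _; rewrite normrM ler_piMl// ler_norml; lra.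
have tb : b * t <= `|t|.
  apply: le_trans (ler_norm _) _; rewrite normrM ler_piMl// ler_norml; lra.
by split; rewrite sqrrD -[_ *+ 2]mulr_natl; lra.
Qed.

Lemma ridge_series_derive r s p : p.1 ^+ 2 + p.2 ^+ 2 < 1 ->
  is_derive p (1, 0) (ridge_series r s) (ridge_series r.+1 s p) /\
  is_derive p (0, 1) (ridge_series r s) (ridge_series r s.+1 p).
Proof.
move=> p1; have dp : disc p by exact: ltW.
have [d d0 Hd] := disc_room p1.
have [K [K0 HK]] := ridge_size_le (r + s).+2.
split; apply: (@is_derive_quadratic _ _ _ _ _ (2 * K) _ d0) => t td; have [q1 q2] := Hd t td;
  rewrite -[2 * K * _]mulrA [K * _]mulrC.
- rewrite (_ : t *: (1, 0) + p = (p.1 + t, p.2)); last first.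
    by case: (p) => x y; congr pair => /=; rewrite /GRing.scale/= ?mulr1 ?mulr0 ?add0r// addrC.
  apply: (@total_comb_family _ _ _ t _ (r + s).+2) => //; try exact: ridge_summable2; try exact: sqr_ge0.
  by move=> j; exact: ridge_term_taylor1.
rewrite (_ : t *: (0, 1) + p = (p.1, p.2 + t)); last first.
  by case: (p) => x y; congr pair => /=; rewrite /GRing.scale/= ?mulr1 ?mulr0 ?add0r// addrC.
apply: (@total_comb_family _ _ _ t _ (r + s).+2) => //; try exact: ridge_summable2; try exact: sqr_ge0.
by move=> j; exact: ridge_term_taylor2.
Qed.

Lemma continuous_ridge_term p j : continuous (fun p => ridge_term 0 0 p j).
Proof.
move=> q; apply: cvg_big => //; first by move=> z; exact: add_continuous.
move=> i _; apply: cvgM; first exact: cvg_cst.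
apply: (@continuous_comp _ _ _ (ridge_arg (phi j i)) (fun x => ((Ct j)^`(0 + 0)).[x])); last exact: continuous_horner.
by apply: cvgD; apply: cvgM; [exact: cvg_fst|exact: cvg_cst|exact: cvg_snd|exact: cvg_cst].
Qed.

Lemma chord_ridge_term om al j : chord gamma (fun p => ridge_term 0 0 p j) om al =
  jmom gamma 0 * (Ct j).[sin al] * \sum_(i < N j) w j i * (Ct j).[sin (om - phi j i)].
Proof.
have jw := jweight gamma_gtN1.
pose rf (i : nat) (p : R * R) := (C j).[p.1 * cos (phi j i) + p.2 * sin (phi j i)].
have cd i : {within disc, continuous (rf i)}.
  apply: continuous_subspaceT => p.
  apply: (@continuous_comp _ _ _ (ridge_arg (phi j i)) (fun x => (C j).[x])); last exact: continuous_horner.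
  by apply: cvgD; apply: cvgM; [exact: cvg_fst|exact: cvg_cst|exact: cvg_snd|exact: cvg_cst].
have cr i := @within_chord _ (rf i) om al (cd i).
transitivity (jmean gamma (fun v => \sum_(i < N j) (w j i / (C j).[1]) * rf i (chord_pt om al v))).
  apply: eq_wint => v _; rewrite /ridge_term; apply: eq_bigr => i _.
  by rewrite !expr0 !mulr1 addn0 derivn0 ngegenE /ridge_arg /rf; ring.
rewrite /jmean wint_sum//; last first.
  move=> i; apply: withinM; first exact: within_cst.
  by move=> v; apply (cr i v).
rewrite mulr_sumr; apply: eq_bigr => i _; rewrite wintZ//.
rewrite -/(jmean gamma (fun v => rf i (chord_pt om al v))).
have -> : jmean gamma (fun v => rf i (chord_pt om al v)) =
   jmom gamma 0 * (C j).[sin al] * (Ct j).[sin (om - phi j i)] := chord_ridge gamma_gtN1 j (phi j i) om al.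
by rewrite [(Ct j).[sin al]]ngegenE; ring.
Qed.

Lemma chord_ridge_series om al : exists K, 0 <= K /\ forall n, (0 < n)%N ->
  `|chord gamma (ridge_series 0 0) om al - \sum_(j < n) chord gamma (fun p => ridge_term 0 0 p j) om al| <= K / n%:R.
Proof.
have [K [K0 HK]] := ridge_summable 0 0; have j0 := jmom0_gt0 gamma_gtN1.
exists (K * jmom gamma 0); split; first by rewrite mulr_ge0// ltW.
move=> n n0.
have cs : continuous (fun p => \sum_(j < n) ridge_term 0 0 p j).
  by move=> q; apply: cvg_big => //; [move=> z; exact: add_continuous|move=> j _; exact: continuous_ridge_term].
have jw := jweight gamma_gtN1.
have -> : \sum_(j < n) chord gamma (fun p => ridge_term 0 0 p j) om al = chord gamma (fun p => \sum_(j < n) ridge_term 0 0 p j) om al.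
  rewrite /chord /jmean wint_sum// => j.
  apply: (@within_chord _ (fun p => ridge_term 0 0 p j)); apply: continuous_subspaceT => p; exact: continuous_ridge_term.
rewrite mulrAC; apply: chord_dist => //.
- exact: ridge_series_continuous.
- exact: continuous_subspaceT.
by move=> p dp; apply: total_tail => //; exact: HK.
Qed.

End RidgeSeries.

(** * Construction of a smooth preimage from the moment conditions *)

Section Inversion.
Context {R : realType}.
Variable gamma : R.
Hypothesis gamma_gtN1 : -1 < gamma.
Notation lam := (gamma + 1).
Notation C := (gegen lam).
Notation Ct := (ngegen gamma).

Definition gcos_coef j k : R := gcoef lam k * gcoef lam (j - k) / (C j).[1].

Let l0 : 0 < lam. Proof. exact: lam_gt0. Qed.
Let C1 j : 0 < (C j).[1]. Proof. exact: gegen1_gt0. Qed.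

Lemma ngegen_tk j t : (Ct j).[cos t] = tk j (gcos_coef j) t.
Proof.
rewrite ngegenE gegen_cos /gcos /tk mulr_suml; apply: eq_bigr => k _.
by rewrite /gcos_coef mulrAC.
Qed.

Lemma gcos_coef_gt0 j k : 0 < gcos_coef j k.
Proof. by rewrite /gcos_coef divr_gt0// mulr_gt0// gcoef_gt0. Qed.

Lemma gcos_coef_sym j k : (k <= j)%N -> gcos_coef j (j - k) = gcos_coef j k.
Proof. by move=> kj; rewrite /gcos_coef subKn// [gcoef _ _ * _]mulrC. Qed.

(** [gcoef_ge] bounds both factors of the numerator below by m / (j + 1), and [gegen1_le] bounds the
    denominator by (j + 1)^M; summation over k costs one more power. *)
Lemma gcos_coef_inv_sum : exists A q, 0 <= A /\
  forall j, \sum_(k < j.+1) `|(gcos_coef j k)^-1| <= A * j.+1%:R ^+ q.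
Proof.
pose m := Num.min lam 1.
have m0 : 0 < m by rewrite lt_min l0 ltr01.
pose M := (Num.truncn (2 * lam)).+1.
have MM : 2 * lam <= M%:R by rewrite ltW// truncnS_gt.
exists (m ^- 2), (M + 3)%N; split; first by rewrite invr_ge0 exprn_ge0// ltW.
move=> j; have J0 : 0 < j.+1%:R :> R by rewrite ltr0n.
apply: (@le_trans _ _ (\sum_(k < j.+1) m ^- 2 * j.+1%:R ^+ (M + 2))); last first.
  rewrite sumr_const card_ord -[_ *+ _]mulr_natr -mulrA -exprSr.
  by rewrite (_ : (M + 2).+1 = M + 3)%N//; lia.
apply: ler_sum => k _; rewrite gtr0_norm ?invr_gt0 ?gcos_coef_gt0//.
have lb i : (i <= j)%N -> m / j.+1%:R <= gcoef lam i.
  move=> ij; rewrite ler_pdivrMr// mulrC; apply: le_trans (gcoef_ge l0 i) _.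
  by rewrite ler_wpM2r ?(ltW (gcoef_gt0 l0 i))// ler_nat.
have kj : (k <= j)%N by rewrite -ltnS.
have h1 := lb k kj; have h2 := lb (j - k)%N (leq_subr _ _).
have h3 := gegen1_le l0 j MM.
have mj : 0 < m / j.+1%:R by rewrite divr_gt0.
have L : (m / j.+1%:R) ^+ 2 / j.+1%:R ^+ M <= gcos_coef j k.
  rewrite /gcos_coef; apply: ler_pM.
  - by rewrite exprn_ge0// ltW.
  - by rewrite invr_ge0 exprn_ge0// ltW.
  - by rewrite expr2; apply: ler_pM => //; exact: ltW.
  - by rewrite lef_pV2 ?posrE ?exprn_gt0.
rewrite (_ : m ^- 2 * _ = ((m / j.+1%:R) ^+ 2 / j.+1%:R ^+ M)^-1); last first.
  have nm : m != 0 by rewrite gt_eqF.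
  have nJ : j.+1%:R != 0 :> R by rewrite gt_eqF.
  have := expf_neq0 M nJ; rewrite exprD; move: (j.+1%:R : R) (j.+1%:R ^+ M) nJ => x y nx ny.
  by field; rewrite ?nx ?ny ?nm.
by rewrite lef_pV2 ?posrE ?gcos_coef_gt0// divr_gt0// exprn_gt0.
Qed.

Variable G : R -> R -> R.
Hypothesis cG : continuous (fun p : R * R => G p.1 p.2).
Hypothesis perw : forall a, per2pi (fun w => G w a).
Hypothesis pera : forall w, per2pi (G w).
Hypothesis Grefl : forall w a, G w (pi - a) = G w a.
Hypothesis Gflip : forall w a, - (pi / 2) <= a <= pi / 2 -> G (w + pi) (- a) = G w a.
Hypothesis Glip : forall q, exists K, forall w, lipn q K (G w).
Hypothesis Gmom : forall n m e, (n < m)%N -> ~~ odd (m + n) -> moment gamma n m e G = 0.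

(** [jmom gamma 0] cancels the constant of the product formula and 2 j + 1 that of the quadrature.
    The shift pi / 2 reflects sin (w - phi) = cos (w - pi / 2 - phi). *)
Definition grid_weight j i : R :=
  grid_sol j (fun k => (gcos_coef j k)^-1) (fcoef gamma G j) (pi / 2) i / (jmom gamma 0 * (j.*2.+1)%:R).

Let j0 : 0 < jmom gamma 0. Proof. exact: jmom0_gt0. Qed.

Lemma grid_weight_sum P : exists B, 0 <= B /\
  forall j, \sum_(i < j.*2.+1) `|grid_weight j i| <= B / j.+1%:R ^+ P.
Proof.
have [A [q [A0 HA]]] := gcos_coef_inv_sum.
(* The extra q orders of decay pay for the growth of the inverse cosine coefficients. *)
have [K [K0 HK]] := fcoef_decay gamma_gtN1 cG pera Grefl Glip (P + q).
exists (K * A / jmom gamma 0); split; first by rewrite divr_ge0 ?mulr_ge0// ltW.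
move=> j; have J0 : 0 < j.+1%:R :> R by rewrite ltr0n.
have N0 : 0 < (j.*2.+1)%:R :> R by rewrite ltr0n.
apply: (@le_trans _ _ (\sum_(i < j.*2.+1) (K / j.+1%:R ^+ (P + q)) * (A * j.+1%:R ^+ q) / (jmom gamma 0 * (j.*2.+1)%:R))).
  apply: ler_sum => i _; rewrite /grid_weight normrM normfV [X in _ / X]gtr0_norm ?mulr_gt0//.
  rewrite ler_wpM2r ?invr_ge0 ?mulr_ge0 ?(ltW j0)//.
  apply: le_trans (grid_sol_norm _ _ _ _ (HK j)) _.
  by rewrite ler_wpM2l// divr_ge0// exprn_ge0.
rewrite sumr_const card_ord -[_ *+ _]mulr_natr le_eqVlt; apply/orP; left; apply/eqP.
have nJ : j.+1%:R != 0 :> R by rewrite gt_eqF.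
have nN : (j.*2.+1)%:R != 0 :> R by rewrite gt_eqF.
have nj : jmom gamma 0 != 0 by rewrite gt_eqF.
have nP := expf_neq0 P nJ; have nq := expf_neq0 q nJ.
rewrite exprD; move: nP nq nN nj; move: (j.+1%:R ^+ P) (j.+1%:R ^+ q) ((j.*2.+1)%:R : R) (jmom gamma 0) => x y z u nx ny nz nu.
by field; rewrite nx ny nz nu.
Qed.

Lemma grid_weight_coef j om : jmom gamma 0 * \sum_(i < j.*2.+1) grid_weight j i * (Ct j).[sin (om - node j.*2.+1 i)] = fcoef gamma G j om.
Proof.
have sb k : (k <= j)%N -> (gcos_coef j (j - k))^-1 = (gcos_coef j k)^-1 by move=> kj; rewrite gcos_coef_sym.
have ab k : (k <= j)%N -> gcos_coef j k * (gcos_coef j k)^-1 = 1 by move=> _; rewrite divff// gt_eqF// gcos_coef_gt0.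
have cb : continuous (fcoef gamma G j) by exact: continuous_fcoef.
have := @grid_solP R j (gcos_coef j) (fun k => (gcos_coef j k)^-1) (fcoef gamma G j) (pi / 2) (om - pi / 2) cb
  (fcoef_per _ perw j) (fcoef_half_turn gamma_gtN1 cG Gflip j) (fcoef_band_limited gamma_gtN1 cG Gmom) sb ab.
rewrite subrK => <-.
have N0 : (j.*2.+1)%:R != 0 :> R by rewrite pnatr_eq0.
have nj : jmom gamma 0 != 0 by rewrite gt_eqF.
rewrite !mulr_sumr; apply: eq_bigr => i _.
rewrite (_ : sin (om - node j.*2.+1 i) = cos (om - pi / 2 - node j.*2.+1 i)); last first.
  by rewrite -cosBpihalf; congr cos; ring.
rewrite ngegen_tk /grid_weight; set x := tk _ _ _; set y := grid_sol _ _ _ _ _.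
move: ((j.*2.+1)%:R : R) (jmom gamma 0) N0 nj x y => u v u0 v0 x y.
by field; rewrite ?u0 ?v0.
Qed.

Theorem inversion : exists D : nat -> nat -> R * R -> R,
  [/\ forall r s, {within disc, continuous (D r s)},
      forall r s (p : R * R), p.1 ^+ 2 + p.2 ^+ 2 < 1 ->
        is_derive p (1, 0 : R) (D r s) (D r.+1 s p) /\ is_derive p (0, 1 : R) (D r s) (D r s.+1 p) &
      forall w a, - (pi / 2) <= a <= pi / 2 -> chord gamma (D 0%N 0%N) w a = G w a].
Proof.
pose N j := j.*2.+1; pose phi j i : R := node j.*2.+1 i.
exists (ridge_series gamma N grid_weight phi); split.
- move=> r s; apply: ridge_series_continuous => //; exact: grid_weight_sum.
- move=> r s p p1; apply: ridge_series_derive => //; exact: grid_weight_sum.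
move=> om a aI.
have [K1 [K10 H1]] := @chord_ridge_series R gamma gamma_gtN1 N grid_weight phi grid_weight_sum om a.
have [K2 [K20 H2]] := fcoef_expansion gamma_gtN1 cG pera Grefl Glip.
apply/eqP; rewrite -subr_eq0 -normr_eq0; apply/eqP/le_anti; rewrite normr_ge0 andbT.
apply/ler_addgt0Pl => e e0; rewrite addr0.
have [n n0 Hn] := small_inv (K1 + K2) e0.
have nn : (n <= n ^ 2)%N by rewrite expnS expn1 leq_pmull.
have n20 : (0 < n ^ 2)%N by rewrite expn_gt0 n0.
have h1 := H1 _ n20; have h2 := H2 n om a n0 aI.
(* The chord mean of the j-th ridge sum is exactly the j-th term of the expansion of G. The partial
   sums are compared at n^2, the lengths provided by [fcoef_expansion]. *)
have E : \sum_(j < n ^ 2) chord gamma (fun p => ridge_term gamma N grid_weight phi 0 0 p j) om a =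
   \sum_(j < n ^ 2) fcoef gamma G j om * (Ct j).[sin a].
  by apply: eq_bigr => j _; rewrite chord_ridge_term// -[in RHS](grid_weight_coef j om) mulrAC.
rewrite E in h1; rewrite distrC in h2.
apply: le_trans (Hn _ nn); rewrite natrX mulrDl.
rewrite (_ : _ - _ = (chord gamma (ridge_series gamma N grid_weight phi 0 0) om a - \sum_(j < n ^ 2) fcoef gamma G j om * (Ct j).[sin a]) +
   (\sum_(j < n ^ 2) fcoef gamma G j om * (Ct j).[sin a] - G om a)); last by ring.
apply: le_trans (ler_normD _ _) _; rewrite lerD//.
by rewrite -natrX.
Qed.

End Inversion.

(** * Functions on the boundary of the circle bundle *)

Section TorusFamily.
Context {R : realType}.
Implicit Types (f : R -> R) (F : R * R -> R) (x y : R).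

Lemma is_derive_fst F x y L : is_derive (x, y) (1, 0) F L -> is_derive x (1 : R) (fun x => F (x, y)) L.
Proof.
have E : (fun h : R => h^-1 *: ((F \o shift (x, y)) (h *: (1 : R, 0 : R)) - F (x, y))) =
    (fun h : R => h^-1 *: (((fun x => F (x, y)) \o shift x) (h *: (1 : R)) - F (x, y))).
  apply/funext => h; congr (_ *: (F _ - _)); congr pair; by rewrite /= ?scaler0 ?add0r.
move=> [d e]; split; first by move: d; rewrite /derivable E.
by rewrite -e /derive E.
Qed.

Lemma is_derive_snd F x y L : is_derive (x, y) (0, 1) F L -> is_derive y (1 : R) (fun y => F (x, y)) L.
Proof.
have E : (fun h : R => h^-1 *: ((F \o shift (x, y)) (h *: (0 : R, 1 : R)) - F (x, y))) =
    (fun h : R => h^-1 *: (((fun y => F (x, y)) \o shift y) (h *: (1 : R)) - F (x, y))).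
  apply/funext => h; congr (_ *: (F _ - _)); congr pair; by rewrite /= ?scaler0 ?add0r.
move=> [d e]; split; first by move: d; rewrite /derivable E.
by rewrite -e /derive E.
Qed.

Lemma per2pi_reduce f x : per2pi f -> f x = f (x - (Num.floor (x / (2 * pi)))%:~R * (2 * pi)).
Proof.
move=> pf.
have H (n : nat) z : f (z + n%:R * (2 * pi)) = f z.
  elim: n z => [|n IH] z; first by rewrite mul0r addr0.
  by rewrite -[n.+1%:R]natr1 mulrDl mul1r addrA pf IH.
case: (Num.floor _) => n.
  by rewrite -[RHS](H n) -pmulrn subrK.
by rewrite NegzE mulrNz mulNr opprK -pmulrn H.
Qed.

Lemma reduce_itv x : 0 <= x - (Num.floor (x / (2 * pi)))%:~R * (2 * pi) <= 2 * pi.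
Proof.
have p0 : 0 < 2 * pi :> R by rewrite mulr_gt0// pi_gt0.
have /andP[h1 h2] := floor_itv (x / (2 * pi)).
move: h1 h2; rewrite ler_pdivlMr// ltr_pdivrMr// rmorphD /= mulrDl mul1r => h1 h2.
by apply/andP; split; lra.
Qed.

Lemma derive_periodic f f' : (forall x, is_derive x (1 : R) f (f' x)) -> per2pi f -> per2pi f'.
Proof.
move=> df pf x.
have H := is_derive_shiftf (df (x + 2 * pi)).
rewrite (_ : (fun y => f (y + 2 * pi)) = f) in H; last by apply/funext => y; rewrite pf.
by have <- := @derive_val _ _ _ _ _ _ _ H; have <- := @derive_val _ _ _ _ _ _ _ (df x).
Qed.

(** Periodicity passes to all derivatives, so each is bounded by its maximum over one period square;
    this makes the constants uniform. *)
Lemma torus_family F : (forall x y, F (x + 2 * pi, y) = F (x, y)) -> (forall x y, F (x, y + 2 * pi) = F (x, y)) ->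
  smooth_up_to_boundary_real setT F ->
  continuous F /\ exists D : nat -> nat -> R -> R -> R, exists M : nat -> nat -> R,
   [/\ forall x y, D 0%N 0%N x y = F (x, y), smooth_family D & forall j k x y, `|D j k x y| <= M j k].
Proof.
move=> p1 p2 [D]; rewrite closureT => -[D0 cD dD].
have cD' j k : continuous (D j k).
  move=> p; have /subspace_continuousP := cD j k => /(_ p I); rewrite /within /=.
  by move=> H S HS; apply: (@filterS _ (nbhs p) _ _ _ _ (H S HS)) => q; apply.
have D0' : D 0%N 0%N = F by apply/funext => p; apply: D0; rewrite inE.
split; first by rewrite -D0'.
pose E j k x y := D j k (x, y).
have sE : smooth_family E.
  move=> j k x y; have [h1 h2] := dD j k (x, y) I.
  by split; [exact: is_derive_fst|exact: is_derive_snd].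
have pE j k : (forall y, per2pi (fun x => E j k x y)) /\ (forall x, per2pi (E j k x)).
  elim: j => [|j [IH1 IH2]].
    elim: k => [|k [IH1 IH2]]; first by rewrite /E D0'; split=> [y x|x y].
    have H2 x : per2pi (E 0%N k.+1 x) by apply: (derive_periodic (f := E 0%N k x)) => // y; exact: (sE _ _ _ _).2.
    split=> // y x.
    have e : E 0%N k (x + 2 * pi) = E 0%N k x by apply/funext => z; exact: IH1.
    have h1 := (sE 0%N k (x + 2 * pi) y).2; have h2 := (sE 0%N k x y).2.
    rewrite /= in h1 h2; move: h1; rewrite (_ : (fun y => E 0%N k (x + 2 * pi) y) = (fun y => E 0%N k x y)); last by apply/funext => z; exact: IH1.
    by move=> h1; have <- := @derive_val _ _ _ _ _ _ _ h1; have <- := @derive_val _ _ _ _ _ _ _ h2.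
  split=> [y|x y]; first by apply: (derive_periodic (f := fun x => E j k x y)) => // x; exact: (sE _ _ _ _).1.
  have h1 := (sE j k x (y + 2 * pi)).1; have h2 := (sE j k x y).1.
  move: h1; rewrite (_ : (fun x => E j k x (y + 2 * pi)) = (fun x => E j k x y)); last by apply/funext => z; exact: IH2.
  by move=> h1; have <- := @derive_val _ _ _ _ _ _ _ h1; have <- := @derive_val _ _ _ _ _ _ _ h2.
have bE j k : exists M, forall x y, `|E j k x y| <= M.
  have [M [_ HM]] := @rect_bounded R (D j k) 0 (2 * pi) 0 (2 * pi) (@cD' j k).
  exists M => x y; have [h1 h2] := pE j k.
  rewrite (per2pi_reduce x (h1 y)) (per2pi_reduce y (h2 _)).
  by apply: HM; exact: reduce_itv.
have [M HM] := choice (fun jk : nat * nat => bE jk.1 jk.2).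
exists E, (fun j k => M (j, k)); split=> // [x y|j k x y]; first by rewrite /E D0'.
exact: (HM (j, k)).
Qed.

End TorusFamily.

(** * Affine substitution in integrals with a singular weight *)

Section Substitution.
Context {R : realType}.
Notation leb := (@lebesgue_measure R).
Implicit Types (f g : R -> R) (c t : R).

Lemma within_itv_for a b f x : {within `[a, b], continuous f} -> a < x < b -> {for x, continuous f}.
Proof.
move=> cf /andP[ax xb]; have ab : a < b by exact: lt_trans xb.
by have [h _ _] := (continuous_within_itvP f ab).1 cf; apply: h; rewrite in_itv /= ax.
Qed.

Lemma within_affine g c : 0 < c -> {within `[-1, 1], continuous g} ->
  {within `[0, 2 * c], continuous (fun t => g (1 - t / c))}.
Proof.
move=> c0 cg; apply/subspace_continuousP => t; rewrite /= in_itv /= => tI.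
have ct : continuous (fun t : R => 1 - t / c).
  by move=> x; apply: cvgB; [exact: cvg_cst|apply: cvgM; [exact: cvg_id|exact: cvg_cst]].
have rg (s : R) : 0 <= s <= 2 * c -> -1 <= 1 - s / c <= 1.
  move=> /andP[s0 s2]; have h1 : 0 <= s / c by rewrite divr_ge0// ltW.
  have h2 : s / c <= 2 by rewrite ler_pdivrMr.
  by apply/andP; split; lra.
have tI' : `[-1, 1]%classic (1 - t / c) by rewrite /= in_itv /=; exact: rg.
move/subspace_continuousP : cg => /(_ _ tI') cg.
move=> S /cg; rewrite /= /within /= => HS.
have H' := ct t _ HS.
apply: (@filterS _ (nbhs (t : R)) _ _ _ _ H') => x /= Hx xI; apply: Hx.
by rewrite /= in_itv /=; apply: rg; move: xI; rewrite /= in_itv.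
Qed.

(** f may blow up at the endpoints, so both sides are evaluated through the integral function of f
    and [FTC_open]. *)
Lemma integral_affine f c : 0 < c -> leb.-integrable `[-1, 1] (EFin \o f) ->
  leb.-integrable `[0, 2 * c] (EFin \o (fun t => f (1 - t / c))) ->
  (forall x, -1 < x < 1 -> {for x, continuous f}) ->
  \int[leb]_(t in `[0, 2 * c]) f (1 - t / c) = c * \int[leb]_(x in `[-1, 1]) f x.
Proof.
move=> c0 i1 i2 cf; have N11 : -1 < 1 :> R by lra.
pose I (x : R) := (\int[leb]_(t in `[-1, x]) f t)%R.
have cI : {within `[-1, 1], continuous I} by apply: (parameterized_integral_continuous (ltW N11)).
have dI (x : R) : -1 < x < 1 -> is_derive x (1 : R) I (f x).
  move=> /andP[ax xb]; have xab : -1 < x < 1 by rewrite ax.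
  have [d1 d2] := continuous_FTC1_closed xb i1 ax (cf x xab).
  by split; [exact: d1|rewrite -derive1E; exact: d2].
have rg (t : R) : 0 < t < 2 * c -> -1 < 1 - t / c < 1.
  move=> /andP[t0 t2]; have h1 : 0 < t / c by rewrite divr_gt0.
  have h2 : t / c < 2 by rewrite ltr_pdivrMr.
  by apply/andP; split; lra.
have dl (t : R) : is_derive t (1 : R) (fun t => 1 - t / c) (- c^-1).
  have := is_derive_subf (is_derive_cstf 1 t (1 : R)) (is_derive_mulf (is_derive_id t (1 : R)) (is_derive_cstf c^-1 t (1 : R))).
  by rewrite mul1r mulr0 addr0 sub0r.
have dF (t : R) : 0 < t < 2 * c -> is_derive t (1 : R) (fun t => - c * I (1 - t / c)) (f (1 - t / c)).
  move=> tI; have := is_derive_cmulf (- c) (is_derive_comp1 (f := fun t => 1 - t / c) (dI _ (rg t tI)) (dl t)).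
  by rewrite mulrN mulrNN mulrCA divff ?gt_eqF// mulr1.
have c20 : 0 < 2 * c by rewrite mulr_gt0.
rewrite (@FTC_open _ 0 (2 * c) (fun t => f (1 - t / c)) (fun t => - c * I (1 - t / c)) c20 i2 _ _ dF).
- have -> : 1 - 2 * c / c = -1 by rewrite mulfK ?gt_eqF//; ring.
  rewrite mul0r subr0 {1}/I set_itv1 Rintegral_set1 mulr0 sub0r mulNr opprK; by [].
- move=> t tI; apply: (@continuous_comp _ _ _ (fun t : R => 1 - t / c) f); last exact: (cf _ (rg t tI)).
  by apply: cvgB; [exact: cvg_cst|apply: cvgM; [exact: cvg_id|exact: cvg_cst]].
apply: withinM; first exact: within_cst.
exact: within_affine.
Qed.

(** The weight contributes (c^2)^gamma and dt contributes c, hence the exponent 2 gamma + 1. *)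
Lemma wint_jacobi_affine gamma g c : -1 < gamma -> 0 < c -> {within `[-1, 1], continuous g} ->
  wint 0 (2 * c) (jacobi_weight 0 (2 * c) gamma) (fun t => g (1 - t / c)) = c `^ (2 * gamma + 1) * jmean gamma g.
Proof.
move=> g1 c0 cg; have c20 : 0 < 2 * c by rewrite mulr_gt0.
have N11 : -1 < 1 :> R by lra.
have cg' := within_affine c0 cg.
have w1 := weight_jacobi c20 g1; have w2 := jweight g1.
pose K := (c * c) `^ gamma.
have K0 : K != 0 by rewrite gt_eqF// powR_gt0// mulr_gt0.
pose f x := jacobi_weight (-1) 1 gamma x * g x.
have E (t : R) : 0 <= t <= 2 * c -> jacobi_weight 0 (2 * c) gamma t * g (1 - t / c) = K * f (1 - t / c).
  move=> /andP[t0 t2]; rewrite /f mulrA; congr (_ * _).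
  rewrite /jacobi_weight /K -powRM ?mulr_ge0 ?(ltW c0)//.
    by congr (_ `^ _); field; rewrite gt_eqF.
  - have : t / c <= 2 by rewrite ler_pdivrMr. by lra.
  - by have : 0 <= t / c by [rewrite divr_ge0// ltW]; lra.
have i1 := wint_integrable w2 cg.
have i2 : leb.-integrable `[0, 2 * c] (EFin \o (fun t => f (1 - t / c))).
  have cKg : {within `[0, 2 * c], continuous (fun t => K^-1 * g (1 - t / c))}.
    by apply: withinM; [exact: within_cst|exact: cg'].
  apply: eq_integrable (wint_integrable w1 cKg) => //.
  move=> t; rewrite inE /= in_itv /= => tI.
  by rewrite mulrCA E// mulrA mulVf// mul1r.
rewrite /wint (_ : \int[leb]_(x in `[0, 2 * c]) _ = \int[leb]_(t in `[0, 2 * c]) (K * f (1 - t / c))); last first.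
  by apply: eq_Rintegral => t; rewrite inE /= in_itv /= => tI; exact: E.
rewrite RintegralZl//.
rewrite integral_affine//; last first.
  move=> x xI; apply: cvgM; first exact: continuous_jacobi.
  exact: within_itv_for cg xI.
rewrite mulrA; congr (_ * _).
rewrite powRD ?powRr1 ?(ltW c0)//; last by rewrite (gt_eqF c0) implybT.
by rewrite /K powRrM powR_mulrn ?(ltW c0)// expr2.
Qed.

End Substitution.

(** * The weighted X-ray transform as a chord mean *)

Section Chords.
Context {R : realType}.
Variable gamma : R.
Hypothesis gamma_gtN1 : -1 < gamma.
Local Open Scope complex_scope.

Definition open_disc : set (R * R) := [set p | Normc.normc (p.1 +i* p.2) < 1].

Lemma open_discE (p : R * R) : open_disc p = (p.1 ^+ 2 + p.2 ^+ 2 < 1) :> Prop.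
Proof.
rewrite /open_disc /Normc.normc /=; congr is_true.
by rewrite -[X in _ < X]sqrtr1 ltr_sqrt// ltr01.
Qed.

Lemma closure_open_disc : closure open_disc = disc.
Proof.
apply/seteqP; split.
  move=> p cp; apply: (@closed_disc R).
  by apply: (closureS _ cp) => q; rewrite open_discE /disc /= => /ltW.
move=> p dp B nB.
have ct : continuous (fun s : R => ((1 - s) * p.1, (1 - s) * p.2)).
  by apply: continuous_pairf => s; apply: cvgM; [apply: cvgB; [exact: cvg_cst|exact: cvg_id]|exact: cvg_cst|apply: cvgB; [exact: cvg_cst|exact: cvg_id]|exact: cvg_cst].
have nB' : nbhs ((1 - 0) * p.1, (1 - 0) * p.2) B by rewrite subr0 !mul1r; case: (p) nB.
have /nbhs_ballP[d /= d0 Hd] := ct 0 _ nB'.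
pose s := Num.min (d / 2) 1.
have s0 : 0 < s by rewrite lt_min divr_gt0// ltr01.
have s1 : s <= 1 by rewrite ge_min lexx orbT.
have sd : s < d by rewrite gt_min ltr_pdivrMr// ltr_pMr// ltr1n.
exists ((1 - s) * p.1, (1 - s) * p.2); split; last first.
  by apply: Hd; rewrite /ball /= sub0r normrN gtr0_norm.
rewrite open_discE /= !exprMn -mulrDr; move: dp; rewrite /disc /= => dp.
apply: (@le_lt_trans _ _ ((1 - s) ^+ 2)); first by rewrite ler_piMr ?sqr_ge0.
by rewrite expr2; nra.
Qed.

Lemma chord_point (b a t : R) : cos a != 0 -> expi b + t%:C * expi (b + pi + a) =
  (chord_pt (b + a) a (1 - t / cos a)).1 +i* (chord_pt (b + a) a (1 - t / cos a)).2.
Proof.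
move=> c0; have E : cos b = cos ((b + a) - a) /\ sin b = sin ((b + a) - a) by rewrite addrK.
rewrite (_ : b + pi + a = (b + a) + pi); last by ring.
rewrite /expi cosDpi sinDpi; case: E => -> ->; move: (b + a) => w.
rewrite /chord_pt cosB sinB; apply/eqP; rewrite eq_complex /=; apply/andP; split; apply/eqP; field; exact: c0.
Qed.

Lemma bdef_chord_pt (w a v : R) :
  bdef ((chord_pt w a v).1 +i* (chord_pt w a v).2) = cos a ^+ 2 * (1 - v ^+ 2).
Proof.
rewrite /bdef /Normc.normc sqr_sqrtr ?addr_ge0 ?sqr_ge0// chord_pt_sqr sin2cos2; ring.
Qed.

Lemma chord_weight (a t : R) : 0 < cos a -> cos a ^+ 2 * (1 - (1 - t / cos a) ^+ 2) = (t - 0) * (2 * cos a - t).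
Proof. by move=> c0; field; rewrite gt_eqF. Qed.

Lemma I0_chord (f : R[i] -> R[i]) b a : inward_interior (b, a) ->
  {within disc, continuous (fun p : R * R => complex.Re (f (p.1 +i* p.2)))} ->
  {within disc, continuous (fun p : R * R => complex.Im (f (p.1 +i* p.2)))} ->
  I0 (weight_mul gamma f) (b, a) =
   (cos a `^ (2 * gamma + 1) * chord gamma (fun p => complex.Re (f (p.1 +i* p.2))) (b + a) a) +i*
   (cos a `^ (2 * gamma + 1) * chord gamma (fun p => complex.Im (f (p.1 +i* p.2))) (b + a) a).
Proof.
move=> ai cR cI; have c0 : 0 < cos a by apply: cos_gt0_pihalf; exact: ai.
have cn : cos a != 0 by rewrite gt_eqF.
rewrite /I0 /cintegral /=; congr (_ +i* _).
  rewrite /chord -(@wint_jacobi_affine _ _ (fun v => complex.Re (f ((chord_pt (b + a) a v).1 +i* (chord_pt (b + a) a v).2)))) //; last first.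
    exact: (@within_chord _ (fun p => complex.Re (f (p.1 +i* p.2))) (b + a) a cR).
  apply: eq_Rintegral => t _; rewrite chord_point// /weight_mul bdef_chord_pt chord_weight// /jacobi_weight.
  by case: (f _) => x y /=; rewrite mul0r subr0.
rewrite /chord -(@wint_jacobi_affine _ _ (fun v => complex.Im (f ((chord_pt (b + a) a v).1 +i* (chord_pt (b + a) a v).2)))) //; last first.
  exact: (@within_chord _ (fun p => complex.Im (f (p.1 +i* p.2))) (b + a) a cI).
apply: eq_Rintegral => t _; rewrite chord_point// /weight_mul bdef_chord_pt chord_weight// /jacobi_weight.
by case: (f _) => x y /=; rewrite mul0r addr0.
Qed.

End Chords.

(** * Moments as double integrals over the inward boundary *)

Section TorusMoments.
Context {R : realType}.
Variable gamma : R.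
Hypothesis gamma_gtN1 : -1 < gamma.
Notation lam := (gamma + 1).
Notation C := (gegen lam).
Notation leb := (@lebesgue_measure R).
Implicit Types (H F : R * R -> R).
Let tp0 : 0 <= 2 * pi :> R. Proof. by rewrite mulr_ge0// pi_ge0. Qed.
Let hp0 : - (pi / 2) <= pi / 2 :> R. Proof. by have := pi_gt0 R; lra. Qed.

(** Coordinates w = beta + alpha and a = alpha: [scat] becomes (w + 2 pi, pi - a) and
    [antipodal_scat] becomes (w + pi, - a). *)
Definition shear H (w a : R) := H (w - a, a).

Lemma continuous_shear H : continuous H -> continuous (fun p : R * R => shear H p.1 p.2).
Proof.
move=> cH p; apply: (@continuous_comp _ _ _ (fun p : R * R => (p.1 - p.2, p.2)) H); last exact: cH.
apply: continuous_pairf => q; last exact: cvg_snd.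
by apply: cvgB; [exact: cvg_fst|exact: cvg_snd].
Qed.

(** [moment] with a real frequency, since n - 2 k may be negative. *)
Definition zmoment n (l e : R) G :=
  pint (fun w => cos (l * w + e) * aint gamma (fun a => G w a * (C n).[sin a])).

Definition zkernel n (l e : R) H (p : R * R) :=
  aweight gamma p.2 * (C n).[sin p.2] * H p * cos (l * (p.1 + p.2) + e).

Lemma continuous_zkernel n l e H : continuous H -> continuous (zkernel n l e H).
Proof.
move=> cH p; apply: cvgM.
  apply: cvgM; last exact: cH.
  apply: cvgM.
    by apply: (@continuous_comp _ _ _ snd (aweight gamma)); [exact: cvg_snd|exact: continuous_aweight].
  by apply: (@continuous_comp _ _ _ snd (fun a => (C n).[sin a])); [exact: cvg_snd|exact: continuous_sinpoly].
apply: (@continuous_comp _ _ _ (fun p : R * R => p.1 + p.2) (fun w => cos (l * w + e))); last exact: continuous_cos_affine.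
by apply: cvgD; [exact: cvg_fst|exact: cvg_snd].
Qed.

Lemma cos_int_per (l : int) (x : R) : cos (l%:~R * (x + 2 * pi)) = cos (l%:~R * x) /\
  sin (l%:~R * (x + 2 * pi)) = sin (l%:~R * x).
Proof.
case: l => m; first by rewrite -pmulrn mulrDr cos_nat_per sin_nat_per.
by rewrite NegzE mulrNz -pmulrn !mulNr !cosN !sinN mulrDr cos_nat_per sin_nat_per.
Qed.

(** For fixed a the passage to w = b + a is a shift of a periodic function, the frequency l being an
    integer; the order of integration is then exchanged. *)
Lemma integral_zkernel n (l : int) e H : continuous H -> (forall a, per2pi (fun w => H (w, a))) ->
  rint (- (pi / 2)) (pi / 2) (fun a => rint 0 (2 * pi) (fun b => zkernel n l%:~R e H (b, a))) =
  zmoment n l%:~R e (shear H).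
Proof.
move=> cH pH; have cZ := @continuous_zkernel n l%:~R e H cH.
pose Z (p : R * R) := zkernel n l%:~R e H (p.1 - p.2, p.2).
have cZ' : continuous Z by exact: (continuous_shear cZ).
transitivity (rint (- (pi / 2)) (pi / 2) (fun a => rint 0 (2 * pi) (fun w => Z (w, a)))).
  apply: eq_rint => a _; rewrite -/(pint _).
  rewrite -(@pint_shift _ (- a) (fun b => zkernel n l%:~R e H (b, a)))//.
    exact: (@continuous2_left _ _ a cZ).
  move=> b; rewrite /zkernel /= pH; congr (_ * _).
  have [h1 h2] := cos_int_per l (b + a).
  by rewrite (_ : b + 2 * pi + a = b + a + 2 * pi); [rewrite !cosD h1 h2|ring].
rewrite -rint_swap//; apply: eq_rint => w _.
rewrite aint_rint -rintZ; last first.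
  move=> a; apply: cvgM; first exact: continuous_aweight.
  apply: cvgM; last exact: continuous_sinpoly.
  exact: (@continuous2_right _ _ w (continuous_shear cH)).
by apply: eq_rint => a _; rewrite /Z /zkernel /shear /= subrK; ring.
Qed.

Lemma integral_zkernel2 n (l : int) e1 e2 H1 H2 (k : R) : continuous H1 -> continuous H2 ->
  (forall a, per2pi (fun w => H1 (w, a))) -> (forall a, per2pi (fun w => H2 (w, a))) ->
  \int[(leb \x leb)%E]_(p in (`[0, 2 * pi] `*` `[- (pi / 2), pi / 2]))
     (k * (zkernel n l%:~R e1 H1 p + zkernel n l%:~R e2 H2 p)) =
  k * (zmoment n l%:~R e1 (shear H1) + zmoment n l%:~R e2 (shear H2)).
Proof.
move=> c1 c2 p1 p2.
have z1 := @continuous_zkernel n l%:~R e1 H1 c1; have z2 := @continuous_zkernel n l%:~R e2 H2 c2.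
have z12 : continuous (fun p => zkernel n l%:~R e1 H1 p + zkernel n l%:~R e2 H2 p).
  by move=> p; apply: cvgD; [exact: z1|exact: z2].
have z : continuous (fun p => k * (zkernel n l%:~R e1 H1 p + zkernel n l%:~R e2 H2 p)).
  by move=> p; apply: cvgM; [exact: cvg_cst|exact: z12].
have [_ ->] := prod_rint_fubini z hp0 tp0.
have cr (F : R * R -> R) : continuous F -> continuous (fun a => rint 0 (2 * pi) (fun b => F (b, a))).
  move=> cF; apply: (@continuous_rint _ (fun p : R * R => F (p.2, p.1)) _ _ tp0) => p.
  apply: (@continuous_comp _ _ _ (fun p : R * R => (p.2, p.1)) F); last exact: cF.
  by apply: continuous_pairf => q; [exact: cvg_snd|exact: cvg_fst].
rewrite -(integral_zkernel n l e1 c1 p1) -(integral_zkernel n l e2 c2 p2).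
rewrite -rintD; [|exact: cr|exact: cr].
rewrite -rintZ; last by move=> a; apply: cvgD; exact: cr.
apply: eq_rint => a _; rewrite -rintD; [|exact: (@continuous2_left _ _ a z1)|exact: (@continuous2_left _ _ a z2)].
by rewrite -rintZ//; exact: (@continuous2_left _ _ a z12).
Qed.

Lemma zmoment_phase n l e G : continuous (fun p : R * R => G p.1 p.2) ->
  zmoment n l e G = cos e * zmoment n l 0 G - sin e * zmoment n l (- (pi / 2)) G.
Proof.
move=> cG.
have cGC : continuous (fun p : R * R => G p.1 p.2 * (C n).[sin p.2]).
  move=> p; apply: cvgM; first exact: cG.
  by apply: (@continuous_comp _ _ _ snd (fun a => (C n).[sin a])); [exact: cvg_snd|exact: continuous_sinpoly].
have cA := @continuous_aint _ _ gamma_gtN1 (fun w a => G w a * (C n).[sin a]) cGC.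
have cM e' : continuous (fun w : R => cos (l * w + e') * aint gamma (fun a => G w a * (C n).[sin a])).
  by move=> w; apply: cvgM; [exact: continuous_cos_affine|exact: cA].
have cMk k e' : continuous (fun w : R => k * (cos (l * w + e') * aint gamma (fun a => G w a * (C n).[sin a]))).
  by move=> w; apply: cvgM; [exact: cvg_cst|exact: cM].
rewrite /zmoment /pint -!rintZ; [|exact: cM|exact: cM].
rewrite -rintB; [|exact: cMk|exact: cMk].
by apply: eq_rint => w _; rewrite addr0 cosBpihalf cosD; ring.
Qed.

Lemma zmomentN n l e G : zmoment n (- l) e G = zmoment n l (- e) G.
Proof. by apply: eq_rint => w _; rewrite -[in LHS]cosN; congr (cos _ * _); ring. Qed.

End TorusMoments.

(** * Inner products in terms of moments, and the range *)

Section Range.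
Context {R : realType}.
Variable gamma : R.
Hypothesis gamma_gtN1 : -1 < gamma.
Notation lam := (gamma + 1).
Notation C := (gegen lam).
Local Open Scope complex_scope.

Lemma shear_props (F : R * R -> R) : (forall x y, F (x + 2 * pi, y) = F (x, y)) ->
  (forall x y, F (x, y + 2 * pi) = F (x, y)) -> (forall p, F (scat p) = F p) ->
  (forall p, inward p -> F (antipodal_scat p) = F p) -> smooth_up_to_boundary_real setT F ->
  continuous F /\ [/\ forall a, per2pi (fun w => shear F w a), forall w, per2pi (shear F w),
   forall w a, shear F w (pi - a) = shear F w a,
   forall w a, - (pi / 2) <= a <= pi / 2 -> shear F (w + pi) (- a) = shear F w a &
   forall q, exists K, forall w, lipn q K (shear F w)].
Proof.
move=> p1 p2 sF aF smF; have [cF [D [M [D0 sD bD]]]] := torus_family p1 p2 smF.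
split=> //; split.
- by move=> a w; rewrite /shear addrAC p1.
- by move=> w a; rewrite /shear p2 -p1; congr (F (_, _)); ring.
- move=> w a; rewrite /shear -[RHS]sF /scat /= -p1; congr (F (_, _)); ring.
- move=> w a aI; rewrite /shear -[RHS]aF//; congr (F (_, _)); rewrite /=; ring.
move=> q; exists (family_bound q M) => w.
rewrite (_ : shear F w = fun a => D 0%N 0%N (w - a) a); last by apply/funext => a; rewrite D0.
exact: lipn_family.
Qed.

(** At alpha = +- pi / 2 powers of 0 occur, and 0 to the power p is 0 unless p = 0. The exponents of
    u and v add up to 1, so they are not both 0 and u v = 0: the integrand vanishes there whatever
    the value of psi. *)
Lemma weight_product (a : R) : - (pi / 2) <= a <= pi / 2 ->
  let u := cos a `^ (2 * gamma + 1) in let v := cos a `^ (- (2 * gamma)) in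
  aweight gamma a = u * u * v /\ (- (pi / 2) < a < pi / 2 \/ u * v = 0).
Proof.
move=> aI u v; have l0 := lam_gt0 gamma_gtN1.
have [ai|ai] := boolP (- (pi / 2) < a < pi / 2).
  split; last by left.
  have c0 : 0 < cos a by exact: cos_gt0_pihalf.
  have cn (x : bool) : x ==> (cos a != 0) by rewrite gt_eqF ?implybT.
  rewrite /aweight ppowE ?(ltW c0)// /u /v -!powRD//; congr (_ `^ _); ring.
have c0 : cos a = 0.
  have [->|] : a = pi / 2 \/ a = - (pi / 2).
  - by move: ai; rewrite negb_and -!leNgt => /orP[] ?; [right|left]; lra.
  - exact: cos_pihalf.
  - by move=> ->; rewrite cosN cos_pihalf.
have uv : u * v = 0.
  rewrite /u /v c0; have [E|E] := eqVneq (2 * gamma + 1) 0; last by rewrite powR0// mul0r.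
  by rewrite (@powR0 _ (- (2 * gamma))) ?mulr0//; apply/eqP; lra.
split; last by right.
rewrite -mulrA uv mulr0 /aweight c0 ppowE// powR0// mulf_neq0 ?pnatr_eq0// gt_eqF//.
Qed.

(** Multiplying x + i y by e^(- i th) gives x cos th + y sin th and y cos th - x sin th; the phases
    come from sin th = cos (th - pi / 2) and - sin th = cos (th + pi / 2). *)
Lemma inner_zmoment (psi F : R * R -> R[i]) (L : nat -> {poly R}) (n : nat) (k : int) (kap : R) :
  continuous (fun p => complex.Re (F p)) -> continuous (fun p => complex.Im (F p)) ->
  (forall a, per2pi (fun w => complex.Re (F (w, a)))) -> (forall a, per2pi (fun w => complex.Im (F (w, a)))) ->
  (forall p, inward_interior p -> psi p = (mu p `^ (2 * gamma + 1))%:C * F p) ->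
  L n = kap%:P * C n ->
  let K := ((-1) ^+ n / (2 * pi)) * kap in let l := (n%:Z - 2 * k)%:~R in
  inner gamma psi (psi_nk gamma L n k) =
   (K * (zmoment gamma n l 0 (shear (fun p => complex.Re (F p))) + zmoment gamma n l (- (pi / 2)) (shear (fun p => complex.Im (F p))))) +i*
   (K * (zmoment gamma n l 0 (shear (fun p => complex.Im (F p))) + zmoment gamma n l (pi / 2) (shear (fun p => complex.Re (F p))))).
Proof.
move=> cR cI pR pI psiE LE K l.
have P p : (`[0, 2 * pi] `*` `[- (pi / 2), pi / 2]) p ->
   psi p * (psi_nk gamma L n k p)^* * (mu p `^ (- (2 * gamma)))%:C =
   (K * (zkernel gamma n l 0 (fun p => complex.Re (F p)) p + zkernel gamma n l (- (pi / 2)) (fun p => complex.Im (F p)) p)) +i*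
   (K * (zkernel gamma n l 0 (fun p => complex.Im (F p)) p + zkernel gamma n l (pi / 2) (fun p => complex.Re (F p)) p)).
  case: p => b a [_ /=]; rewrite in_itv /= => aI.
  have [aw H] := weight_product aI; move: aw H (psiE (b, a)); rewrite /psi_nk /mu /=.
  set u := cos a `^ _; set v := cos a `^ _ => aw H pE.
  rewrite LE hornerM hornerC /expi /zkernel /= aw addr0 cosBpihalf cosDpihalf -/l /K.
  move: (l * (b + a)) ((-1) ^+ n / (2 * pi)) (C n).[sin a] => th s Lv.
  case: H => [ai|uv].
    rewrite (pE ai); case: (F (b, a)) => x y.
    by apply/eqP; rewrite eq_complex /=; apply/andP; split; apply/eqP; ring.
  case: (F (b, a)) (psi (b, a)) => [x y] [x' y'].
  move/eqP: uv; rewrite mulf_eq0 => /orP[] /eqP ->;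
    by apply/eqP; rewrite eq_complex /=; apply/andP; split; apply/eqP; ring.
rewrite /inner /cintegral.
rewrite -(integral_zkernel2 gamma_gtN1 n (n%:Z - 2 * k) 0 (- (pi / 2)) K cR cI pR pI).
rewrite -(integral_zkernel2 gamma_gtN1 n (n%:Z - 2 * k) 0 (pi / 2) K cI cR pI pR).
by congr (_ +i* _); apply: eq_Rintegral => p; rewrite inE => pD; rewrite (P p pD).
Qed.

End Range.

(** r, s are the cosine and sine moments of the real part of the data, x, y those of the imaginary
    part. Frequency - m gives r = y and x = - s, frequency m gives r = - y and x = s, so the complex
    conditions separate into real ones. *)
Lemma phase_system (R : realFieldType) (K1 K2 r s x y : R) : K1 != 0 -> K2 != 0 ->
  K1 * (r + (0 * x - 1 * y)) = 0 -> K1 * (x + s) = 0 -> K2 * (r + y) = 0 -> K2 * (x + (0 * r - 1 * s)) = 0 ->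
  [/\ r = 0, s = 0, x = 0 & y = 0].
Proof.
move=> k1 k2 /eqP h1 /eqP h2 /eqP h3 /eqP h4.
move: h1 h2 h3 h4; rewrite !mulf_eq0 (negbTE k1) (negbTE k2) /= => /eqP h1 /eqP h2 /eqP h3 /eqP h4.
by split; lra.
Qed.

Theorem theorem4 (R : realType) (gamma : R) (gamma_gtN1 : -1 < gamma)
    (L : nat -> {poly R}) (hL : orthogonal_polynomials gamma L)
    (psi : R * R -> R[i]) (hpsi : weighted_C_alpha_plus_plus gamma psi) :
  in_range_I0 gamma psi <->
  (forall (n : nat) (k : int), ~~ (0 <= k <= n%:Z) ->
     inner gamma psi (psi_nk gamma L n k) = 0).
Proof.
case: hpsi => g [[_ [F [F1 F2 Fg Fs] [_ _ [smR smI]]]] ga] psiE.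
pose FR p := complex.Re (F p); pose FI p := complex.Im (F p).
have Fa p : inward p -> F (antipodal_scat p) = F p.
  move=> ip; have ip' : inward (antipodal_scat p).
    by move: ip; rewrite /inward /=; case: p => x y /=; lra.
  by rewrite !Fg ?inE// ga// inE.
have [cR [perwR peraR reflR flipR lipR]] : continuous FR /\ _ :=
  @shear_props _ FR (fun x y => congr1 _ (F1 x y)) (fun x y => congr1 _ (F2 x y)) (fun p => congr1 _ (Fs p))
    (fun p ip => congr1 _ (Fa p ip)) smR.
have [cI [perwI peraI reflI flipI lipI]] : continuous FI /\ _ :=
  @shear_props _ FI (fun x y => congr1 _ (F1 x y)) (fun x y => congr1 _ (F2 x y)) (fun p => congr1 _ (Fs p))
    (fun p ip => congr1 _ (Fa p ip)) smI.
have csR := continuous_shear cR; have csI := continuous_shear cI.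
have ii (p : R * R) : inward_interior p -> inward p by move=> /andP[h1 h2]; apply/andP; split; exact: ltW.
have psiF p : inward_interior p -> psi p = (real_complex R (mu p `^ (2 * gamma + 1))) * F p.
  by move=> ip; rewrite psiE ?inE// Fg ?inE//; exact: ii.
have pR a : per2pi (fun w => FR (w, a)) by move=> w; rewrite /FR F1.
have pI a : per2pi (fun w => FI (w, a)) by move=> w; rewrite /FI F1.
have innerE n k : exists2 K, K != 0 & forall l, l = (n%:Z - 2 * k)%:~R ->
   inner gamma psi (psi_nk gamma L n k) =
   Complex (K * (zmoment gamma n l 0 (shear FR) + zmoment gamma n l (- (pi / 2)) (shear FI)))
           (K * (zmoment gamma n l 0 (shear FI) + zmoment gamma n l (pi / 2) (shear FR))).
  have [kap kap0 LE] := orthogonal_gegen gamma_gtN1 hL n.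
  exists (((-1) ^+ n / (2 * pi)) * kap); last first.
    by move=> l ->; exact: (@inner_zmoment _ _ gamma_gtN1 psi F L n k kap cR cI pR pI psiF LE).
  by rewrite mulf_neq0// mulf_neq0 ?invr_eq0 ?mulf_neq0 ?pnatr_eq0 ?signr_eq0 ?gt_eqF ?pi_gt0.
split.
  move=> [f [smfR smfI] psiI] n k kn.
  pose fR (p : R * R) := complex.Re (f (Complex p.1 p.2)); pose fI (p : R * R) := complex.Im (f (Complex p.1 p.2)).
  have cf (h : R * R -> R) : smooth_up_to_boundary_real open_disc h -> {within disc, continuous h}.
    move=> [D]; rewrite closure_open_disc => -[D0 cD _].
    apply: subspace_eq_continuous (cD 0%N 0%N) => p pd.
    by apply: D0.
  have cfR : {within disc, continuous fR} by exact: cf.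
  have cfI : {within disc, continuous fI} by exact: cf.
  have E w a : - (pi / 2) < a < pi / 2 -> shear FR w a = chord gamma fR w a /\ shear FI w a = chord gamma fI w a.
    move=> ai; have ip : inward_interior (w - a, a) by [].
    have := psiI (w - a, a); rewrite inE => /(_ ip); rewrite psiF// (I0_chord gamma_gtN1 ip cfR cfI) subrK /mu /=.
    have u0 : cos a `^ (2 * gamma + 1) != 0 by rewrite gt_eqF// powR_gt0// cos_gt0_pihalf.
    rewrite /shear /FR /FI; case: (F (w - a, a)) => x y [].
    by rewrite !mul0r subr0 addr0 => h1 h2; split; apply: (mulfI u0).
  have Z (l : int) e G f0 : (n < `|l|)%N -> {within disc, continuous f0} -> continuous (fun p : R * R => G p.1 p.2) ->
     (forall w a, - (pi / 2) < a < pi / 2 -> G w a = chord gamma f0 w a) -> zmoment gamma n l%:~R e G = 0.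
    move=> nl cf0 cG GE; case: l nl => m nl.
      exact: (chord_moment gamma_gtN1 e nl cf0 cG GE).
    rewrite NegzE mulrNz zmomentN.
    exact: (@chord_moment _ _ gamma_gtN1 f0 G n m.+1 (- e) nl cf0 cG GE).
  (* For k outside {0, .., n} the frequency n - 2 k exceeds n in absolute value. *)
  have nl : (n < `|(n%:Z - 2 * k)%R|)%N by move: kn; lia.
  have [K _ HK] := innerE n k; rewrite (HK _ erefl).
  have ZR e : zmoment gamma n (n%:Z - 2 * k)%:~R e (shear FR) = 0.
    by apply: (Z _ e _ _ nl cfR csR) => w a ai; exact: (E w a ai).1.
  have ZI e : zmoment gamma n (n%:Z - 2 * k)%:~R e (shear FI) = 0.
    by apply: (Z _ e _ _ nl cfI csI) => w a ai; exact: (E w a ai).2.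
  by rewrite !ZR !ZI addr0 mulr0.
move=> H.
have mom n m : (n < m)%N -> ~~ odd (m + n) -> [/\ zmoment gamma n m%:R 0 (shear FR) = 0,
   zmoment gamma n m%:R (- (pi / 2)) (shear FR) = 0, zmoment gamma n m%:R 0 (shear FI) = 0 &
   zmoment gamma n m%:R (- (pi / 2)) (shear FI) = 0].
  move=> nm om.
  (* The equal parity of m and n makes m = n - 2 k1 and - m = n - 2 k2 solvable, and m > n puts k1
     below 0 and k2 above n. *)
  pose k1 : int := - ((m - n)./2)%:Z; pose k2 : int := n%:Z - k1.
  have l1 : m%:R = (n%:Z - 2 * k1)%:~R :> R by rewrite (_ : n%:Z - 2 * k1 = m%:Z)// /k1; lia.
  have l2 : - m%:R = (n%:Z - 2 * k2)%:~R :> R by rewrite (_ : n%:Z - 2 * k2 = - m%:Z) ?rmorphN// /k2 /k1; lia.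
  have nk1 : ~~ (0 <= k1 <= n%:Z) by rewrite /k1; lia.
  have nk2 : ~~ (0 <= k2 <= n%:Z) by rewrite /k2 /k1; lia.
  have [K1 K10 E1] := innerE n k1; have [K2 K20 E2] := innerE n k2.
  have := H n k1 nk1; have := H n k2 nk2; rewrite (E1 _ l1) (E2 _ l2) !zmomentN opprK oppr0.
  rewrite (zmoment_phase gamma_gtN1 n m%:R (pi / 2) csR) (zmoment_phase gamma_gtN1 n m%:R (pi / 2) csI).
  rewrite cos_pihalf sin_pihalf => -[h1 h2] [h3 h4].
  exact: (phase_system K20 K10 h1 h2 h3 h4).
have momR n m e : (n < m)%N -> ~~ odd (m + n) -> moment gamma n m e (shear FR) = 0.
  move=> nm om; have [h1 h2 _ _] := mom n m nm om.
  by rewrite -[LHS]/(zmoment gamma n m%:R e (shear FR)) zmoment_phase// h1 h2 !mulr0 subr0.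
have momI n m e : (n < m)%N -> ~~ odd (m + n) -> moment gamma n m e (shear FI) = 0.
  move=> nm om; have [_ _ h1 h2] := mom n m nm om.
  by rewrite -[LHS]/(zmoment gamma n m%:R e (shear FI)) zmoment_phase// h1 h2 !mulr0 subr0.
(* The chord transform is real, so real and imaginary parts are inverted separately. *)
have [DR [cDR dDR eDR]] := inversion gamma_gtN1 csR perwR peraR reflR flipR lipR momR.
have [DI [cDI dDI eDI]] := inversion gamma_gtN1 csI perwI peraI reflI flipI lipI momI.
pose f (z : R[i]) : R[i] := Complex (DR 0%N 0%N (complex.Re z, complex.Im z)) (DI 0%N 0%N (complex.Re z, complex.Im z)).
have fR : (fun p : R * R => complex.Re (f (Complex p.1 p.2))) = DR 0%N 0%N by apply/funext => -[].
have fI : (fun p : R * R => complex.Im (f (Complex p.1 p.2))) = DI 0%N 0%N by apply/funext => -[].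
have sm (D : nat -> nat -> R * R -> R) : (forall r s, {within disc, continuous (D r s)}) ->
    (forall r s (p : R * R), p.1 ^+ 2 + p.2 ^+ 2 < 1 ->
        is_derive p (1, 0 : R) (D r s) (D r.+1 s p) /\ is_derive p (0, 1 : R) (D r s) (D r s.+1 p)) ->
    smooth_up_to_boundary_real open_disc (D 0%N 0%N).
  move=> cD dD; exists D; rewrite closure_open_disc; split => // j k p.
  by rewrite open_discE; exact: dD.
exists f.
  split; [rewrite /= -[X in smooth_up_to_boundary_real _ X]/(fun p : R * R => complex.Re (f (Complex p.1 p.2))) fR|
          rewrite /= -[X in smooth_up_to_boundary_real _ X]/(fun p : R * R => complex.Im (f (Complex p.1 p.2))) fI]; exact: sm.
move=> [b a]; rewrite inE => ip.
have cfR : {within disc, continuous (fun p : R * R => complex.Re (f (Complex p.1 p.2)))} by rewrite fR.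
have cfI : {within disc, continuous (fun p : R * R => complex.Im (f (Complex p.1 p.2)))} by rewrite fI.
rewrite (I0_chord gamma_gtN1 ip cfR cfI) fR fI eDR ?eDI ?(ii _ ip)//.
rewrite psiF// /shear addrK /FR /FI /mu /=; case: (F (b, a)) => x y /=.
by apply/eqP; rewrite eq_complex /=; apply/andP; split; apply/eqP; ring.
Qed.
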